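(* Let $K$ be a finite strongly connected oriented two-dimensional simplicial complex, let $K_1$ be the set of all 1-dimensional simplices of $K$, and let $P:K\to\mathbb{R}^3$ be an oriented polyhedron with nondegenerate triangular faces. Let $L=\bigcup_{\sigma\in K_1}\{\ell_\sigma\}$ be the set of the lengths $\ell_\sigma$ of all edges $P(\sigma)$ of $P$, and let $\{\lambda_1,\dots,\lambda_m\}$ be a $\mathbb{Q}$-basis of the $\mathbb{Q}$-linear span of $L$ in $\mathbb{R}$; that is, the reals $\lambda_1,\dots,\lambda_m$ are $\mathbb{Q}$-linearly independent and for every $\sigma\in K_1$ there are $\alpha_{\sigma j}\in\mathbb{Q}$ such that $$\ell_\sigma=\sum_{j=1}^m\alpha_{\sigma j}\lambda_j .$$ Then, for every flex $\{P_t\}_{t\in[0,1]}$ of $P$ and every $j=1,\dots,m$, the expression $$\sum_{\sigma\in K_1}\alpha_{\sigma j}\,\widetilde{\varphi}_\sigma(t)$$ is independent of $t\in[0,1]$, where $\widetilde{\varphi}_\sigma(t)$ denotes the dihedral angle at the edge $P(\sigma)$ during the flex $\{P_t\}_{t\in[0,1]}$.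
   Context: **Complexes.** A non-empty finite set $K$ of simplices in a Euclidean space is a *finite strongly connected two-dimensional simplicial complex* if: (i) each face of a simplex in $K$ is in $K$; (ii) the intersection of any two simplices of $K$ is a face of each of them; (iii) each simplex of $K$ is contained in a 2-dimensional simplex of $K$; (iv) every 1-dimensional simplex of $K$ is contained in exactly two 2-dimensional simplices of $K$; (v) for any two 2-dimensional simplices $\sigma,\tau\in K$ there is a sequence of 2-dimensional simplices $\sigma=\sigma_1,\dots,\sigma_n=\tau$ of $K$ such that $\sigma_j\cap\sigma_{j+1}$ is a 1-dimensional simplex of $K$ for all $j=1,\dots,n-1$. $K_i$ denotes the set of $i$-dimensional simplices of $K$. $K$ is *oriented* if each of its 2-dimensional simplices is equipped with an orientation and these are consistent: whenever $\sigma\in K_1$ is contained in two distinct $\tau_1,\tau_2\in K_2$, they induce opposite orientations on $\sigma$. **Polyhedra.** A *polyhedron* of combinatorial type $K$ is a mapping $P:K\to\mathbb{R}^3$ (i.e. a map defined on the union of the simplices of $K$) whose restriction to each simplex of $K$ is affine; self-intersections are allowed. For $\sigma\in K_i$, $P(\sigma)$ is called a vertex, edge or face of $P$ for $i=0,1,2$ respectively. $P$ has *nondegenerate (triangular) faces* if $P(\sigma)$ is a nondegenerate 2-dimensional simplex for every $\sigma\in K_2$. If $K$ is oriented, $P$ is called *oriented*. **Flexes.** A *flex* of $P$ is a continuous family $\{P_t\}_{t\in[0,1]}$ of polyhedra $P_t:K\to\mathbb{R}^3$ with $P_0=P$ such that for every $\sigma\in K_2$ and $t\in(0,1]$ the face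 $P_t(\sigma)$ is congruent to $P_0(\sigma)$. **Dihedral angles.** Let $P$ be an oriented polyhedron with nondegenerate faces, $\sigma\in K_1$, and let $\tau_1,\tau_2\in K_2$ be the two 2-simplices with $\sigma=\tau_1\cap\tau_2$. Let $\boldsymbol{n}(\tau_i)$ be the unit normal to $P(\tau_i)$ positively oriented according to the orientation of $K$ (if $(a,b,c)$ is a positively ordered vertex triple of $\tau_i$, then $\boldsymbol{n}(\tau_i)$ is the normalization of $(P(b)-P(a))\times(P(c)-P(a))$). If $\boldsymbol{n}(\tau_1)+\boldsymbol{n}(\tau_2)\ne 0$, let $\boldsymbol{x}$ be any point of $P(\sigma)$ that is not a vertex of $P(K)$, and $B(\boldsymbol{x})$ a ball centered at $\boldsymbol{x}$ which meets no edge of the faces $P(\tau_1),P(\tau_2)$ other than $P(\sigma)$. The set $P(\tau_1)\cup P(\tau_2)$ divides $B(\boldsymbol{x})$ into two bodies; let $B_+(\boldsymbol{x})$ be the one whose interior contains the points $\boldsymbol{x}+\frac12\varepsilon(\boldsymbol{n}(\tau_1)+\boldsymbol{n}(\tau_2))$, where $\varepsilon>0$ is less than the radius of $B(\boldsymbol{x})$. The *principal value of the dihedral angle* of $P$ at $P(\sigma)$ is $\varphi_\sigma=2\pi\,\mathrm{Vol}(B_+(\boldsymbol{x}))/\mathrm{Vol}(B(\boldsymbol{x}))$ (independent of the choice of $\boldsymbol{x}$). If $\boldsymbol{n}(\tau_1)+\boldsymbol{n}(\tau_2)=0$, put $\varphi_\sigma=0$. The *oriented dihedral angle* at $P(\sigma)$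 is the set $\Phi_\sigma=\{\varphi_\sigma+2\pi m : m\in\mathbb{Z}\}$. Given a flex $\{P_t\}_{t\in[0,1]}$ of $P$, let $\Phi_\sigma(t)$ be the oriented dihedral angle of $P_t$ at $P_t(\sigma)$. The *dihedral angle at the edge $P(\sigma)$ during the flex* is the continuous function $\widetilde{\varphi}_\sigma:[0,1]\to\mathbb{R}$ with $\widetilde{\varphi}_\sigma(t)\in\Phi_\sigma(t)$ for all $t$ and $\widetilde{\varphi}_\sigma(0)=\varphi_\sigma$, the principal value of the dihedral angle of $P$ at $P(\sigma)$ (the multivalued map $t\mapsto\Phi_\sigma(t)$ is continuous, so such a selection exists). *)

(* Defs.v *)
From HB Require Import structures.
From mathcomp Require Import all_boot all_order all_algebra finmap.
From mathcomp Require Import all_classical all_reals all_analysis.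
Set Implicit Arguments.
Unset Strict Implicit.
Unset Printing Implicit Defensive.
Import Order.TTheory GRing.Theory Num.Theory.
Import numFieldNormedType.Exports.
Local Open Scope classical_set_scope.
Local Open Scope ring_scope.

(* The library norm on 'rV[R]_n is the max norm, hence the Euclidean one here. *)
Definition dotp (R : realType) (n : nat) (u v : 'rV[R]_n) : R :=
  \sum_i u 0 i * v 0 i.

Definition enorm (R : realType) (n : nat) (u : 'rV[R]_n) : R :=
  Num.sqrt (dotp u u).

Definition eball (R : realType) (n : nat) (x : 'rV[R]_n) (r : R) :
    set 'rV[R]_n :=
  [set y | enorm (y - x) < r].

Definition vec3 (R : realType) (a b c : R) : 'rV[R]_3 :=
  \row_i nth 0 [:: a; b; c] i.

Definition crossp (R : realType) (u v : 'rV[R]_3) : 'rV[R]_3 :=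
  let x := u 0 in let y := v 0 in
  let i0 := inord 0 in let i1 := inord 1 in let i2 := inord 2 in
  vec3 (x i1 * y i2 - x i2 * y i1)
       (x i2 * y i0 - x i0 * y i2)
       (x i0 * y i1 - x i1 * y i0).

Definition volume (R : realType) (A : set 'rV[R]_3) : \bar R :=
  ((@lebesgue_measure R \x @lebesgue_measure R) \x @lebesgue_measure R)%E
    [set p : (R * R) * R | A (vec3 p.1.1 p.1.2 p.2)].

Definition congruent (R : realType) (n : nat) (A B : set 'rV[R]_n) : Prop :=
  exists2 f : 'rV[R]_n -> 'rV[R]_n,
    (forall x y, enorm (f x - f y) = enorm (x - y)) & f @` A = B.

(* A simplex is encoded by the finite set of its vertices; the simplex as a    *)
(* point set is the hull. The empty vertex set has empty hull.                 *)
Definition hull (R : realType) (n : nat) (s : {fset 'rV[R]_n}) :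
    set 'rV[R]_n :=
  [set x | exists w : 'rV[R]_n -> R,
     [/\ forall v, v \in s -> 0 <= w v,
         \sum_(v <- s) w v = 1 &
         x = \sum_(v <- s) w v *: v]].

Definition affinely_independent (R : realType) (n : nat)
    (s : {fset 'rV[R]_n}) : Prop :=
  forall w : 'rV[R]_n -> R,
    \sum_(v <- s) w v = 0 -> \sum_(v <- s) w v *: v = 0 ->
    forall v, v \in s -> w v = 0.

Definition is_simplex (R : realType) (n d : nat) (s : {fset 'rV[R]_n}) : Prop :=
  #|` s| = d.+1 /\ affinely_independent s.

Definition simplices (R : realType) (n : nat) (K : {fset {fset 'rV[R]_n}})
    (d : nat) : {fset {fset 'rV[R]_n}} :=
  [fset s in K | #|` s| == d.+1]%fset.

Definition support_of (R : realType) (n : nat) (K : {fset {fset 'rV[R]_n}}) :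
    set 'rV[R]_n :=
  [set x | exists2 s, s \in K & hull s x].

(* Finite, by the type of K. In scc_inter the common face may be empty. By      *)
(* scc_inter and affine independence, containment and intersection of          *)
(* simplices of K amount to those of their vertex sets, which is how scc_pure, *)
(* scc_edge and scc_connected express them.                                    *)
Record strongly_connected_complex (R : realType) (n : nat)
    (K : {fset {fset 'rV[R]_n}}) : Prop := StronglyConnectedComplex {
  scc_nonempty : K != fset0;
  scc_simplex : forall s, s \in K -> exists d, is_simplex d s;
  scc_face : forall s f, s \in K -> (f `<=` s)%fset -> f != fset0 -> f \in K;
  scc_inter : forall s t, s \in K -> t \in K ->
    exists f, [/\ (f `<=` s)%fset, (f `<=` t)%fset &
                  hull s `&` hull t = hull f];
  scc_pure : forall s, s \in K ->
    exists2 t, t \in simplices K 2 & (s `<=` t)%fset;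
  scc_edge : forall s, s \in simplices K 1 ->
    #|` [fset t in simplices K 2 | (s `<=` t)%fset]%fset| = 2%N;
  scc_connected : forall s t, s \in simplices K 2 -> t \in simplices K 2 ->
    exists2 p : seq {fset 'rV[R]_n},
      path (fun a b => (b \in simplices K 2) &&
                       ((a `&` b)%fset \in simplices K 1)) s p
      & last s p = t
}.

(* [o t] is a positively ordered vertex triple of the 2-simplex t; only its    *)
(* class up to cyclic permutation matters below.                               *)
Definition induces (R : realType) (n : nat)
    (o : {fset 'rV[R]_n} -> 'rV[R]_n * 'rV[R]_n * 'rV[R]_n)
    (t : {fset 'rV[R]_n}) (u v : 'rV[R]_n) : bool :=
  let: (a, b, c) := o t in (u, v) \in [:: (a, b); (b, c); (c, a)].

Record orientation (R : realType) (n : nat) (K : {fset {fset 'rV[R]_n}})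
    (o : {fset 'rV[R]_n} -> 'rV[R]_n * 'rV[R]_n * 'rV[R]_n) : Prop :=
  Orientation {
  or_vertices : forall t, t \in simplices K 2 ->
    let: (a, b, c) := o t in t = [fset a; b; c]%fset;
  or_consistent : forall t1 t2 u v,
    t1 \in simplices K 2 -> t2 \in simplices K 2 -> t1 != t2 ->
    ([fset u; v] `<=` t2)%fset -> induces o t1 u v -> induces o t2 v u
}.

(* P is a total function, but only its values on the support of K are used.    *)
Definition polyhedron (R : realType) (n : nat) (K : {fset {fset 'rV[R]_n}})
    (P : 'rV[R]_n -> 'rV[R]_3) : Prop :=
  forall s, s \in K -> forall x y (l : R), hull s x -> hull s y ->
    0 <= l <= 1 -> P (l *: x + (1 - l) *: y) = l *: P x + (1 - l) *: P y.

Definition nondegenerate_faces (R : realType) (n : nat)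
    (K : {fset {fset 'rV[R]_n}}) (P : 'rV[R]_n -> 'rV[R]_3) : Prop :=
  forall s, s \in simplices K 2 -> is_simplex 2 [fset P v | v in s]%fset.

(* Since each P t is affine on each of the finitely many simplices, pointwise  *)
(* continuity in t is the same as uniform or joint continuity.                 *)
Record flex (R : realType) (n : nat) (K : {fset {fset 'rV[R]_n}})
    (P : 'rV[R]_n -> 'rV[R]_3) (Pt : R -> 'rV[R]_n -> 'rV[R]_3) : Prop := Flex {
  flex_polyhedron : forall t, 0 <= t <= 1 -> polyhedron K (Pt t);
  flex_continuous : forall x, support_of K x ->
    {within `[0, 1]%classic, continuous (fun t => Pt t x)};
  flex_start : forall x, support_of K x -> Pt 0 x = P x;
  flex_congruent : forall s t, s \in simplices K 2 -> 0 < t <= 1 ->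
    congruent (Pt 0 @` hull s) (Pt t @` hull s)
}.

(* Meaningful when s has exactly two elements. *)
Definition edge_length (R : realType) (n : nat) (P : 'rV[R]_n -> 'rV[R]_3)
    (s : {fset 'rV[R]_n}) : R :=
  enorm (P (enum_fset s)`_0 - P (enum_fset s)`_1).

Definition normal (R : realType) (n : nat)
    (o : {fset 'rV[R]_n} -> 'rV[R]_n * 'rV[R]_n * 'rV[R]_n)
    (P : 'rV[R]_n -> 'rV[R]_3) (t : {fset 'rV[R]_n}) : 'rV[R]_3 :=
  let: (a, b, c) := o t in
  let w := crossp (P b - P a) (P c - P a) in (enorm w)^-1 *: w.

Definition admissible_ball (R : realType) (n : nat)
    (K : {fset {fset 'rV[R]_n}}) (P : 'rV[R]_n -> 'rV[R]_3)
    (s t1 t2 : {fset 'rV[R]_n}) (x : 'rV[R]_3) (r : R) : Prop :=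
  [/\ (P @` hull s) x,
      forall v, [fset v]%fset \in K -> x <> P v,
      0 < r &
      forall e, e \in simplices K 1 -> e != s ->
        (e `<=` t1)%fset || (e `<=` t2)%fset ->
        eball x r `&` (P @` hull e) = set0].

(* The part of the ball B(x, r) cut off by P(t1) and P(t2) that contains the   *)
(* points x + e/2 nu, where nu is the sum of the two normals. The points of    *)
(* the two faces themselves are left out, which does not affect the volume.    *)
Definition positive_body (R : realType) (n : nat) (P : 'rV[R]_n -> 'rV[R]_3)
    (t1 t2 : {fset 'rV[R]_n}) (nu x : 'rV[R]_3) (r : R) : set 'rV[R]_3 :=
  [set y | exists2 e : R, 0 < e < r &
     connected_component (eball x r `\` (P @` hull t1 `|` P @` hull t2))
       (x + (e / 2) *: nu) y].

(* The value does not depend on x, r, nor on the order of t1 and t2, so this   *)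
(* holds of exactly one phi when s is an edge and the faces are nondegenerate. *)
Definition is_principal_value (R : realType) (n : nat)
    (K : {fset {fset 'rV[R]_n}})
    (o : {fset 'rV[R]_n} -> 'rV[R]_n * 'rV[R]_n * 'rV[R]_n)
    (P : 'rV[R]_n -> 'rV[R]_3) (s : {fset 'rV[R]_n}) (phi : R) : Prop :=
  exists t1 t2, [/\ t1 \in simplices K 2, t2 \in simplices K 2,
    (t1 `&` t2)%fset = s &
    let nu := normal o P t1 + normal o P t2 in
    if nu == 0 then phi = 0 else
    exists x r, admissible_ball K P s t1 t2 x r /\
      phi = 2 * pi * (fine (volume (positive_body P t1 t2 nu x r))
                      / fine (volume (eball x r)))].

Definition oriented_dihedral_angle (R : realType) (n : nat)
    (K : {fset {fset 'rV[R]_n}})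
    (o : {fset 'rV[R]_n} -> 'rV[R]_n * 'rV[R]_n * 'rV[R]_n)
    (P : 'rV[R]_n -> 'rV[R]_3) (s : {fset 'rV[R]_n}) : set R :=
  [set phi | exists psi (m : int),
     is_principal_value K o P s psi /\ phi = psi + 2 * pi * m%:~R].

Record dihedral_angle_during (R : realType) (n : nat)
    (K : {fset {fset 'rV[R]_n}})
    (o : {fset 'rV[R]_n} -> 'rV[R]_n * 'rV[R]_n * 'rV[R]_n)
    (P : 'rV[R]_n -> 'rV[R]_3) (Pt : R -> 'rV[R]_n -> 'rV[R]_3)
    (s : {fset 'rV[R]_n}) (phi : R -> R) : Prop := DihedralAngleDuring {
  dihedral_continuous : {within `[0, 1]%classic, continuous phi};
  dihedral_mem : forall t, 0 <= t <= 1 ->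
    oriented_dihedral_angle K o (Pt t) s (phi t);
  dihedral_start : is_principal_value K o P s (phi 0)
}.

Definition Q_independent (R : realType) (m : nat) (lam : 'I_m -> R) : Prop :=
  forall c : 'I_m -> rat, \sum_j ratr (c j) * lam j = 0 -> forall j, c j = 0.

Definition Q_span (R : realType) (L : set R) : set R :=
  [set x | exists (k : nat) (c : 'I_k -> rat) (l : 'I_k -> R),
     (forall i, L (l i)) /\ x = \sum_i ratr (c i) * l i].

Definition Q_basis_of_span (R : realType) (m : nat) (lam : 'I_m -> R)
    (L : set R) : Prop :=
  Q_independent lam /\ Q_span (range lam) = Q_span L.

Definition edge_lengths (R : realType) (n : nat) (K : {fset {fset 'rV[R]_n}})
    (P : 'rV[R]_n -> 'rV[R]_3) : set R :=
  [set edge_length P s | s in [set s | s \in simplices K 1]].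

(* Main.v *)
Require Import Defs.
From HB Require Import structures.
From mathcomp Require Import all_boot all_order all_algebra all_field finmap.
From mathcomp Require Import all_classical all_reals all_analysis.
From mathcomp Require Import ring lra.
From mathcomp Require Import complex.

(** For an edge s between the faces t1 and t2, let u be the complex number
    exp(i phi) of the oriented dihedral angle phi.  With the unit normals n1, n2
    and the unit vector e along s,

        u = - n1.n2 - i e.(n1 x n2),

    which is a rational function of the vertex positions as long as the edge
    lengths stay fixed, and they do: congruent nondegenerate triangles have the
    same side lengths up to order ([congruent_side]), so during the flex each
    length takes finitely many values and is constant by continuity
    ([flex_distance]).

    Suppose that the sum S = sum_s alpha_sj phi_s varies during the flex.  For
    N clearing the denominators of the alpha_sj, put a_s = N alpha_sj.  By the
    intermediate value theorem there are times t_k such that the complex numbers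
    w_k = exp(i N S(t_k)) = prod_s u_s(t_k)^a_s are pairwise distinct.  In an
    ultrapower of the complex numbers the class w of this sequence is then
    transcendental, since a nonzero polynomial has finitely many roots.  One can
    enlarge the field of constants to a field k over which w is still
    transcendental while the classes of all vertex coordinates become algebraic
    over k(w) ([transcendence_tower]).  They lie in a finite extension L of
    k(w), to which the derivation D = d/dw extends ([extend_derivation]).

    Two facts about logarithmic derivatives in L give a contradiction.

    - A Schlaefli formula ([schlafli_formula]).  All edge lengths are constants
      of D, so D moves each face t as a rigid body with an angular velocity
      omega_t, and D u_s / u_s = - i (omega_t1 - omega_t2).e.  Hence
      sum_s l_s D u_s / u_s is up to the factor - i the sum over the faces t of
      omega_t dotted with the sum of the boundary vectors of t, that is 0.

    - Residues are integers ([residue_at_zero]).  Taking the trace to k(w), then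
      the residue at w = 0, sends D x / x to the order of vanishing of the norm
      of x at 0, an integer.  For x = w it is the degree [L : k(w)] > 0.

    Let n_s be the residue of D u_s / u_s.  The Schlaefli formula gives
    sum_s l_s n_s = 0; expanding l_s over the rationally independent lambda_j
    gives sum_s alpha_sj n_s = 0 ([rational_relation]).  But w = prod_s u_s^a_s
    has residue sum_s a_s n_s = N sum_s alpha_sj n_s = 0, not a positive degree.

    It remains to relate the formula for u with the angle defined through
    volumes.  Near an interior point of the edge, each face is a half-disc of
    the ball ([triangle_near_edge]); the body on the side of the normals is the
    intersection or the union of two open half-balls, by convexity or
    star-shapedness ([body_wedge]); and its volume is proportional to the angle
    ([volume_open_wedge]).  The latter follows from the invariance of volume
    under rotations, obtained from shears, and from additivity. *)

Set Implicit Arguments.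
Unset Strict Implicit.
Unset Printing Implicit Defensive.
Import Order.TTheory GRing.Theory Num.Theory.
Import numFieldNormedType.Exports.
Local Open Scope classical_set_scope.
Local Open Scope ring_scope.
Local Notation "x %:F" := (@FracField.tofrac _ x).
Local Notation numer x := (frac (generic_quotient.repr x)).1.
Local Notation denom x := (frac (generic_quotient.repr x)).2.

(** * Fields of fractions *)

Lemma frac_numden (A : idomainType) (x : {fraction A}) :
  x = (numer x)%:F / (denom x)%:F.
Proof.
have d0 := denom_ratioP (generic_quotient.repr x).
apply: (mulIf (x := (denom x)%:F)); first by rewrite tofrac_eq0.
rewrite mulfVK ?tofrac_eq0 // -{1}(reprK x); unlock FracField.tofrac.
rewrite -[LHS]FracField.pi_mul; apply/eqmodP; rewrite /= FracField.equivfE.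
rewrite /FracField.mulf !numden_Ratio ?oner_neq0 ?mulf_neq0 ?oner_neq0 //.
by rewrite !mulr1 mulrC.
Qed.

Lemma fracE (A : idomainType) (x : {fraction A}) :
  exists n d, d != 0 /\ x = n%:F / d%:F.
Proof.
exists (numer x), (denom x); split; first exact: denom_ratioP.
exact: frac_numden.
Qed.

Section FractionLift.
Variables (A : idomainType) (E : fieldType) (f : {rmorphism A -> E}).
Hypothesis f_inj : injective f.

Definition frac_lift (x : {fraction A}) : E := f (numer x) / f (denom x).

Lemma frac_liftE n d : d != 0 -> frac_lift (n%:F / d%:F) = f n / f d.
Proof.
move=> nzd; set x := _ / _; have d0 := denom_ratioP (generic_quotient.repr x).
have nz y : y != 0 -> f y != 0 by rewrite -(rmorph0 f) (inj_eq f_inj).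
have : (numer x) * d = n * (denom x).
  apply/eqP; rewrite -tofrac_eq !tofracM.
  have -> : (numer x)%:F = x * (denom x)%:F.
    by rewrite {2}(frac_numden x) mulfVK ?tofrac_eq0.
  by rewrite mulrAC /x mulfVK ?tofrac_eq0.
move=> /(congr1 f); rewrite !rmorphM /= => e.
by rewrite /frac_lift; apply/eqP; rewrite eqr_div ?nz // e.
Qed.

Fact frac_lift_zmod : zmod_morphism frac_lift.
Proof.
have nz y : y != 0 -> f y != 0 by rewrite -(rmorph0 f) (inj_eq f_inj).
move=> x y; have [n [d [d0 ->]]] := fracE x; have [m [e [e0 ->]]] := fracE y.
rewrite -mulNr -tofracN addf_div ?tofrac_eq0 // -!tofracM -tofracD.
rewrite !frac_liftE ?mulf_neq0 // rmorphD !rmorphM rmorphN /=.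
by rewrite -mulNr addf_div ?nz.
Qed.

Fact frac_lift_monoid : monoid_morphism frac_lift.
Proof.
split.
  by rewrite -(divr1 1) -tofrac1 frac_liftE ?oner_neq0 // rmorph1 divr1.
move=> x y; have [n [d [d0 ->]]] := fracE x; have [m [e [e0 ->]]] := fracE y.
by rewrite mulf_div -!tofracM !frac_liftE ?mulf_neq0 // !rmorphM mulf_div.
Qed.

(** The universal property of the field of fractions: an injective morphism to a
    field extends. *)
Lemma frac_lift_exists :
  exists g : {rmorphism {fraction A} -> E}, forall a, g a%:F = f a.
Proof.
pose g : {rmorphism {fraction A} -> E} := HB.pack frac_lift
  (GRing.isZmodMorphism.Build _ _ frac_lift frac_lift_zmod)
  (GRing.isMonoidMorphism.Build _ _ frac_lift frac_lift_monoid).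
exists g => a; rewrite /g /= -[a%:F]divr1 -tofrac1 frac_liftE ?oner_neq0 //.
by rewrite rmorph1 divr1.
Qed.
End FractionLift.

(** * Transcendence of a generic parameter *)

Section Evaluation.
Variables (k F : fieldType) (f : {rmorphism k -> F}) (w : F).

Definition evalp : {poly k} -> F := horner_morph (fun a => mulrC w (f a)).
HB.instance Definition _ := GRing.RMorphism.on evalp.

Definition transcendental := injective evalp.

Definition algebraic_via x :=
  exists2 P : {poly {poly k}}, P != 0 & (map_poly evalp P).[x] = 0.
End Evaluation.

Lemma evalpC (k F : fieldType) (f : {rmorphism k -> F}) w a :
  evalp f w a%:P = f a.
Proof. exact: horner_morphC. Qed.

Lemma evalpX (k F : fieldType) (f : {rmorphism k -> F}) w :
  evalp f w 'X = w.
Proof. exact: horner_morphX. Qed.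

Lemma clear_denominators (A : idomainType) (p : {poly {fraction A}}) :
  exists d (Q : {poly A}), d != 0 /\
    d%:F *: p = map_poly (@FracField.tofrac A) Q.
Proof.
elim/poly_ind: p => [|p c [d [Q [d0 dQ]]]].
  by exists 1, 0; rewrite oner_neq0 scaler0 rmorph0.
have [n [e [e0 ->]]] := fracE c.
exists (e * d), ((e *: Q) * 'X + (d * n)%:P); split; first exact: mulf_neq0.
apply/polyP=> i; rewrite coefZ coef_map /= !coefD !coefMX !coefC.
move/polyP: dQ => /(_ i.-1); rewrite coefZ coef_map /= => dQ.
case: i dQ => [|i] /= dQ; last first.
  by rewrite !addr0 coefZ !tofracM -dQ mulrA.
by rewrite !add0r !tofracM [_ * d%:F]mulrC -mulrA [X in _ * X]mulrC divfK ?tofrac_eq0.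
Qed.

(** A polynomial relation between x and w can be read as one for w over k[x] or as
    one for x over k[w]. *)
Lemma swap_evalp (k F : fieldType) (f : {rmorphism k -> F}) x w
    (P : {poly {poly k}}) :
  (map_poly (evalp f x) P).[w] = (map_poly (evalp f w) (swapXY P)).[x].
Proof.
have ev y z Q : (map_poly (evalp f y) Q).[z] =
    (map_poly (map_poly f) Q).[z%:P].[y].
  have -> : map_poly (evalp f y) Q =
      map_poly (horner_eval y) (map_poly (map_poly f) Q).
    by rewrite -map_poly_comp.
  by rewrite -{1}(hornerC z y) -/(horner_eval y z%:P) horner_map.
by rewrite !ev -swapXY_map horner2_swapXY.
Qed.

(** Adjoin the elements of xs one at a time.  If x is algebraic over k(w) there is
    nothing to do; otherwise replace the constants k by k(x), and w stays
    transcendental by the exchange property: an algebraic relation for w over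
    k(x) would, read the other way round, be one for x over k(w). *)
Lemma transcendence_tower (C F : fieldType) (c : {rmorphism C -> F}) (w : F)
    (xs : seq F) : transcendental c w ->
  exists (k : fieldType) (f : {rmorphism k -> F}) (g : {rmorphism C -> k}),
    [/\ forall a, f (g a) = c a, transcendental f w
      & forall x, x \in xs -> algebraic_via f w x].
Proof.
move=> cw; elim: xs => [|x xs [k [f [g [fg fw algxs]]]]].
  by exists C, c, idfun.
case: (EM (algebraic_via f w x)) => [algx|nalg].
  exists k, f, g; split=> // y; rewrite inE => /predU1P[->//|]; exact: algxs.
(* x is transcendental over k(w), hence over k. *)
have fx : injective (evalp f x).
  apply/raddf_inj => p /eqP; apply: contraTeq => p0; apply/eqP => px; apply: nalg.
  exists (map_poly polyC p).
    by rewrite map_poly_eq0_id0 ?polyC_eq0 ?lead_coef_eq0.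
  rewrite -map_poly_comp -px; congr _.[x]; apply: eq_map_poly => a /=.
  exact: evalpC.
have [h hE] := frac_lift_exists fx.
pose g' : {rmorphism k -> {fraction {poly k}}} :=
  (@FracField.tofrac {poly k}) \o polyC.
have hg' a : h (g' a) = f a by rewrite -(evalpC f x); exact: hE.
have g'_inj : injective g' by exact: fmorph_inj.
exists {fraction {poly k}}, h, (g' \o g); split=> [a||y].
- by rewrite /= -fg -hg'.
- apply/raddf_inj => p pw; apply/eqP; apply: contra_eqT pw => p0.
  have [d [Q [d0 dQ]]] := clear_denominators p.
  apply/eqP => pw; apply: nalg; exists (swapXY Q).
    rewrite swapXY_eq0; apply: contraNneq p0 => Q0.
    move: dQ; rewrite Q0 rmorph0 => /eqP.
    by rewrite scaler_eq0 tofrac_eq0 (negPf d0).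
  rewrite -swap_evalp.
  have -> : map_poly (evalp f x) Q = map_poly h (d%:F *: p).
    by rewrite dQ -map_poly_comp; apply: eq_map_poly => a /=; rewrite hE.
  by rewrite map_polyZ hornerZ [X in _ * X]pw mulr0.
- rewrite inE => /predU1P[->|/algxs[P P0 Py]].
    exists ('X - (('X : {poly k})%:F)%:P%:P); first by rewrite polyXsubC_eq0.
    rewrite rmorphB /= map_polyX map_polyC /= !hornerE.
    apply/eqP; rewrite subr_eq0 eq_sym -[eqbRHS](evalpX f x); apply/eqP.
    by rewrite [LHS](evalpC h); exact: hE.
  exists (map_poly (map_poly g') P).
    by rewrite map_poly_eq0_id0 // map_poly_eq0 lead_coef_eq0.
  rewrite -map_poly_comp -Py; congr _.[y]; apply: eq_map_poly => q /=.
  rewrite /evalp /horner_morph -map_poly_comp; congr _.[w].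
  by apply: eq_map_poly => a; exact: hg'.
Qed.

(** * Derivations and the trace of a logarithmic derivative *)

(** By induction from the case of two elements, where a combination n y - x with an
    integer n is a generator in characteristic 0. *)
Lemma primitive_element (K F : fieldType) (iota : {rmorphism K -> F})
    (xs : seq F) : [pchar K] =i pred0 ->
    (forall x, x \in xs -> algebraicOver iota x) ->
  exists2 z, algebraicOver iota z
    & forall x, x \in xs -> exists q, (map_poly iota q).[z] = x.
Proof.
move=> charK; elim: xs => [_|x xs IH algxs]; first by exists 0; [exact: algebraic0|].
have [|y algy yxs] := IH; first by move=> z zxs; apply: algxs; rewrite inE zxs orbT.
have algx : algebraicOver iota x by apply: algxs; rewrite mem_head.
have [p p0 px] := algx; have [q q0 qy] := algy.
have [n [[rx rxE] [ry ryE]]] := pchar0_PET p0 px q0 qy charK.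
exists (y *+ n - x).
  apply: algebraic_sub => //; rewrite -mulr_natl -(rmorph_nat iota).
  by apply: algebraic_mul => //; exact: algebraic_id.
move=> u; rewrite inE => /predU1P[->|/yxs[r <-]]; first by exists rx.
exists (r \Po ry); by rewrite map_comp_poly horner_comp ryE.
Qed.

Section Derivation.
Variables (A : comNzRingType) (D : A -> A).

Definition derivation :=
  (forall x y, D (x + y) = D x + D y) /\
  (forall x y, D (x * y) = D x * y + x * D y).

Hypothesis derD : derivation.

Lemma derivationD x y : D (x + y) = D x + D y. Proof. by case: derD => /(_ x y). Qed.
Lemma derivationM x y : D (x * y) = D x * y + x * D y.
Proof. by case: derD => _ /(_ x y). Qed.
Lemma derivation0 : D 0 = 0.
Proof. by apply: (addrI (D 0)); rewrite -derivationD !addr0. Qed.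
Lemma derivation1 : D 1 = 0.
Proof. by apply: (addrI (D 1)); rewrite addr0 -{3}(mulr1 1) derivationM mulr1 mul1r. Qed.
Lemma derivationN x : D (- x) = - D x.
Proof. by apply: (addrI (D x)); rewrite -derivationD !subrr derivation0. Qed.
Lemma derivationB x y : D (x - y) = D x - D y.
Proof. by rewrite derivationD derivationN. Qed.
Lemma derivation_sum (I : Type) (r : seq I) (P : pred I) (F : I -> A) :
  D (\sum_(i <- r | P i) F i) = \sum_(i <- r | P i) D (F i).
Proof. by apply: (big_morph D derivationD derivation0). Qed.
Lemma derivation_prod (I : finType) (F : I -> A) :
  D (\prod_i F i) = \sum_i D (F i) * \prod_(j | j != i) F j.
Proof.
elim: (index_enum I) (index_enum_uniq I) => [|i r IH] /=.
  by rewrite !big_nil derivation1.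
move=> /andP[ir ur]; rewrite !big_cons derivationM IH // eqxx; congr (_ * _ + _).
  rewrite big_seq [RHS]big_seq_cond; apply: eq_bigl => j.
  by rewrite andb_idr // => jr; apply: contraNneq ir => <-.
rewrite mulr_sumr big_seq [RHS]big_seq; apply: eq_bigr => j jr.
rewrite big_cons ifT; first exact: mulrCA.
by apply: contraNneq ir => ij; rewrite ij.
Qed.

(** Jacobi's formula. *)
Lemma derivation_det n (M : 'M[A]_n) : D (\det M) = \tr (\adj M *m map_mx D M).
Proof.
pose B i : 'M[A]_n := \matrix_(p, q) if p == i then D (M p q) else M p q.
have -> : D (\det M) = \sum_i \det (B i).
  rewrite derivation_sum /determinant exchange_big; apply: eq_bigr => s _ /=.
  have Dsgn : D ((-1) ^+ perm.odd_perm s) = 0.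
    by case: (perm.odd_perm s); rewrite ?expr1 ?expr0 ?derivationN derivation1 ?oppr0.
  rewrite derivationM Dsgn mul0r add0r derivation_prod mulr_sumr; apply: eq_bigr => i _.
  congr (_ * _); rewrite [RHS](bigD1 i) //= !mxE eqxx; congr (_ * _).
  by apply: eq_bigr => j /negPf ji; rewrite mxE ji.
rewrite mxtrace_mulC; apply: eq_bigr => i _.
rewrite (expand_det_row (B i) i) mxE; apply: eq_bigr => j _.
rewrite !mxE eqxx; congr (_ * _); rewrite /cofactor; congr (_ * \det _).
by apply/matrixP => p q; rewrite !mxE eq_sym (negPf (neq_lift _ _)).
Qed.
End Derivation.

Section DerivationField.
Variables (A : fieldType) (D : A -> A).
Hypothesis derD : derivation D.
Definition dlog x := D x / x.
Lemma dlogM x y : x != 0 -> y != 0 -> dlog (x * y) = dlog x + dlog y.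
Proof. by move=> x0 y0; rewrite /dlog derivationM //; field; rewrite x0 y0. Qed.
Lemma dlogV x : x != 0 -> dlog x^-1 = - dlog x.
Proof.
move=> x0; apply/eqP; rewrite -addr_eq0 addrC -dlogM ?invr_eq0 //.
by rewrite divff // /dlog derivation1 // mul0r.
Qed.
End DerivationField.

Section Trace.
Variables (K L : fieldType) (c : {rmorphism K -> L}) (dK : K -> K) (D : L -> L).
Hypotheses (derK : derivation dK) (derD : derivation D).
Hypothesis Dc : forall a, D (c a) = c (dK a).
Variables (d : nat) (b : 'cV[L]_d).
Hypothesis b_span : forall x, exists v : 'rV[K]_d, (map_mx c v *m b) 0 0 = x.
Hypothesis b_free : forall v : 'rV[K]_d, map_mx c v *m b = 0 -> v = 0.

Let mx_span (u : 'cV[L]_d) : exists M : 'M[K]_d, map_mx c M *m b = u.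
Proof.
have /choice[v vP] : forall i, exists v : 'rV[K]_d, (map_mx c v *m b) 0 0 = u i 0.
  by move=> i; exact: b_span.
exists (\matrix_i v i); apply/colP => i; rewrite -vP !mxE.
by apply: eq_bigr => j _; rewrite !mxE.
Qed.

Let mx_free (M N : 'M[K]_d) : map_mx c M *m b = map_mx c N *m b -> M = N.
Proof.
move=> /eqP; rewrite -subr_eq0 -mulmxBl -map_mxB => /eqP MN.
apply/eqP; rewrite -subr_eq0; apply/eqP/row_matrixP => i; rewrite row0.
by apply: b_free; rewrite map_row -row_mul MN row0.
Qed.

(** The matrix of the multiplication by x in the K-basis b of L; it is the regular
    representation, acting on the column b. *)
Definition regmx x : 'M[K]_d := projT1 (cid (mx_span (x *: b))).

Lemma regmxP x : map_mx c (regmx x) *m b = x *: b.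
Proof. exact: projT2 (cid (mx_span (x *: b))). Qed.

Lemma regmxD x y : regmx (x + y) = regmx x + regmx y.
Proof. by apply: mx_free; rewrite map_mxD mulmxDl !regmxP scalerDl. Qed.

Lemma regmxM x y : regmx (x * y) = regmx x *m regmx y.
Proof.
apply: mx_free; rewrite map_mxM -mulmxA !regmxP -scalemxAr regmxP.
by rewrite scalerA mulrC.
Qed.

Lemma regmxC a : regmx (c a) = a%:M.
Proof. by apply: mx_free; rewrite regmxP map_scalar_mx mul_scalar_mx. Qed.

Lemma regmx_unit x : x != 0 -> regmx x \in unitmx.
Proof.
move=> x0; apply: (@mulmx1_unit _ _ _ (regmx x^-1) _).1.
by rewrite -regmxM divff // -(rmorph1 c) regmxC.
Qed.

(** The trace of D x / x is the logarithmic derivative of the norm of x.  The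
    matrices of D x and of the entrywise derivative of X = regmx x differ by a
    commutator [X, G], where G expresses D b in the basis b; after division by X
    the commutator has trace 0, and the rest is Jacobi's formula. *)
Lemma trace_dlog x : x != 0 ->
  \tr (regmx (dlog D x)) = dlog dK (\det (regmx x)).
Proof.
move=> x0; have [G GP] := mx_span (map_mx D b).
set X := regmx x; have uX : X \in unitmx by exact: regmx_unit.
have DX : regmx (D x) = map_mx dK X + (X *m G - G *m X).
  apply: mx_free; rewrite regmxP map_mxD mulmxDl map_mxB mulmxBl !map_mxM.
  rewrite -!mulmxA GP regmxP -scalemxAr GP.
  have : map_mx D (map_mx c X *m b) = map_mx D (x *: b) by rewrite regmxP.
  move=> /colP DE; apply/colP => i; move: (DE i); rewrite !mxE derivation_sum // derivationM //.
  under eq_bigr => j _ do rewrite derivationM // !mxE Dc.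
  rewrite big_split /= => e; apply/eqP; rewrite addrA eq_sym subr_eq; apply/eqP.
  by under [in LHS]eq_bigr => j _ do rewrite !mxE; rewrite -e; congr (_ + _);
     apply: eq_bigr => j _; rewrite !mxE.
rewrite /dlog regmxM DX -/X.
have -> : regmx x^-1 = invmx X.
  have VX : regmx x^-1 *m X = 1%:M.
    by rewrite -regmxM mulVf // -(rmorph1 c) regmxC.
  by rewrite -[LHS]mulmx1 -(mulmxV uX) mulmxA VX mul1mx.
rewrite mulmxDl mulmxBl mxtraceD -(mulmxA G) mulmxV // mulmx1 raddfB /=.
rewrite [\tr (_ *m _ *m _)]mxtrace_mulC mulmxA mulVmx // mul1mx subrr addr0.
rewrite derivation_det // mxtrace_mulC /invmx uX -scalemxAl mxtraceZ mulrC.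
by [].
Qed.
End Trace.

(** * The residue at zero of a rational function *)

(** The quotient rule does not depend on the representative: differentiate
    m d = n e. *)
Lemma quotient_rule_unique (F : fieldType) (n n' d d' m m' e e' : F) :
  d != 0 -> e != 0 -> m * d = n * e ->
  m' * d + m * d' = n' * e + n * e' ->
  (m' * e - m * e') / e ^+ 2 = (n' * d - n * d') / d ^+ 2.
Proof.
move=> d0 e0 E E'; have mE : m = n * e / d by rewrite -E mulfK.
have m'E : m' = (n' * e + n * e' - m * d') / d by rewrite -E' addrK mulfK.
by rewrite m'E mE; field; rewrite d0 e0.
Qed.

Lemma quotient_ruleD (F : fieldType) (n n' d d' m m' e e' : F) :
  d != 0 -> e != 0 ->
  ((n' * e + n * e' + (m' * d + m * d')) * (d * e) -
     (n * e + m * d) * (d' * e + d * e')) / (d * e) ^+ 2 =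
  (n' * d - n * d') / d ^+ 2 + (m' * e - m * e') / e ^+ 2.
Proof. by move=> d0 e0; field; rewrite d0 e0. Qed.

Lemma quotient_ruleM (F : fieldType) (n n' d d' m m' e e' : F) :
  d != 0 -> e != 0 ->
  ((n' * m + n * m') * (d * e) - n * m * (d' * e + d * e')) / (d * e) ^+ 2 =
  (n' * d - n * d') / d ^+ 2 * (m / e) + n / d * ((m' * e - m * e') / e ^+ 2).
Proof. by move=> d0 e0; field; rewrite d0 e0. Qed.

Lemma dlog_power_factor (F : fieldType) (X g g' : F) n :
  X != 0 -> g != 0 ->
  X * ((g' * X ^+ n.+1 + g * (X ^+ n *+ n.+1)) / (g * X ^+ n.+1)) - n.+1%:R =
  X * g' / g.
Proof.
move=> X0 g0; have Xn0 : X ^+ n != 0 by rewrite expf_neq0.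
by rewrite exprS -[X ^+ n *+ _]mulr_natr; field; rewrite g0 X0 Xn0.
Qed.

Section RationalFunctions.
Variable k : fieldType.
Local Notation K := {fraction {poly k}}.

(** d/dX on rational functions, by the quotient rule. *)
Lemma rational_derivation :
  exists2 dK : K -> K, derivation dK & forall p, dK p%:F = (p^`())%:F.
Proof.
(* The quotient rule on a representative fraction. *)
pose q n d : K := ((n^`())%:F * d%:F - n%:F * (d^`())%:F) / d%:F ^+ 2.
pose dK (x : K) := q (numer x) (denom x).
have dKE n d : d != 0 -> dK (n%:F / d%:F) = q n d.
  move=> d0; set x := _ / _; have e0 := denom_ratioP (generic_quotient.repr x).
  rewrite /dK; set m := (numer x); set e := (denom x).
  have E : m * d = n * e.
    apply/eqP; rewrite -tofrac_eq !tofracM.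
    by rewrite -eqr_div ?tofrac_eq0 // -frac_numden.
  have E' : (m^`())%:F * d%:F + m%:F * (d^`())%:F =
      (n^`())%:F * e%:F + n%:F * (e^`())%:F.
    by rewrite -!tofracM -!tofracD -!derivM E.
  have {}E : m%:F * d%:F = n%:F * e%:F by rewrite -!tofracM E.
  have fd : d%:F != 0 by rewrite tofrac_eq0.
  have fe : e%:F != 0 by rewrite tofrac_eq0.
  exact: (quotient_rule_unique fd fe E E').
clearbody dK; rewrite /q in dKE; clear q; exists dK => [|p].
  split=> x y; have [n [d [d0 ->]]] := fracE x; have [m [e [e0 ->]]] := fracE y.
    have fd : d%:F != 0 by rewrite tofrac_eq0.
    have fe : e%:F != 0 by rewrite tofrac_eq0.
    rewrite (addf_div _ _ fd fe) -!tofracM -tofracD.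
    rewrite (dKE _ _ (mulf_neq0 d0 e0)) (dKE _ _ d0) (dKE _ _ e0).
    rewrite derivD !derivM ![(_ + _)%:F]tofracD ![(_ * _)%:F]tofracM.
    exact: (quotient_ruleD _ _ _ _ _ _ fd fe).
  have fd : d%:F != 0 by rewrite tofrac_eq0.
  have fe : e%:F != 0 by rewrite tofrac_eq0.
  rewrite mulf_div -!tofracM.
  rewrite (dKE _ _ (mulf_neq0 d0 e0)) (dKE _ _ d0) (dKE _ _ e0).
  rewrite !derivM ![(_ + _)%:F]tofracD ![(_ * _)%:F]tofracM.
  exact: (quotient_ruleM _ _ _ _ _ _ fd fe).
rewrite -[p%:F]divr1 -tofrac1 dKE ?oner_neq0 // -polyC1 derivC.
by rewrite !tofrac0 mulr0 subr0 !tofrac1 mulr1 expr1n divr1.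
Qed.

(** The maximal ideal of the local ring of rational functions regular at 0.  With
    it, residues can be handled without defining them: x has residue a at 0, for a
    pole of order at most 1, when X x - a vanishes at 0. *)
Definition vanishes_at0 (x : K) :=
  exists p q : {poly k}, [/\ p.[0] = 0, q.[0] != 0 & x = p%:F / q%:F].

Let horner_nz (q : {poly k}) : q.[0] != 0 -> q%:F != 0.
Proof. by rewrite tofrac_eq0; apply: contraNneq => ->; rewrite horner0. Qed.

Lemma vanishes_at0_0 : vanishes_at0 0.
Proof.
by exists 0, 1; rewrite horner0 hornerE oner_neq0 tofrac0 mul0r.
Qed.

Lemma vanishes_at0D x y : vanishes_at0 x -> vanishes_at0 y -> vanishes_at0 (x + y).
Proof.
move=> [p [q [p0 q0 ->]]] [r [s [r0 s0 ->]]].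
exists (p * s + r * q), (q * s); split.
- by rewrite !hornerE p0 r0 !mul0r addr0.
- by rewrite hornerM mulf_neq0.
- by rewrite tofracD !tofracM addf_div ?horner_nz.
Qed.

Lemma vanishes_at0Z a x : vanishes_at0 x -> vanishes_at0 ((a%:P)%:F * x).
Proof.
move=> [p [q [p0 q0 ->]]]; exists (a%:P * p), q; split=> //.
  by rewrite !hornerE p0 mulr0.
by rewrite tofracM mulrA.
Qed.

Lemma vanishes_at0C a : vanishes_at0 (a%:P)%:F -> a = 0.
Proof.
move=> [p [q [p0 q0 /(congr1 ( *%R^~ q%:F))]]].
rewrite (divfK (horner_nz q0)) -tofracM => /eqP; rewrite tofrac_eq => /eqP /(congr1 (horner^~ 0)).
by rewrite hornerM hornerC p0 => /eqP; rewrite mulf_eq0 (negPf q0) orbF => /eqP.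
Qed.

(** The residue at 0 of dx / x is the order of x at 0: write the numerator and the
    denominator as a power of X times a polynomial that does not vanish at 0. *)
Lemma residue_dlog (dK : K -> K) : derivation dK ->
    (forall p, dK p%:F = (p^`())%:F) ->
  forall x, x != 0 -> exists n : int, vanishes_at0 ('X%:F * dlog dK x - n%:~R).
Proof.
move=> derK dKE x x0.
have X0 : ('X : {poly k})%:F != 0 by rewrite tofrac_eq0 polyX_eq0.
have poly_case p : p != 0 ->
    exists n : nat, vanishes_at0 ('X%:F * dlog dK p%:F - n%:R).
  move=> p0; have [n [g]] := multiplicity_XsubC p 0; rewrite p0 /= subr0 => g0 pE.
  have fg : g%:F != 0 by apply: horner_nz.
  exists n, ('X * g^`()), g; split=> //; first by rewrite !hornerE.
  rewrite pE /dlog dKE derivM derivXn.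
  rewrite !(tofracD, tofracM, tofracXn, tofracMn) {pE}.
  case: n => [|n] /=.
    by rewrite mulr0n mulr0 addr0 expr0 !mulr1 subr0 mulrA.
  exact: (dlog_power_factor _ _ X0 fg).
have [p [q [q0 xE]]] := fracE x; move: x0; rewrite {}xE => x0.
have p0 : p != 0.
  by apply: contraNneq x0 => ->; rewrite tofrac0 mul0r.
have [n np] := poly_case _ p0; have [m mq] := poly_case _ q0.
exists (n%:Z - m%:Z); rewrite dlogM ?invr_eq0 ?tofrac_eq0 //.
rewrite dlogV ?tofrac_eq0 // mulrBr intrD.
move: (vanishes_at0D np (vanishes_at0Z (-1) mq)).
by congr vanishes_at0; rewrite polyCN polyC1 tofracN tofrac1 mulrNz -!pmulrn; ring.
Qed.
End RationalFunctions.

(** * Derivations of simple algebraic extensions *)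

Section SimpleExtension.
Variables (K L : fieldType) (ev : {rmorphism {poly K} -> L}).
Hypothesis ev_surj : forall x, exists q, ev q = x.
Hypothesis ev_alg : exists2 p, p != 0 & ev p = 0.
Hypothesis charK : [pchar K] =i pred0.

(** The polynomials killed by ev form an ideal; f is an element of least degree. *)
Lemma generating_relation : exists f, [/\ f != 0, ev f = 0
  & forall q, ev q = 0 -> f %| q].
Proof.
pose P n := `[< exists p : {poly K}, [/\ p != 0, ev p = 0 & size p = n] >].
have exP : exists n, P n.
  by case: ev_alg => p p0 evp; exists (size p); apply/asboolP; exists p.
case: (ex_minnP exP) => n /asboolP[f [f0 evf fn]] minn.
exists f; split=> // q evq; apply: contraT => /negP nd.
have r0 : q %% f != 0 by apply: contra_notN nd => /eqP; rewrite /dvdp => ->.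
have evr : ev (q %% f) = 0.
  by move: evq; rewrite {1}(divp_eq q f) rmorphD rmorphM /= evf mulr0 add0r.
have : P (size (q %% f)) by apply/asboolP; exists (q %% f).
by move/minn; rewrite -fn leqNgt ltn_modp f0.
Qed.

Lemma simple_extension_basis : exists (d : nat) (b : 'cV[L]_d),
  (forall x, exists v : 'rV[K]_d, (map_mx (ev \o polyC) v *m b) 0 0 = x) /\
  (forall v : 'rV[K]_d, map_mx (ev \o polyC) v *m b = 0 -> v = 0).
Proof.
have [f [f0 evf fdvd]] := generating_relation.
exists (size f).-1, (\col_i ev 'X^i).
have E (v : 'rV[K]_(size f).-1) :
    (map_mx (ev \o polyC) v *m \col_i ev 'X^i) 0 0 = ev (rVpoly v).
  rewrite mxE /rVpoly poly_def rmorph_sum /=; apply: eq_bigr => i _.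
  by rewrite !mxE /= valK -mul_polyC rmorphM.
split=> [x|v v0].
  have [q <-] := ev_surj x; exists (poly_rV (q %% f)); rewrite E poly_rV_K.
    by rewrite {2}(divp_eq q f) rmorphD rmorphM /= evf mulr0 add0r.
  by rewrite -ltnS prednK ?ltn_modp // lt0n size_poly_eq0.
apply: (can_inj rVpolyK); rewrite linear0; apply/eqP; apply: contraT => r0.
have /fdvd/(dvdp_leq r0) : ev (rVpoly v) = 0 by rewrite -E v0 mxE.
rewrite leqNgt => /negP; case; apply: leq_ltn_trans (size_poly _ _) _.
by rewrite prednK ?ltnS // lt0n size_poly_eq0.
Qed.

Variable dK : K -> K.
Hypothesis derK : derivation dK.

Let d_ (q : {poly K}) := map_poly dK q.

Let dE q i : (d_ q)`_i = dK q`_i.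
Proof. by rewrite coef_map_id0 // derivation0. Qed.

Let d_D p q : d_ (p + q) = d_ p + d_ q.
Proof. by apply/polyP => i; rewrite coefD !dE coefD derivationD. Qed.

Let d_M p q : d_ (p * q) = d_ p * q + p * d_ q.
Proof.
apply/polyP => i; rewrite coefD dE !coefM derivation_sum // -big_split /=.
by apply: eq_bigr => j _; rewrite derivationM // !dE.
Qed.

(** Modulo the minimal polynomial f of the generator theta, the derivation is
    forced: 0 = D (f(theta)) = (dK f)(theta) + f'(theta) D theta determines
    D theta, because f'(theta) is nonzero in characteristic 0. *)
Lemma extend_derivation : exists2 D : L -> L, derivation D
  & forall a, D (ev a%:P) = ev (dK a)%:P.
Proof.
have [f [f0 evf fdvd]] := generating_relation.
have evf' : ev f^`() != 0.
  apply/eqP => /fdvd; have [f'0 _|f'0 /(dvdp_leq f'0)] := eqVneq f^`() 0; last first.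
    by rewrite leqNgt lt_size_deriv.
  have sf : size f = 1%N.
    apply/eqP; rewrite eqn_leq lt0n size_poly_eq0 f0 andbT leqNgt.
    apply/negP => sf; have /polyP/(_ (size f).-2) := f'0.
    rewrite coef_deriv coef0 -mulr_natl => /eqP; rewrite mulf_eq0.
    rewrite ((pcharf0P _).1 charK) /=.
    have -> : (size f).-2.+1 = (size f).-1 by case: (size f) sf => [|[]].
    by rewrite -/(lead_coef f) lead_coef_eq0 (negPf f0).
  have /eqP/size_poly1P[a a0 fE] := sf.
  by move/eqP: evf; rewrite fE -/((ev \o polyC) a) fmorph_eq0 (negPf a0).
(* The value of D at the generator. *)
pose eta := - ev (d_ f) / ev f^`().
pose D1 q := ev (d_ q) + ev q^`() * eta.
have D1D p q : D1 (p + q) = D1 p + D1 q.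
  by rewrite /D1 d_D derivD !rmorphD mulrDl /= addrACA.
have D1M p q : D1 (p * q) = D1 p * ev q + ev p * D1 q.
  by rewrite /D1 d_M derivM !(rmorphD, rmorphM) /=; ring.
have D10 q : ev q = 0 -> D1 q = 0.
  move/fdvd/dvdpP => [g ->]; rewrite D1M evf mulr0 add0r /D1 /eta.
  by rewrite mulrCA divff // mulr1 subrr mulr0.
have D1eq p q : ev p = ev q -> D1 p = D1 q.
  move=> pq; rewrite -(subrK q p) D1D D10 ?add0r //.
  by rewrite rmorphB /= pq subrr.
have /choice[r rE] := ev_surj.
exists (D1 \o r) => [|a].
  split=> x y /=.
    by rewrite -D1D; apply: D1eq; rewrite rmorphD /= !rE.
  have := D1M (r x) (r y); rewrite !rE => <-.
  by apply: D1eq; rewrite rmorphM /= !rE.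
rewrite /= (D1eq _ a%:P) // /D1 derivC rmorph0 mul0r addr0; congr (ev _).
by apply/polyP => i; rewrite dE !coefC; case: eqP => // _; exact: derivation0.
Qed.
End SimpleExtension.

(** * Ultrapowers of a field *)

Section Ultrapower.
Local Open Scope quotient_scope.
Variables (C : fieldType) (U : set_system nat).
Hypothesis UU : UltraFilter U.

(** The sequences that vanish on a set of the ultrafilter U: the maximal ideal
    whose quotient is the ultrapower. *)
Definition null_seq : pred (nat -> C) :=
  fun f => `[< U [set k | f k = 0] >].

Fact null_seq_ideal : idealr_closed null_seq.
Proof.
split.
- by apply/asboolP; rewrite (_ : [set _ | _] = setT) ?predeqE //; exact: filterT.
- apply/asboolP => U1; apply: (filter_not_empty U).
  by apply: filterS U1 => k /= /eqP; rewrite oner_eq0.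
- move=> a u v /asboolP Uu /asboolP Uv; apply/asboolP.
  apply: filterS2 Uu Uv => k /= uk vk.
  by rewrite /GRing.add /= /GRing.mul /= uk vk mulr0 addr0.
Qed.
HB.instance Definition _ := isIdealr.Build (nat -> C) null_seq null_seq_ideal.

Local Notation Q := {ideal_quot (null_seq : idealr (nat -> C))}.

Lemma null_pi f : (\pi_Q f == 0) = `[< U [set k | f k = 0] >].
Proof.
rewrite -(rmorph0 \pi_Q).
by rewrite -Quotient.idealrBE subr0.
Qed.

Definition ultra_inv (x : Q) : Q :=
  \pi_Q (fun k : nat => ((generic_quotient.repr x : nat -> C) k)^-1 : C).

Fact ultra_mulVf x : x != 0 -> ultra_inv x * x = 1.
Proof.
rewrite /ultra_inv -{1 3}(reprK x); move: (generic_quotient.repr x) => f.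
rewrite null_pi => /asboolPn nf.
have [//|nU] := in_ultra_setVsetC [set k | f k = 0] UU.
rewrite -rmorphM -(rmorph1 \pi_Q) /=.
apply/eqP; rewrite -Quotient.idealrBE; apply/asboolP.
apply: filterS nU => k /= /eqP fk.
by rewrite /GRing.add /= /GRing.mul /= mulVf // subrr.
Qed.

Fact ultra_inv0 : ultra_inv 0 = 0.
Proof.
apply/eqP; rewrite /ultra_inv null_pi.
have : \pi_Q (generic_quotient.repr (0 : Q)) == 0.
  by rewrite reprK.
rewrite null_pi => /asboolP U0; apply/asboolP; apply: filterS U0 => k /= ->.
by rewrite invr0.
Qed.

Definition ultrapower : fieldType := HB.pack Q
  (GRing.ComNzRing_isField.Build Q ultra_mulVf ultra_inv0).

Definition ultra_class : {rmorphism (nat -> C) -> ultrapower} :=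
  \pi_Q.

End Ultrapower.

(** The ultrafilter refines the filter of cofinite sets, so a sequence that is
    eventually nonzero stays nonzero in the quotient. *)
Lemma ultrapower_exists (C : fieldType) :
  exists (F : fieldType) (cls : {rmorphism (nat -> C) -> F}),
    forall f N, (forall k, (N <= k)%N -> f k != 0) -> cls f != 0.
Proof.
have [U [UU sU]] := ultraFilterLemma (eventually_filter : ProperFilter \oo).
exists (ultrapower C UU), (ultra_class C UU) => f N fN.
rewrite /ultra_class; apply/negP; rewrite [_ == _]null_pi => /asboolP U0.
apply: (filter_not_empty U); have : U [set k | (N <= k)%N].
  by apply: sU; exists N.
by apply: filterS2 U0 => k /= f0 /fN; rewrite f0 eqxx.
Qed.

(** * Generic points of sequences and their residues *)

(** Residues of logarithmic derivatives without residue fields: M is the space of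
    the y whose residue is 0, and z has residue 1.  The two last conditions
    say that c a * z has residue 0 only for a = 0, and that the residue of D x / x
    is an integer. *)
Record dlog_residue (C L : fieldType) (c : C -> L) (D : L -> L)
    (M : L -> Prop) (z : L) : Prop := DlogResidue {
  res_deriv : derivation D;
  res_const : forall a, D (c a) = 0;
  res0 : M 0;
  resD : forall x y, M x -> M y -> M (x + y);
  resZ : forall a x, M x -> M (c a * x);
  res_polar : forall a, M (c a * z) -> a = 0;
  res_dlog : forall x, x != 0 -> exists n : int, M (dlog D x - z *~ n)
}.

(** For L finite over k(X), of degree d, the residue of y is that of its trace to
    k(X).  The trace of a constant a being d a, the element 1 / (d X) has
    residue 1, and D X / X = 1 / X has residue d. *)
Lemma residue_at_zero (k L : fieldType)
    (ev : {rmorphism {poly {fraction {poly k}}} -> L}) :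
    (forall x, exists q, ev q = x) -> (exists2 p, p != 0 & ev p = 0) ->
    [pchar k] =i pred0 ->
  exists D M z d, [/\ dlog_residue (fun a : k => ev (a%:P)%:F%:P) D M z,
    dlog D (ev ('X%:F)%:P) = z *+ d & (0 < d)%N].
Proof.
move=> ev_surj ev_alg chark.
have charK : [pchar {fraction {poly k}}] =i pred0.
  move=> p; rewrite -chark.
  exact: (fmorph_pchar (@FracField.tofrac {poly k} \o polyC : {rmorphism k -> _})).
have [dK derK dKE] := rational_derivation k.
have [d [b [bspan bfree]]] := simple_extension_basis ev_surj ev_alg.
have [D derD DE] := extend_derivation ev_surj ev_alg charK derK.
pose T x := \tr (regmx bspan x).
have TD x y : T (x + y) = T x + T y by rewrite /T regmxD // mxtraceD.
have TZ a x : T (ev a%:P * x) = a * T x.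
  by rewrite /T regmxM // (regmxC bspan bfree a) mul_scalar_mx mxtraceZ.
have TC a : T (ev a%:P) = a *+ d.
  by rewrite /T (regmxC bspan bfree a) mxtrace_scalar.
have T0 : T 0 = 0 by apply: (addrI (T 0)); rewrite -TD !addr0.
have TN x : T (- x) = - T x by apply: (addrI (T x)); rewrite -TD !subrr T0.
have X0 : ('X : {poly k})%:F != 0 by rewrite tofrac_eq0 polyX_eq0.
have d0 : (0 < d)%N.
  rewrite lt0n; apply/negP => /eqP d0.
  have [v v1] := bspan 1; have /eqP := oner_neq0 L; apply.
  rewrite -v1 mxE; apply: big1 => -[i id] _.
  by exfalso; rewrite d0 in id.
have dK0 : d%:R != 0 :> {fraction {poly k}}.
  by rewrite ((pcharf0P _).1 charK) -lt0n.
(* The factor 1 / d makes the trace of z equal to 1 / X. *)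
pose zK : {fraction {poly k}} := ('X%:F)^-1 / d%:R.
pose z := ev zK%:P.
have Tz : 'X%:F * T z = 1.
  by rewrite TC -mulr_natr (divfK dK0) (divff X0).
exists D, (fun y => vanishes_at0 ('X%:F * T y)), z, d; split; [ | | exact: d0].
- split; first exact: derD.
  + move=> a; rewrite DE dKE derivC tofrac0 polyC0; exact: rmorph0.
  + by rewrite T0 mulr0; exact: vanishes_at0_0.
  + by move=> x y Mx My; rewrite TD mulrDr; exact: vanishes_at0D.
  + by move=> a x Mx; rewrite TZ mulrCA; exact: vanishes_at0Z.
  + by move=> a; rewrite TZ mulrCA Tz mulr1; exact: vanishes_at0C.
  + move=> x x0.
    have N0 : \det (regmx bspan x) != 0.
      by move: (regmx_unit bspan bfree x0); rewrite unitmxE unitfE.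
    have [n nP] := residue_dlog derK dKE N0; exists n.
    rewrite TD TN -mulrzl.
    have -> : n%:~R * z = ev (n%:~R)%:P * z by rewrite rmorph_int rmorph_int.
    rewrite TZ mulrDr mulrN [X in _ - X]mulrCA Tz mulr1.
    move: nP; rewrite -(@trace_dlog _ _ (ev \o polyC) dK D derK derD DE _ b
      bspan bfree x x0).
    by [].
- pose c : {rmorphism {fraction {poly k}} -> L} := ev \o polyC.
  have DX : D (c 'X%:F) = 1.
    rewrite /c /= DE dKE derivX.
    exact: (rmorph1 (c \o @FracField.tofrac {poly k})).
  rewrite -[ev _]/(c _) -[z]/(c zK) /dlog DX mul1r -(fmorphV c) -(rmorphMn c).
  by rewrite -mulr_natr /zK (divfK dK0).
Qed.

Lemma poly_finite_zeros (C : fieldType) (w : nat -> C) (p : {poly C}) :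
  injective w -> p != 0 -> exists N, forall k, (N <= k)%N -> p.[w k] != 0.
Proof.
move=> w_inj; elim: {p}_.+1 {-2}p (ltnSn (size p)) => // n IH p.
rewrite ltnS => pn p0.
have [[a pa]|nroot] := pselect (exists a, root p a); last first.
  exists 0%N => k _; apply: contra_notN nroot => /eqP pk.
  by exists (w k); apply/rootP.
have /factor_theorem[q pE] := pa.
have q0 : q != 0 by apply: contraNneq p0 => q0; rewrite pE q0 mul0r.
have [|N NP] := IH q _ q0.
  by move: pn; rewrite pE size_Mmonic ?monicXsubC // size_XsubC addn2.
have [[k0 k0a]|na] := pselect (exists k0, w k0 = a).
  exists (maxn N k0.+1) => k; rewrite geq_max => /andP[Nk k0k].
  rewrite pE hornerM mulf_neq0 ?NP // !hornerE subr_eq0.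
  by rewrite -k0a (inj_eq w_inj); apply: contraTneq k0k => ->; rewrite ltnn.
exists N => k Nk; rewrite pE hornerM mulf_neq0 ?NP // !hornerE subr_eq0.
by apply: contra_notN na => /eqP <-; exists k.
Qed.

(** Finitely many sequences of elements of C, taken modulo an ultrafilter, generate
    over a field of constants k and the class W of an injective sequence w a field
    L algebraic over k(W), which carries the residues at W = 0.  The field k need
    not be C, but it contains C, and j reads L inside the ultrapower F, where
    polynomial identities can be verified term by term. *)
Lemma generic_point (C : fieldType) (xs : seq (nat -> C)) (w : nat -> C) :
    [pchar C] =i pred0 -> injective w ->
  exists (L F : fieldType) (cls : {rmorphism (nat -> C) -> F})
    (j : {rmorphism L -> F}) (c : {rmorphism C -> L}) (D : L -> L)
    (M : L -> Prop) (z : L),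
  [/\ dlog_residue c D M z, forall a, j (c a) = cls (fun=> a),
      forall x, x \in xs -> exists y, j y = cls x
    & exists W d, [/\ j W = cls w, dlog D W = z *+ d & (0 < d)%N]].
Proof.
move=> charC w_inj.
have [F [cls clsP]] := ultrapower_exists C.
pose cstm (a : C) : nat -> C := fun=> a.
have cstmB : zmod_morphism cstm by [].
have cstmM : monoid_morphism cstm by [].
pose cm : {rmorphism C -> (nat -> C)} := HB.pack cstm
  (GRing.isZmodMorphism.Build _ _ cstm cstmB)
  (GRing.isMonoidMorphism.Build _ _ cstm cstmM).
pose c0 : {rmorphism C -> F} := cls \o cm.
have evE p : evalp c0 (cls w) p = cls (fun k => p.[w k]).
  elim/poly_ind: p => [|p a IH].
    rewrite rmorph0 -(rmorph0 cls); congr (cls _).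
    by apply/funext => k; rewrite horner0.
  rewrite rmorphD rmorphM /= IH evalpX [evalp _ _ a%:P](evalpC c0) /c0 /=.
  rewrite -rmorphM -rmorphD /=; congr (cls _).
  by apply/funext => k; rewrite !hornerE.
have w_tr : transcendental c0 (cls w).
  apply: raddf_inj => p pw; apply/eqP; apply: contra_eqT pw => p0.
  have [N NP] := poly_finite_zeros w_inj p0.
  by rewrite [X in X != _](evE p); exact: clsP NP.
have [k [f [g [fg f_tr algxs]]]] := transcendence_tower (map cls xs) w_tr.
have [iota iotaE] := frac_lift_exists f_tr.
have chark : [pchar k] =i pred0.
  by move=> p; rewrite -charC; exact: (fmorph_pchar g).
have charK : [pchar {fraction {poly k}}] =i pred0.
  move=> p; rewrite -chark.
  exact: (fmorph_pchar (@FracField.tofrac {poly k} \o polyC : {rmorphism k -> _})).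
have algK x : x \in map cls xs -> algebraicOver iota x.
  move=> /algxs[P P0 Px]; exists (map_poly (@FracField.tofrac _) P).
    by rewrite map_poly_eq0_id0 // tofrac_eq0 lead_coef_eq0.
  rewrite -map_poly_comp rootE -Px; apply/eqP; congr _.[x].
  by apply: eq_map_poly => q; exact: iotaE.
have [theta [p p0 ptheta] xsE] := primitive_element charK algK.
pose L := subFExtend iota theta p.
pose ev : {rmorphism {poly {fraction {poly k}}} -> L} := subfx_eval iota theta p.
pose j : {rmorphism L -> F} := @subfx_inj _ _ iota theta p.
have jE q : j (ev q) = (map_poly iota q).[theta] by exact: subfx_inj_eval.
have ev_surj x : exists q, ev q = x.
  by have [q ->] := subfxE x; exists q.
have ev_alg : exists2 q, q != 0 & ev q = 0.
  by exists p => //; apply: (fmorph_inj j); rewrite jE rmorph0; apply/rootP.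
have [D [M [z [d [res DW d0]]]]] := residue_at_zero ev_surj ev_alg chark.
pose c : {rmorphism C -> L} :=
  ev \o polyC \o @FracField.tofrac {poly k} \o polyC \o g.
exists L, F, cls, j, c, D, M, z; split.
- case: res => r1 r2 r3 r4 r5 r6 r7; split=> //.
  + by move=> a; exact: r2.
  + by move=> a x; exact: r5.
  + move=> a /r6 ga; apply/eqP; rewrite -(fmorph_eq0 g); exact/eqP.
- move=> a; rewrite /c /= jE map_polyC hornerC /= iotaE -[RHS]/(c0 a) -fg.
  exact: evalpC.
- move=> x xxs; have [|q <-] := xsE (cls x); first exact: map_f.
  by exists (ev q).
- exists (ev ('X%:F)%:P), d; split=> //.
  by rewrite jE map_polyC hornerC /= iotaE; exact: evalpX.
Qed.

(** * Vectors and infinitesimal rotations *)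

Section Vectors.
Variable A : comNzRingType.
Implicit Types u v w : 'rV[A]_3.

Definition xc u := u 0 (inord 0).
Definition yc u := u 0 (inord 1).
Definition zc u := u 0 (inord 2).

Definition dot u v := xc u * xc v + yc u * yc v + zc u * zc v.

Definition cross u v : 'rV[A]_3 :=
  \row_i nth 0 [:: yc u * zc v - zc u * yc v; zc u * xc v - xc u * zc v;
                   xc u * yc v - yc u * xc v] i.

Lemma row3P u v : [/\ xc u = xc v, yc u = yc v & zc u = zc v] -> u = v.
Proof.
move=> [ux uy uz]; apply/rowP => i; rewrite -(inord_val i).
by case: i => [[|[|[|//]]] /= _].
Qed.

Lemma xcD u v : xc (u + v) = xc u + xc v. Proof. by rewrite /xc mxE. Qed.
Lemma ycD u v : yc (u + v) = yc u + yc v. Proof. by rewrite /yc mxE. Qed.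
Lemma zcD u v : zc (u + v) = zc u + zc v. Proof. by rewrite /zc mxE. Qed.
Lemma xcN u : xc (- u) = - xc u. Proof. by rewrite /xc mxE. Qed.
Lemma ycN u : yc (- u) = - yc u. Proof. by rewrite /yc mxE. Qed.
Lemma zcN u : zc (- u) = - zc u. Proof. by rewrite /zc mxE. Qed.
Lemma xcZ a u : xc (a *: u) = a * xc u. Proof. by rewrite /xc mxE. Qed.
Lemma ycZ a u : yc (a *: u) = a * yc u. Proof. by rewrite /yc mxE. Qed.
Lemma zcZ a u : zc (a *: u) = a * zc u. Proof. by rewrite /zc mxE. Qed.
Lemma xc0 : xc 0 = 0. Proof. by rewrite /xc mxE. Qed.
Lemma yc0 : yc 0 = 0. Proof. by rewrite /yc mxE. Qed.
Lemma zc0 : zc 0 = 0. Proof. by rewrite /zc mxE. Qed.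
Lemma xc_cross u v : xc (cross u v) = yc u * zc v - zc u * yc v.
Proof. by rewrite /xc mxE inordK. Qed.
Lemma yc_cross u v : yc (cross u v) = zc u * xc v - xc u * zc v.
Proof. by rewrite /yc mxE inordK. Qed.
Lemma zc_cross u v : zc (cross u v) = xc u * yc v - yc u * xc v.
Proof. by rewrite /zc mxE inordK. Qed.

Definition coordE := (xcD, ycD, zcD, xcN, ycN, zcN, xcZ, ycZ, zcZ,
  xc0, yc0, zc0, xc_cross, yc_cross, zc_cross).
End Vectors.

Ltac vec_ring := rewrite /dot ?coordE; ring.
Ltac vec_eq := apply: row3P; split; vec_ring.

Section MapVectors.
Variables (A B : comNzRingType).
Lemma xc_map (f : A -> B) u : xc (map_mx f u) = f (xc u).
Proof. by rewrite /xc mxE. Qed.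
Lemma yc_map (f : A -> B) u : yc (map_mx f u) = f (yc u).
Proof. by rewrite /yc mxE. Qed.
Lemma zc_map (f : A -> B) u : zc (map_mx f u) = f (zc u).
Proof. by rewrite /zc mxE. Qed.

Variable f : {rmorphism A -> B}.
End MapVectors.

Section Motion.
Variables (L : fieldType) (D : L -> L).
Hypothesis derD : derivation D.
Hypothesis two_neq0 : 2%:R != 0 :> L.
Implicit Types u v w p q e n : 'rV[L]_3.
Local Notation "v ^D" := (map_mx D v) (at level 2, format "v ^D").

Lemma derivation_dot u v : D (dot u v) = dot u^D v + dot u v^D.
Proof.
rewrite /dot !(derivationD derD) !(derivationM derD) !(xc_map, yc_map, zc_map).
ring.
Qed.

Lemma derivation_cross u v : (cross u v)^D = cross u^D v + cross u v^D.
Proof.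
apply: row3P; rewrite !(xc_map, yc_map, zc_map) !coordE.
rewrite !(derivationB derD) !(derivationM derD) !(xc_map, yc_map, zc_map).
by split; ring.
Qed.

Lemma derivation_scale a u : (a *: u)^D = D a *: u + a *: u^D.
Proof.
by apply: row3P; rewrite !(xc_map, yc_map, zc_map) !coordE
  !(xc_map, yc_map, zc_map) !(derivationM derD).
Qed.

Lemma derivation_sub u v : (u - v)^D = u^D - v^D.
Proof.
by apply: row3P; rewrite !(xc_map, yc_map, zc_map) !coordE
  !(xc_map, yc_map, zc_map) !(derivationB derD).
Qed.

Lemma basis_ext p q u v : dot (cross p q) (cross p q) != 0 ->
  dot u p = dot v p -> dot u q = dot v q ->
  dot u (cross p q) = dot v (cross p q) -> u = v.
Proof.
move=> N0 up uq uN.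
suff wE w : dot (cross p q) (cross p q) *: w = dot w (cross p q) *: cross p q
    + (dot w p * dot q q - dot w q * dot p q) *: p
    + (dot w q * dot p p - dot w p * dot p q) *: q.
  by apply: (scalerI N0); rewrite !wE up uq uN.
vec_eq.
Qed.

(** If the lengths and the angle of p and q are constants of D, then D moves them as
    a rigid body.  With N = p x q the angular velocity is
    ((Dq.N) p - (Dp.N) q + (Dp.q) N) / N.N, found by comparing the products of
    D p = w x p and D q = w x q with p, q and N. *)
Lemma rigid_velocity p q :
    D (dot p p) = 0 -> D (dot p q) = 0 -> D (dot q q) = 0 ->
    dot (cross p q) (cross p q) != 0 ->
  exists w, p^D = cross w p /\ q^D = cross w q.
Proof.
move=> pp pq qq N0; set N := cross p q; have NN : dot N N != 0 by [].
have half u : D (dot u u) = 0 -> dot u^D u = 0.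
  rewrite derivation_dot => uu; apply: (mulfI two_neq0); rewrite mulr0 -uu.
  vec_ring.
have {}pp := half _ pp; have {}qq := half _ qq.
have {}pq : dot p^D q = - dot q^D p.
  by apply/eqP; rewrite -addr_eq0 -pq derivation_dot; apply/eqP; vec_ring.
pose w := (dot N N)^-1 *: (dot q^D N *: p - dot p^D N *: q + dot p^D q *: N).
have wE v : dot N N * dot v w =
    dot v (dot q^D N *: p - dot p^D N *: q + dot p^D q *: N).
  rewrite /w; set t := (_ + _ *: N).
  have -> : dot v ((dot N N)^-1 *: t) = (dot N N)^-1 * dot v t by vec_ring.
  by rewrite mulrA divff // mul1r.
have tri u v : dot (cross w u) v = dot (cross u v) w by vec_ring.
exists w; split; apply: (basis_ext N0); apply: (mulfI NN); rewrite tri wE.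
- by rewrite pp /N; vec_ring.
- rewrite -/N; have -> : dot N (dot q^D N *: p - dot p^D N *: q + dot p^D q *: N)
    = dot p^D q * dot N N by rewrite /N; vec_ring.
  by rewrite mulrC.
- by rewrite /N; vec_ring.
- rewrite pq; have -> : cross q p = - N by rewrite /N; vec_eq.
  have -> : dot (- N) (dot q^D N *: p - dot p^D N *: q + - dot q^D p *: N)
    = dot q^D p * dot N N by rewrite /N; vec_ring.
  by rewrite mulrC.
- by rewrite qq /N; vec_ring.
- by rewrite /N; vec_ring.
Qed.
(** The difference d of the velocities satisfies d = (d.e) e + e x (d x e). *)
Lemma same_velocity_on_axis e w1 w2 : dot e e = 1 ->
  cross w1 e = cross w2 e -> w1 = w2 + dot (w1 - w2) e *: e.
Proof.
move=> ee we; set d := w1 - w2.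
have de : cross d e = 0.
  have -> : cross d e = cross w1 e - cross w2 e by rewrite /d; vec_eq.
  by rewrite we subrr.
have dE : dot e e *: d = dot d e *: e + cross e (cross d e) by vec_eq.
have c0 : cross e 0 = 0 by vec_eq.
by move: dE; rewrite ee scale1r de c0 addr0 => <-; rewrite /d addrC subrK.
Qed.

Lemma normal_velocity a w p q : D a = 0 ->
  p^D = cross w p -> q^D = cross w q ->
  (a *: cross p q)^D = cross w (a *: cross p q).
Proof.
move=> Da Dp Dq; rewrite derivation_scale derivation_cross Da Dp Dq.
vec_eq.
Qed.

(** The infinitesimal form of u = exp(i phi): two faces that rotate around their
    common edge e with angular velocities w1 and w2 change the dihedral angle
    phi at the rate - (w1 - w2).e.  The formula for u is that of exp(i phi),
    with cos phi = - n1.n2 and sin phi = - e.(n1 x n2). *)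
Lemma hinge_derivation i e n1 n2 w1 w2 : i * i = -1 -> D i = 0 ->
    dot e e = 1 -> dot e n1 = 0 -> e^D = cross w1 e -> e^D = cross w2 e ->
    n1^D = cross w1 n1 -> n2^D = cross w2 n2 ->
  D (- dot n1 n2 - i * dot e (cross n1 n2)) =
  - i * dot (w1 - w2) e * (- dot n1 n2 - i * dot e (cross n1 n2)).
Proof.
move=> ii Di ee en1 De1 De2 Dn1 Dn2.
(* w1 = w2 + k e: in a frame that moves with the second face, the first one
   rotates around e with velocity k. *)
have := same_velocity_on_axis ee (etrans (esym De1) De2).
set k := dot (w1 - w2) e => w1E.
have crossE v : cross w1 v = cross w2 v + k *: cross e v by rewrite w1E; vec_eq.
have Dc : D (dot n1 n2) = k * dot e (cross n1 n2).
  by rewrite derivation_dot Dn1 Dn2 crossE; vec_ring.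
have Ds : D (dot e (cross n1 n2)) = - (k * dot n1 n2).
  rewrite derivation_dot derivation_cross Dn1 Dn2 De2 crossE.
  transitivity (k * (dot e n1 * dot e n2 - dot e e * dot n1 n2)); first vec_ring.
  by rewrite ee en1; ring.
rewrite (derivationB derD) (derivationN derD) (derivationM derD) Di Dc Ds mul0r.
rewrite add0r; set s := dot e _; set co := dot n1 n2.
transitivity (- (k * s) + i * k * co); first by ring.
transitivity ((i * i) * (k * s) + i * k * co); last by ring.
by rewrite ii mulN1r.
Qed.
End Motion.

(** * Faces around the edges of a complex *)

Lemma cardfs2E (T : choiceType) (A : {fset T}) : #|` A| = 2%N ->
  exists x y, x != y /\ A = [fset x; y]%fset.
Proof.
move=> A2; have /fset0Pn[x xA] : A != fset0 by rewrite -cardfs_gt0 A2.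
have : #|` A `\ x|%fset == 1%N by move/eqP: A2; rewrite (cardfsD1 x) xA add1n eqSS.
move=> /cardfs1P[y Ax]; exists x, y.
have /fsetD1P[yx yA] : y \in (A `\ x)%fset by rewrite Ax fset11.
by rewrite eq_sym yx -(fsetD1K xA) Ax.
Qed.

Section Complex.
Variables (R : realType) (n : nat) (K : {fset {fset 'rV[R]_n}}).
Local Notation V := 'rV[R]_n.
Variable o : {fset V} -> V * V * V.
Hypotheses (Kc : strongly_connected_complex K) (Ko : orientation K o).

Definition boundary (t : {fset V}) : seq (V * V) :=
  let: (a, b, c) := o t in [:: (a, b); (b, c); (c, a)].

Lemma inducesE t u v : induces o t u v = ((u, v) \in boundary t).
Proof. by rewrite /induces /boundary; case: (o t) => [[a b] c]. Qed.

Lemma simplicesP d s : reflect (s \in K /\ #|` s| = d.+1) (s \in simplices K d).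
Proof.
rewrite /simplices !inE /=; apply: (iffP andP) => -[sK /eqP sd]; split=> //.

Qed.

Variant face_spec (t : {fset V}) : V * V * V -> Prop :=
  FaceSpec a b c of t = [fset a; b; c]%fset & a != b & b != c & c != a :
    face_spec t (a, b, c).

Lemma faceP t : t \in simplices K 2 -> face_spec t (o t).
Proof.
move=> tK; have := or_vertices Ko tK; case: (o t) => [[a b] c] tE.
have /simplicesP[_ ct] := tK.
constructor=> //; apply/eqP => ab; move: ct; rewrite tE ?ab.
- rewrite fsetUid => /eqP; rewrite cardfs2; by case: (_ != _).
- by rewrite -fsetUA fsetUid cardfs2; case: (_ != _).
- rewrite fsetUC fsetUA fsetUid cardfs2; by case: (_ != _).
Qed.

Lemma boundary_sub t e : t \in simplices K 2 -> e \in boundary t ->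
  ([fset e.1; e.2] `<=` t)%fset.
Proof.
move=> tK; rewrite /boundary; case: (faceP tK) => a b c tE _ _ _.
by rewrite tE !inE => /or3P[] /eqP -> /=; apply/fsubsetP => x;
  rewrite !inE => /orP[] ->; rewrite ?orbT.
Qed.

Lemma edge_of_boundary t e : t \in simplices K 2 -> e \in boundary t ->
  [fset e.1; e.2]%fset \in simplices K 1.
Proof.
move=> tK; have /simplicesP[tK' _] := tK.
move=> et; have eE := boundary_sub tK et; move: et.
rewrite /boundary; case: (faceP tK) => a b c tE ab bc ca et.
have neq : e.1 != e.2 by move: et; rewrite !inE => /or3P[] /eqP ->.
apply/simplicesP; rewrite cardfs2 neq; split=> //.
apply: (scc_face Kc tK') => //.
by apply/fset0Pn; exists e.1; rewrite !inE eqxx.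
Qed.

(** The two faces at an edge, in the order in which the first one induces the
    direction (u, v); the second one then induces (v, u). *)
Variant edge_spec (s : {fset V}) : Prop :=
  EdgeSpec (t1 t2 : {fset V}) (u v : V) of
    t1 \in simplices K 2 & t2 \in simplices K 2 & t1 != t2 &
    s = [fset u; v]%fset & u != v &
    (u, v) \in boundary t1 & (v, u) \in boundary t2 &
    (forall t, t \in simplices K 2 -> (s `<=` t)%fset -> t = t1 \/ t = t2).

Lemma edgeP s : s \in simplices K 1 -> edge_spec s.
Proof.
move=> sK; have /simplicesP[_ /cardfs2E[x [y [xy sE]]]] := sK.
have /cardfs2E[t1 [t2 [t12 tE]]] := scc_edge Kc sK.
have mem t : (t \in [fset t1; t2])%fset = (t \in simplices K 2) && (s `<=` t)%fset.
  by rewrite -tE !inE.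
have /andP[t1K st1] : (t1 \in simplices K 2) && (s `<=` t1)%fset.
  by rewrite -mem !inE eqxx.
have /andP[t2K st2] : (t2 \in simplices K 2) && (s `<=` t2)%fset.
  by rewrite -mem !inE eqxx orbT.
have only t : t \in simplices K 2 -> (s `<=` t)%fset -> t = t1 \/ t = t2.
  move=> tK st; have : (t \in [fset t1; t2])%fset by rewrite mem tK.
  by rewrite !inE => /orP[] /eqP; [left|right].
have dir u v : s = [fset u; v]%fset -> u != v -> (u, v) \in boundary t1 ->
    edge_spec s.
  move=> sE' uv uvt1; exists t1 t2 u v => //.
  by rewrite -inducesE; apply: (or_consistent Ko t1K) => //;
     rewrite -?sE' ?inducesE.
have : (x, y) \in boundary t1 \/ (y, x) \in boundary t1.
  move: st1; rewrite sE /boundary; case: (faceP t1K) => a b c -> _ _ _.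
  move=> /fsubsetP sub; move: (sub x) (sub y); rewrite !inE !eqxx ?orbT.
  move=> /(_ isT) /orP[/orP[]|] /eqP xE /(_ isT) /orP[/orP[]|] /eqP yE;
    move: xy; rewrite xE yE ?eqxx // => _ /=; rewrite ?eqxx ?orbT;
    by [left | right].
move=> [xyt|yxt]; first by apply: (dir x y).
by apply: (dir y x) => //; rewrite 1?eq_sym // sE fsetUC.
Qed.

Section DoubleCounting.
Variables (A : zmodType) (G : {fset V} -> V * V -> A).

(** Double counting of the flags formed by a face and a directed edge of its
    boundary. *)
Lemma sum_edges_faces :
  \sum_(s <- simplices K 1) \sum_(t <- simplices K 2)
     \sum_(e <- boundary t | [fset e.1; e.2]%fset == s) G t e =
  \sum_(t <- simplices K 2) \sum_(e <- boundary t) G t e.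
Proof.
rewrite exchange_big /= big_seq [RHS]big_seq; apply: eq_bigr => t tK.
under eq_bigr => s _ do rewrite big_mkcond.
rewrite exchange_big /= big_seq [RHS]big_seq; apply: eq_bigr => e et.
rewrite (bigD1_seq _ (edge_of_boundary tK et)) ?fset_uniq //= eqxx big1 ?addr0 //.
by move=> s /negPf; rewrite eq_sym => ->.
Qed.

(** The two faces at an edge run through it in opposite directions. *)
Lemma sum_around_edge s t1 t2 u v :
    t1 \in simplices K 2 -> t2 \in simplices K 2 -> t1 != t2 ->
    s = [fset u; v]%fset -> u != v ->
    (u, v) \in boundary t1 -> (v, u) \in boundary t2 ->
    (forall t, t \in simplices K 2 -> (s `<=` t)%fset -> t = t1 \/ t = t2) ->
  \sum_(t <- simplices K 2) \sum_(e <- boundary t | [fset e.1; e.2]%fset == s)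
    G t e = G t1 (u, v) + G t2 (v, u).
Proof.
move=> t1K t2K t12 sE uv uvt1 vut2 only.
have one t a b : t \in simplices K 2 -> s = [fset a; b]%fset -> a != b ->
    (a, b) \in boundary t ->
    \sum_(e <- boundary t | [fset e.1; e.2]%fset == s) G t e = G t (a, b).
  move=> tK sE' ab abt; rewrite -big_filter.
  suff -> : [seq e <- boundary t | [fset e.1; e.2]%fset == s] = [:: (a, b)].
    by rewrite big_seq1.
  have ne x y z : x != y -> y != z -> z != x ->
      (([fset x; y] == [fset z; x] :> {fset V})%fset = false) *
      (([fset z; x] == [fset x; y] :> {fset V})%fset = false).
    move=> xy yz zx; suff H : ([fset x; y] == [fset z; x] :> {fset V})%fset = false.
      by rewrite H eq_sym H.
    apply/negP => /eqP/fsetP/(_ y).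
    by rewrite !inE eqxx orbT (negPf yz) eq_sym (negPf xy).
  move: abt; rewrite /boundary sE'; case: (faceP tK) => x y z _ xy yz zx.
  rewrite !inE => /or3P[] /eqP[-> ->] /=; rewrite ?eqxx.
  - by rewrite (ne _ _ _ xy yz zx) (ne _ _ _ yz zx xy).
  - by rewrite (ne _ _ _ zx xy yz) (ne _ _ _ yz zx xy).
  - by rewrite (ne _ _ _ xy yz zx) (ne _ _ _ zx xy yz).
rewrite (bigD1_seq t1) ?fset_uniq //= -[X in _ + X]big_filter.
rewrite (bigD1_seq t2) ?filter_uniq ?mem_filter ?fset_uniq 1?eq_sym ?t12 //=.
rewrite (one t1 u v) // (one t2 v u) 1?eq_sym //; last by rewrite sE fsetUC.
rewrite [X in _ + (_ + X)]big1_seq ?addr0 // => t.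
rewrite mem_filter => /and3P[tt2 tt1 tK]; rewrite big1_seq // => e /andP[/eqP eE et].
have st : (s `<=` t)%fset by rewrite -eE; exact: boundary_sub.
have [tE|tE] := only t tK st; first by rewrite tE eqxx in tt1.
by rewrite tE eqxx in tt2.
Qed.

End DoubleCounting.
End Complex.

(** * Invariance of Lebesgue measure under shears *)

Section ProductSigmaFinite.
Context d1 d2 (T1 : measurableType d1) (T2 : measurableType d2) (R : realType).
Variables (m1 : {sigma_finite_measure set T1 -> \bar R})
  (m2 : {sigma_finite_measure set T2 -> \bar R}).

(** Exhaustions of the factors multiply to an exhaustion of the product. *)
Lemma product_sigma_finite : sigma_finite setT (m1 \x m2)%E.
Proof.
have /sigma_finiteP[F [FT ndF Foo]] := sigma_finiteT m1.
have /sigma_finiteP[G [GT ndG Goo]] := sigma_finiteT m2.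
have incl (T : Type) (H : nat -> set T) : {homo H : n k / (n <= k)%N >-> (n <= k)%O} ->
    forall n k x, (n <= k)%N -> H n x -> H k x.
  by move=> ndH n k x /ndH/subsetPset; apply.
exists (fun n => F n `*` G n) => [|n].
  apply/seteqP; split => // -[x y] _.
  have [n _ Fx] : (\bigcup_i F i) x by rewrite -FT.
  have [k _ Gy] : (\bigcup_i G i) y by rewrite -GT.
  exists (maxn n k) => //; split => /=.
    exact: incl ndF _ _ _ (leq_maxl _ _) Fx.
  exact: incl ndG _ _ _ (leq_maxr _ _) Gy.
have [mF Fn] := Foo n; have [mG Gn] := Goo n.
split; first exact: measurableX.
by rewrite product_measure1E // lte_mul_pinfty // ge0_fin_numE.
Qed.
End ProductSigmaFinite.

Section Translation.
Variable R : realType.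
Local Notation T := (measurableTypeR R).
Local Notation mu := (@lebesgue_measure R).

Lemma lebesgue_translation (a : R) (A : set T) : measurable A ->
  mu [set x | A (x + a)] = mu A.
Proof.
move=> mA; rewrite -[LHS]/(pushforward mu (+%R^~ a : T -> T) A).
have mf : measurable_fun setT (+%R^~ a : T -> T).
  by apply: measurable_realfun.measurable_funD.
apply/esym/lebesgue_measure_unique => // X /ocitvP[->|[[x y]/= xy ->]].
  by rewrite /= /pushforward preimage_set0 !measure0.
rewrite /= /pushforward.
have -> : (+%R^~ a : T -> T) @^-1` `]x, y]%classic = `]x - a, y - a]%classic.
  by apply/seteqP; split => z /=; rewrite !in_itv /= ltrBlDr lerBrDr.
rewrite !lebesgue_measure_itv /= !lte_fin ltrD2r xy.
by rewrite -!EFinB; congr EFin; ring.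
Qed.

Definition vol3 (B : set (T * T * T)) := ((mu \x mu) \x mu)%E B.

Lemma shear_measurable_z (g : T * T -> T) (B : set (T * T * T)) :
  measurable_fun setT g -> measurable B ->
  measurable [set p | B (p.1, p.2 + g p.1)].
Proof.
move=> mg mB; rewrite -[X in measurable X]setTI.
apply: (_ : measurable_fun setT (fun p : T * T * T => (p.1, p.2 + g p.1))) => //.
apply: measurable_fun_pair; first exact: measurable_fst.
apply: measurable_realfun.measurable_funD; first exact: measurable_snd.
by apply: measurableT_comp => //; exact: measurable_fst.
Qed.

(** On each vertical line a shear acts as a translation. *)
Lemma vol3_shear_z (g : T * T -> T) (B : set (T * T * T)) :
  measurable B -> vol3 [set p | B (p.1, p.2 + g p.1)] = vol3 B.
Proof.
move=> mB; apply: eq_integral => p _ /=.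
transitivity (mu [set z | xsection B p (z + g p)]).
  congr mu; apply/seteqP; split => z /=; rewrite /xsection /= !inE //.
by rewrite lebesgue_translation //; exact: measurable_xsection.
Qed.

Lemma fubini_swap d1 d2 (T1 : measurableType d1) (T2 : measurableType d2)
    (m1 : {sigma_finite_measure set T1 -> \bar R})
    (m2 : {sigma_finite_measure set T2 -> \bar R}) (X : set (T1 * T2)) :
  measurable X -> (m1 \x m2)%E X = (m1 \x^ m2)%E X.
Proof.
by move=> mX; apply: product_measure_unique => // A B mA mB; exact: product_measure2E.
Qed.

Let measurable_preim d (S : measurableType d) (f : S -> S) (B : set S) :
  measurable_fun setT f -> measurable B -> measurable [set p | B (f p)].
Proof. by move=> mf mB; rewrite -[X in measurable X]setTI; exact: mf. Qed.

Lemma area_shear_y (g : T -> T) (B : set (T * T)) : measurable B ->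
  (mu \x mu)%E [set p | B (p.1, p.2 + g p.1)] = (mu \x mu)%E B.
Proof.
move=> mB; apply: eq_integral => x _ /=.
transitivity (mu [set y | xsection B x (y + g x)]).
  by congr mu; apply/seteqP; split => y /=; rewrite /xsection /= !inE.
by rewrite lebesgue_translation //; exact: measurable_xsection.
Qed.

Lemma area_shear_x (g : T -> T) (B : set (T * T)) :
  measurable_fun setT g -> measurable B ->
  (mu \x mu)%E [set p | B (p.1 + g p.2, p.2)] = (mu \x mu)%E B.
Proof.
move=> mg mB; rewrite !fubini_swap //; last first.
  apply: (@measurable_preim _ _ (fun p : T * T => (p.1 + g p.2, p.2))) => //.
  apply: measurable_fun_pair; last exact: measurable_snd.
  apply: measurable_realfun.measurable_funD; first exact: measurable_fst.
  by apply: measurableT_comp => //; exact: measurable_snd.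
apply: eq_integral => y _ /=.
transitivity (mu [set x | ysection B y (x + g y)]).
  by congr mu; apply/seteqP; split => x /=; rewrite /ysection /= !inE.
by rewrite lebesgue_translation //; exact: measurable_ysection.
Qed.

Let measurable_shear_x (g : T * T -> T) : measurable_fun setT g ->
  measurable_fun setT
    (fun p : T * T * T => (p.1.1 + g (p.1.2, p.2), p.1.2, p.2)).
Proof.
move=> mg; apply: measurable_fun_pair; last exact: measurable_snd.
apply: measurable_fun_pair.
  apply: measurable_realfun.measurable_funD.
    by apply: measurableT_comp; exact: measurable_fst.
  apply: measurableT_comp => //; apply: measurable_fun_pair.
    by apply: measurableT_comp; [exact: measurable_snd|exact: measurable_fst].
  exact: measurable_snd.
by apply: measurableT_comp; [exact: measurable_snd|exact: measurable_fst].
Qed.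

Let measurable_shear_y (g : T * T -> T) : measurable_fun setT g ->
  measurable_fun setT
    (fun p : T * T * T => (p.1.1, p.1.2 + g (p.1.1, p.2), p.2)).
Proof.
move=> mg; apply: measurable_fun_pair; last exact: measurable_snd.
apply: measurable_fun_pair.
  by apply: measurableT_comp; exact: measurable_fst.
apply: measurable_realfun.measurable_funD.
  by apply: measurableT_comp; [exact: measurable_snd|exact: measurable_fst].
apply: measurableT_comp => //; apply: measurable_fun_pair.
  by apply: measurableT_comp; exact: measurable_fst.
exact: measurable_snd.
Qed.

(** The planar Lebesgue measure under a name of its own, so that its
    sigma-finiteness can be registered and Fubini applied to area times length. *)
Definition area : set (T * T) -> \bar R := (mu \x mu)%E.
HB.instance Definition _ := Measure.on area.
HB.instance Definition _ := Measure_isSigmaFinite.Build _ _ _ area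
  (product_sigma_finite mu mu).

(** Slicing by the last coordinate reduces the shears along the first two
    coordinates to planar ones. *)
Lemma vol3_swap (B : set (T * T * T)) : measurable B ->
  vol3 B = (\int[mu]_z (area (ysection B z)))%E.
Proof.
exact: (fubini_swap area mu).
Qed.

Lemma vol3_shear_x (g : T * T -> T) (B : set (T * T * T)) :
  measurable_fun setT g -> measurable B ->
  measurable [set p | B (p.1.1 + g (p.1.2, p.2), p.1.2, p.2)] /\
  vol3 [set p | B (p.1.1 + g (p.1.2, p.2), p.1.2, p.2)] = vol3 B.
Proof.
move=> mg mB; have mS := measurable_preim (measurable_shear_x mg) mB.
split=> //; rewrite (vol3_swap mS) (vol3_swap mB).
apply: eq_integral => z _ /=.
transitivity ((mu \x mu)%E
    [set p | ysection B z (p.1 + g (p.2, z), p.2)]).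
  by congr (_ \x _)%E; apply/seteqP; split => -[x y] /=; rewrite /ysection /= !inE.
rewrite (area_shear_x (g := fun y => g (y, z))) //.
  by apply: measurableT_comp => //; exact: measurable_pair2.
exact: measurable_ysection.
Qed.

Lemma vol3_shear_y (g : T * T -> T) (B : set (T * T * T)) :
  measurable_fun setT g -> measurable B ->
  measurable [set p | B (p.1.1, p.1.2 + g (p.1.1, p.2), p.2)] /\
  vol3 [set p | B (p.1.1, p.1.2 + g (p.1.1, p.2), p.2)] = vol3 B.
Proof.
move=> mg mB; have mS := measurable_preim (measurable_shear_y mg) mB.
split=> //; rewrite (vol3_swap mS) (vol3_swap mB).
apply: eq_integral => z _ /=.
transitivity ((mu \x mu)%E
    [set p | ysection B z (p.1, p.2 + g (p.1, z))]).
  by congr (_ \x _)%E; apply/seteqP; split => -[x y] /=; rewrite /ysection /= !inE.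
rewrite (area_shear_y (fun x => g (x, z))) //.
exact: measurable_ysection.
Qed.

End Translation.

(** * Volume-preserving maps of space *)

Section Volume.
Variable R : realType.
Local Notation T := (measurableTypeR R).
Implicit Types (u v w : 'rV[R]_3) (A B : set 'rV[R]_3).

Lemma dotpE u v : dotp u v = dot u v.
Proof.
rewrite /dotp /dot /xc /yc /zc !big_ord_recl big_ord0 addr0 addrA.
by congr (_ + _ + _); congr (_ * _); congr (_ _ _); apply/val_inj; rewrite /= inordK.
Qed.

Lemma xc_vec3 (a b c : R) : xc (vec3 a b c) = a.
Proof. by rewrite /xc mxE inordK. Qed.
Lemma yc_vec3 (a b c : R) : yc (vec3 a b c) = b.
Proof. by rewrite /yc mxE inordK. Qed.
Lemma zc_vec3 (a b c : R) : zc (vec3 a b c) = c.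
Proof. by rewrite /zc mxE inordK. Qed.
Definition vec3E := (xc_vec3, yc_vec3, zc_vec3).

Definition point (p : T * T * T) : 'rV[R]_3 := vec3 p.1.1 p.1.2 p.2.

Lemma volumeE A : volume A = vol3 [set p | A (point p)]. Proof. by []. Qed.

(** Measurability through the coordinates, since the volume is defined through
    them. *)
Definition measurable3 A := measurable [set p : T * T * T | A (point p)].

Definition measurable_coord (f : 'rV[R]_3 -> R) :=
  measurable_fun setT (fun p => f (point p) : T).

Lemma measurable_xc : measurable_coord (@xc R).
Proof.
rewrite /measurable_coord; under eq_fun do rewrite /point xc_vec3.
by apply: measurableT_comp; exact: measurable_fst.
Qed.
Lemma measurable_yc : measurable_coord (@yc R).
Proof.
rewrite /measurable_coord; under eq_fun do rewrite /point yc_vec3.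
by apply: measurableT_comp; [exact: measurable_snd|exact: measurable_fst].
Qed.
Lemma measurable_zc : measurable_coord (@zc R).
Proof.
rewrite /measurable_coord; under eq_fun do rewrite /point zc_vec3.
exact: measurable_snd.
Qed.

Lemma measurable_coordD f g : measurable_coord f -> measurable_coord g ->
  measurable_coord (fun v => f v + g v).
Proof. exact: measurable_realfun.measurable_funD. Qed.
Lemma measurable_coordM f g : measurable_coord f -> measurable_coord g ->
  measurable_coord (fun v => f v * g v).
Proof. exact: measurable_realfun.measurable_funM. Qed.

Lemma measurable_dot_sub x p : measurable_coord (fun y => dot (y - x) p).
Proof.
rewrite (_ : (fun y => _) =
  (fun y => xc p * xc y + yc p * yc y + zc p * zc y - dot x p)); last first.
  by apply/funext => y; vec_ring.
have cst a : measurable_coord (fun=> a) by exact: measurable_cst.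
have mx := measurable_xc; have my := measurable_yc; have mz := measurable_zc.
exact: (measurable_coordD (measurable_coordD (measurable_coordD
  (measurable_coordM (cst (xc p)) mx) (measurable_coordM (cst (yc p)) my))
  (measurable_coordM (cst (zc p)) mz)) (cst (- dot x p))).
Qed.

Lemma measurable3_gt f a : measurable_coord f -> measurable3 [set v | a < f v].
Proof.
move=> mf; rewrite /measurable3 -[X in measurable X]setTI.
rewrite (_ : [set p | a < f (point p)] = (fun p => f (point p) : T) @^-1` `]a, +oo[%classic).
  by apply: mf => //; exact: measurable_itv.
by apply/seteqP; split => p /=; rewrite in_itv /= andbT.
Qed.

Lemma measurable3C A : measurable3 A -> measurable3 (~` A).
Proof. exact: measurableC. Qed.
Lemma measurable3I A B : measurable3 A -> measurable3 B -> measurable3 (A `&` B).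
Proof. exact: measurableI. Qed.
Lemma measurable3U A B : measurable3 A -> measurable3 B -> measurable3 (A `|` B).
Proof. exact: measurableU. Qed.

Lemma measurable3_le f a : measurable_coord f -> measurable3 [set v | f v <= a].
Proof.
move=> mf; rewrite (_ : [set v | f v <= a] = ~` [set v | a < f v]).
  by apply: measurable3C; exact: measurable3_gt.
by apply/seteqP; split => v /=; rewrite leNgt => /negP.
Qed.

Lemma eballE (x : 'rV[R]_3) (r : R) : 0 < r -> eball x r = [set y | dot (y - x) (y - x) < r ^+ 2].
Proof.
move=> r0; have H (s : R) : (Num.sqrt s < r) = (s < r ^+ 2).
  by rewrite -(ltr_sqrt _ (exprn_gt0 2 r0)) sqrtr_sqr gtr0_norm.
by apply/seteqP; split => y; rewrite /eball /enorm /= dotpE H.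
Qed.

Lemma measurable_eball (x : 'rV[R]_3) (r : R) : 0 < r -> measurable3 (eball x r).
Proof.
move=> r0; rewrite eballE //.
rewrite (_ : [set y | dot (y - x) (y - x) < r ^+ 2] =
    [set y | - r ^+ 2 < - dot (y - x) (y - x)]).
  apply: measurable3_gt; pose e := vec3 (R := R).
  rewrite (_ : (fun y => _) = (fun y => (-1) *
     (dot (y - x) (e 1 0 0) * dot (y - x) (e 1 0 0) +
      dot (y - x) (e 0 1 0) * dot (y - x) (e 0 1 0) +
      dot (y - x) (e 0 0 1) * dot (y - x) (e 0 0 1)))); last first.
    by apply/funext => y; rewrite /dot /e !vec3E; ring.
  have sq p := measurable_coordM (measurable_dot_sub x p) (measurable_dot_sub x p).
  apply: (measurable_coordM (_ : measurable_coord (fun=> -1))).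
    exact: measurable_cst.
  exact: (measurable_coordD (measurable_coordD (sq _) (sq _)) (sq _)).
by apply/seteqP; split => y /=; rewrite ltrN2.
Qed.

Definition volume_preserving (Q : 'rV[R]_3 -> 'rV[R]_3) := forall A,
  measurable3 A -> measurable3 (Q @^-1` A) /\ volume (Q @^-1` A) = volume A.

Lemma volume_preserving_comp Q Q' : volume_preserving Q ->
  volume_preserving Q' -> volume_preserving (Q \o Q').
Proof.
move=> vQ vQ' A mA; have [mQA QA] := vQ _ mA; have [mQQ QQ] := vQ' _ mQA.
by split; [exact: mQQ|exact: etrans QQ QA].
Qed.

Let affine_measurable (a b c : R) :
  measurable_fun setT (fun p : T * T => a * p.1 + b * p.2 + c : T).
Proof.
apply: measurable_realfun.measurable_funD => //.
apply: measurable_realfun.measurable_funD;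
  apply: measurable_realfun.measurable_funM => //.
Qed.

Let volume_preserving_via (Q : 'rV[R]_3 -> 'rV[R]_3) (f : T * T * T -> T * T * T) :
  (forall p, Q (point p) = point (f p)) ->
  (forall B : set (T * T * T), measurable B -> measurable [set p | B (f p)] /\
     vol3 [set p | B (f p)] = vol3 B) ->
  volume_preserving Q.
Proof.
move=> Qf fP A mA; have [mf vf] := fP _ mA.
have E : [set p : T * T * T | (Q @^-1` A) (point p)] = [set p | A (point (f p))].
  by apply/seteqP; split => p; rewrite /preimage /= Qf.
by rewrite !volumeE /measurable3 E.
Qed.

Lemma volume_preserving_x (a b c : R) : volume_preserving
  (fun v => vec3 (xc v + (a * yc v + b * zc v + c)) (yc v) (zc v)).
Proof.
apply: (volume_preserving_via (f := fun p =>
    (p.1.1 + (a * p.1.2 + b * p.2 + c), p.1.2, p.2))).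
  by move=> p; rewrite /point /= !vec3E.
by move=> B mB; exact: (vol3_shear_x (affine_measurable a b c) mB).
Qed.

Lemma volume_preserving_y (a b c : R) : volume_preserving
  (fun v => vec3 (xc v) (yc v + (a * xc v + b * zc v + c)) (zc v)).
Proof.
apply: (volume_preserving_via (f := fun p =>
    (p.1.1, p.1.2 + (a * p.1.1 + b * p.2 + c), p.2))).
  by move=> p; rewrite /point /= !vec3E.
by move=> B mB; exact: (vol3_shear_y (affine_measurable a b c) mB).
Qed.

Lemma volume_preserving_z (a b c : R) : volume_preserving
  (fun v => vec3 (xc v) (yc v) (zc v + (a * xc v + b * yc v + c))).
Proof.
apply: (volume_preserving_via (f := fun p =>
    (p.1, p.2 + (a * p.1.1 + b * p.1.2 + c)))).
  by move=> p; rewrite /point /= !vec3E.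
move=> B mB; split; first exact: (shear_measurable_z (affine_measurable a b c) mB).
exact: (vol3_shear_z (fun p : T * T => a * p.1 + b * p.2 + c) mB).
Qed.

Lemma volume_translation x : volume_preserving (fun y => y - x).
Proof.
have := volume_preserving_comp (volume_preserving_x 0 0 (- xc x))
  (volume_preserving_comp (volume_preserving_y 0 0 (- yc x))
     (volume_preserving_z 0 0 (- zc x))).
congr volume_preserving; apply/funext => y /=; apply: row3P.
by rewrite !(vec3E, coordE) !mul0r !add0r.
Qed.

End Volume.

(** * Invariance of volume under rotations *)

Section Rotations.
Variable R : realType.
Implicit Types (u v w p q : 'rV[R]_3) (A B : set 'rV[R]_3).

(** The orthogonal maps that are already known to preserve volume. *)
Definition rotation (Q : 'rV[R]_3 -> 'rV[R]_3) :=
  (forall u v, dot (Q u) (Q v) = dot u v) /\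
  (forall u v, Q (u - v) = Q u - Q v) /\ volume_preserving Q.

Lemma rotation_comp Q Q' : rotation Q -> rotation Q' -> rotation (Q \o Q').
Proof.
move=> [dQ [lQ vQ]] [dQ' [lQ' vQ']]; split=> [u v /=|]; first by rewrite dQ dQ'.
split=> [u v /=|]; first by rewrite lQ' lQ.
exact: volume_preserving_comp.
Qed.

Definition rot_xy (c s : R) v := vec3 (c * xc v - s * yc v) (s * xc v + c * yc v) (zc v).
Definition rot_xz (c s : R) v := vec3 (c * xc v - s * zc v) (yc v) (s * xc v + c * zc v).
Definition rot_yz (c s : R) v := vec3 (xc v) (c * yc v - s * zc v) (s * yc v + c * zc v).

Let three_shears (c s : R) : c ^+ 2 + s ^+ 2 = 1 -> c != -1 ->
  exists t : R, forall a b : R, let a1 := a - t * b in let b1 := b + s * a1 in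
  b1 = s * a + c * b /\ a1 - t * b1 = c * a - s * b.
Proof.
move=> cs c1; have c10 : 1 + c != 0 by rewrite addrC addr_eq0.
(* The tangent of half the angle. *)
exists (s / (1 + c)) => a b /=.
have st : s / (1 + c) * s = 1 - c.
  have s2 : s ^+ 2 = 1 - c ^+ 2 by rewrite -cs addrC addKr.
  by rewrite mulrAC -expr2 s2; field.
have st' : s / (1 + c) * (1 + c) = s by rewrite mulfVK.
set t := s / (1 + c) in st st' *.
split.
  transitivity (s * a + (1 - t * s) * b); first by ring.
  by rewrite st; ring.
transitivity ((1 - t * s) * a - (t * (1 + (1 - t * s))) * b); first by ring.
by rewrite st -[in RHS]st'; ring.
Qed.

Let via_quarter (rot : R -> R -> 'rV[R]_3 -> 'rV[R]_3) :
  (forall c s c' s' v, rot c s (rot c' s' v) = rot (c * c' - s * s') (s * c' + c * s') v) ->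
  (forall c s, c ^+ 2 + s ^+ 2 = 1 -> c != -1 -> volume_preserving (rot c s)) ->
  forall c s, c ^+ 2 + s ^+ 2 = 1 -> volume_preserving (rot c s).
Proof.
move=> rotM rotV c s cs; have [c1|] := eqVneq c (-1); last exact: rotV.
have s0 : s = 0 by apply/eqP; rewrite -sqrf_eq0 -(addKr (c ^+ 2) (s ^+ 2)) cs c1; apply/eqP; ring.
(* The half-turn is the square of the quarter-turn. *)
have v01 : volume_preserving (rot 0 1) by apply: rotV; [ring | rewrite eq_sym oppr_eq0 oner_eq0].
have := volume_preserving_comp v01 v01; congr volume_preserving.
by apply/funext => v /=; rewrite rotM c1 s0; congr rot; ring.
Qed.

Lemma rotation_xy c s : c ^+ 2 + s ^+ 2 = 1 -> rotation (rot_xy c s).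
Proof.
move=> cs; split=> [u v|].
  transitivity ((c ^+ 2 + s ^+ 2) * (xc u * xc v + yc u * yc v) + zc u * zc v).
    by rewrite /dot /rot_xy !vec3E; ring.
  by rewrite cs mul1r.
split=> [u v|]; first by apply: row3P; rewrite /rot_xy !(coordE, vec3E); split; ring.
apply: via_quarter (cs) => [c1 s1 c2 s2 v|{cs}c {}s cs c1].
  by apply: row3P; rewrite /rot_xy !vec3E; split; ring.
have [t tE] := three_shears cs c1.
have := volume_preserving_comp (volume_preserving_x (- t) 0 0)
  (volume_preserving_comp (volume_preserving_y s 0 0) (volume_preserving_x (- t) 0 0)).
congr volume_preserving; apply/funext => v /=; apply: row3P.
have [e1 e2] := tE (xc v) (yc v); rewrite /rot_xy !vec3E !mul0r !addr0 !mulNr.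
by rewrite e2 [_ + s * _]e1.
Qed.

Lemma rotation_xz c s : c ^+ 2 + s ^+ 2 = 1 -> rotation (rot_xz c s).
Proof.
move=> cs; split=> [u v|].
  transitivity ((c ^+ 2 + s ^+ 2) * (xc u * xc v + zc u * zc v) + yc u * yc v).
    by rewrite /dot /rot_xz !vec3E; ring.
  by rewrite cs mul1r addrAC.
split=> [u v|]; first by apply: row3P; rewrite /rot_xz !(coordE, vec3E); split; ring.
apply: via_quarter (cs) => [c1 s1 c2 s2 v|{cs}c {}s cs c1].
  by apply: row3P; rewrite /rot_xz !vec3E; split; ring.
have [t tE] := three_shears cs c1.
have := volume_preserving_comp (volume_preserving_x 0 (- t) 0)
  (volume_preserving_comp (volume_preserving_z s 0 0) (volume_preserving_x 0 (- t) 0)).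
congr volume_preserving; apply/funext => v /=; apply: row3P.
have [e1 e2] := tE (xc v) (zc v).
rewrite /rot_xz !vec3E !mul0r !addr0 !add0r !mulNr.
by rewrite e2 [_ + s * _]e1.
Qed.

Lemma rotation_yz c s : c ^+ 2 + s ^+ 2 = 1 -> rotation (rot_yz c s).
Proof.
move=> cs; split=> [u v|].
  transitivity ((c ^+ 2 + s ^+ 2) * (yc u * yc v + zc u * zc v) + xc u * xc v).
    by rewrite /dot /rot_yz !vec3E; ring.
  by rewrite cs mul1r /dot; ring.
split=> [u v|]; first by apply: row3P; rewrite /rot_yz !(coordE, vec3E); split; ring.
apply: via_quarter (cs) => [c1 s1 c2 s2 v|{cs}c {}s cs c1].
  by apply: row3P; rewrite /rot_yz !vec3E; split; ring.
have [t tE] := three_shears cs c1.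
have := volume_preserving_comp (volume_preserving_y 0 (- t) 0)
  (volume_preserving_comp (volume_preserving_z 0 s 0) (volume_preserving_y 0 (- t) 0)).
congr volume_preserving; apply/funext => v /=; apply: row3P.
have [e1 e2] := tE (yc v) (zc v).
rewrite /rot_yz !vec3E !mul0r !addr0 !add0r !mulNr.
by rewrite e2 [_ + s * _]e1.
Qed.

Let givens (a b : R) : exists c s : R, c ^+ 2 + s ^+ 2 = 1 /\ s * a + c * b = 0 /\ 0 <= c * a - s * b.
Proof.
have [ab|ab] := eqVneq (a ^+ 2 + b ^+ 2) 0.
  have /andP[/eqP a0 /eqP b0] : (a == 0) && (b == 0).
    by rewrite -sqrf_eq0 -[b == 0]sqrf_eq0 -paddr_eq0 ?sqr_ge0 // ab.
  by exists 1, 0; rewrite a0 b0; split; [ring | split; [ring | lra]].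
have r0 : 0 < Num.sqrt (a ^+ 2 + b ^+ 2).
  by rewrite sqrtr_gt0 lt_neqAle eq_sym ab addr_ge0 ?sqr_ge0.
have rr : Num.sqrt (a ^+ 2 + b ^+ 2) ^+ 2 = a ^+ 2 + b ^+ 2.
  by rewrite sqr_sqrtr // addr_ge0 ?sqr_ge0.
set r := Num.sqrt _ in r0 rr; have rn : r != 0 by rewrite gt_eqF.
exists (a / r), (- (b / r)); split.
  transitivity ((a ^+ 2 + b ^+ 2) / r ^+ 2); first by field.
  by rewrite -rr divff // expf_neq0.
split; first by field.
have -> : a / r * a - - (b / r) * b = (a ^+ 2 + b ^+ 2) / r by field.
by rewrite -rr expr2 mulfK // ltW.
Qed.

(** Givens rotations: a rotation in the xz-plane, then one in the xy-plane, bring p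
    to the first basis vector; one in the yz-plane then brings q to the second. *)
Lemma align p q : dot p p = 1 -> dot q q = 1 -> dot p q = 0 ->
  exists Q, [/\ rotation Q, Q p = vec3 1 0 0 & Q q = vec3 0 1 0].
Proof.
move=> pp qq pq.
have [c1 [s1 [cs1 [e1 _]]]] := givens (xc p) (zc p).
pose p1 := rot_xz c1 s1 p.
have [c2 [s2 [cs2 [e2 g2]]]] := givens (xc p1) (yc p1).
pose Q2 := rot_xy c2 s2 \o rot_xz c1 s1.
have rQ2 : rotation Q2 by apply: rotation_comp; [exact: rotation_xy|exact: rotation_xz].
have z1 : zc p1 = 0 by rewrite /p1 /rot_xz vec3E.
have Q2p : Q2 p = vec3 1 0 0.
  have yp : yc (Q2 p) = 0 by rewrite /Q2 /= /rot_xy vec3E.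
  have zp : zc (Q2 p) = 0 by rewrite /Q2 /= /rot_xy vec3E.
  have xp : 0 <= xc (Q2 p) by rewrite /Q2 /= /rot_xy vec3E.
  have : dot (Q2 p) (Q2 p) = 1 by rewrite rQ2.1.
  rewrite /dot yp zp !mul0r !addr0 -expr2 => /eqP; rewrite sqrp_eq1 // => /eqP x1.
  by apply: row3P; rewrite x1 yp zp !vec3E.
pose q2 := Q2 q.
have [c3 [s3 [cs3 [e3 g3]]]] := givens (yc q2) (zc q2).
have x2 : xc q2 = 0.
  have xcE v : dot (vec3 1 0 0) v = xc v by rewrite /dot !vec3E; ring.
  by rewrite -xcE -Q2p rQ2.1.
exists (rot_yz c3 s3 \o Q2); split.
- exact: (rotation_comp (rotation_yz cs3) rQ2).
- by rewrite /= Q2p; apply: row3P; rewrite /rot_yz !vec3E !mulr0 subrr addr0.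
- have zq : zc (rot_yz c3 s3 q2) = 0 by rewrite /rot_yz vec3E.
  have yq : 0 <= yc (rot_yz c3 s3 q2) by rewrite /rot_yz vec3E.
  have xq : xc (rot_yz c3 s3 q2) = 0 by rewrite /rot_yz vec3E.
  have : dot (rot_yz c3 s3 q2) (rot_yz c3 s3 q2) = 1.
    by rewrite (rotation_yz cs3).1 rQ2.1.
  rewrite {1}/dot xq zq !mul0r add0r addr0 -expr2 => /eqP; rewrite sqrp_eq1 // => /eqP y1.
  rewrite /= -/q2; apply: row3P; rewrite xq y1 zq !vec3E.
  by [].
Qed.
End Rotations.

(** * The volume of a wedge of a ball *)

Section Wedge.
Variable R : realType.

(** As f is additive below h only, the multiples n c of a small c are reduced modulo
    h / 2, where the deviation G of f from linearity vanishes: the values n G c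
    stay bounded, hence G c = 0. *)
Lemma bounded_additive_linear (f : R -> R) (h V : R) : 0 < h ->
    (forall a c, 0 < a -> 0 < c -> a + c < h -> f (a + c) = f a + f c) ->
    (forall c, 0 < c < h -> 0 <= f c <= V) -> V = 4 * f (h / 2) ->
  forall b, 0 < b < h -> f b = b / (2 * h) * V.
Proof.
move=> h0 fD fV f2 b.
pose G b := f b - b / (2 * h) * V.
have GD a c : 0 < a -> 0 < c -> a + c < h -> G (a + c) = G a + G c.
  by move=> a0 c0 ac; rewrite /G fD //; ring.
have G2 : G (h / 2) = 0.
  have pin : h != 0 :> R by rewrite gt_eqF.
  by rewrite /G f2; field.
have Gbnd c : 0 < c < h -> `|G c| <= V.
  move=> cc; have /andP[W0 W1] := fV _ cc; have /andP[c0 cpi] := cc.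
  have d01 : 0 <= c / (2 * h) <= 1.
    have pi20 : 0 < 2 * h :> R by rewrite mulr_gt0.
    rewrite (divr_ge0 (ltW c0) (ltW pi20)) /= ler_pdivrMr // mul1r.
    by move: c0 cpi h0; clear; lra.
  by rewrite ler_norml /G; move: (c / _) d01 => d /andP[d0 d1]; apply/andP; split; nra.
have small c : 0 < c < h / 2 -> G c = 0.
  move=> /andP[c0 c2].
  have iter n : exists2 d, 0 < d <= h / 2 & G d = n%:R * G c.
    elim: n => [|n [d /andP[d0 d2] Gd]].
      by exists (h / 2); rewrite ?mul0r // lexx divr_gt0.
    have dc : G (d + c) = n.+1%:R * G c.
      rewrite GD //; first by rewrite Gd -natr1; ring.
      by move: d0 d2 c0 c2 h0; clear; lra.
    have [le2|gt2] := leP (d + c) (h / 2).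
      by exists (d + c) => //; rewrite le2 addr_gt0.
    exists (d + c - h / 2).
      by move: gt2 d0 d2 c0 c2 h0; clear => *; apply/andP; split; lra.
    rewrite -dc; have := GD (d + c - h / 2) (h / 2).
    rewrite subrK G2 addr0 => ->; rewrite ?subr_gt0 ?divr_gt0 //.
    by move: d0 d2 c0 c2 h0; clear; lra.
  apply/eqP; apply: contraT => Gc; exfalso.
  have Gc0 : 0 < `|G c| by rewrite normr_gt0.
  have [n nP] : exists n : nat, V / `|G c| < n%:R.
    by exists (Num.truncn (V / `|G c|)).+1; exact: truncnS_gt.
  have [d /andP[d0 d2] Gd] := iter n.
  have : `|G d| <= V.
    by apply: Gbnd; rewrite d0 /=; move: d2 h0; clear; lra.
  rewrite Gd normrM normr_nat leNgt => /negP; apply.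
  by rewrite -ltr_pdivrMr.
move=> /andP[b0 bpi]; apply/eqP; rewrite -subr_eq0 -/(G b); apply/eqP.
have [b2|b2|->] := ltgtP b (h / 2) => //; first by apply: small; rewrite b0.
have := GD (b - h / 2) (h / 2).
have bh : 0 < b - h / 2 < h / 2.
  by move: b0 b2 bpi h0; clear => *; apply/andP; split; lra.
by rewrite subrK G2 addr0 (small _ bh) => -> //; rewrite ?subr_gt0 ?divr_gt0.
Qed.

Implicit Types (u v w p q : 'rV[R]_3) (A B : set 'rV[R]_3).
Local Notation T := (measurableTypeR R).
Local Notation mu := (@lebesgue_measure R).

Lemma volume_box (I J L : interval R) :
  volume [set v | xc v \in I /\ yc v \in J /\ zc v \in L] =
  (mu [set` I] * mu [set` J] * mu [set` L])%E.
Proof.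
have mIJ : measurable ([set` I] `*` [set` J] : set (T * T)).
  by apply: measurableX; exact: measurable_itv.
have mL : measurable ([set` L] : set T) by exact: measurable_itv.
have -> : (mu [set` I] * mu [set` J] * mu [set` L])%E =
    (area (R := R) [set p | p.1 \in I /\ p.2 \in J] * mu [set` L])%E.
  by congr (_ * _)%E; rewrite /area -product_measure1E //; exact: measurable_itv.
rewrite -(product_measure1E (area (R := R)) mu mIJ mL).
rewrite volumeE; congr vol3.
apply/seteqP; split => -[[x y] z]; rewrite /point /= !vec3E; first by move=> [? []].
by move=> [[]].
Qed.

Lemma measurable_box (I J L : interval R) :
  measurable3 [set v : 'rV[R]_3 | xc v \in I /\ yc v \in J /\ zc v \in L].
Proof.
rewrite /measurable3.
rewrite (_ : [set p | _] = ([set` I] `*` [set` J]) `*` [set` L]); last first.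
  apply/seteqP; split => -[[x y] z]; rewrite /point /= !vec3E; first by move=> [? []].
  by move=> [[]].
by apply: measurableX; [apply: measurableX|]; exact: measurable_itv.
Qed.

Lemma volume_le A B : measurable3 A -> measurable3 B -> A `<=` B ->
  (volume A <= volume B)%E.
Proof.
move=> mA mB AB; rewrite !volumeE.
apply: (@le_measure _ _ _ (area (R := R) \x mu)%E); rewrite ?inE //.
by move=> p; exact: AB.
Qed.

Lemma volumeU A B : measurable3 A -> measurable3 B -> A `&` B = set0 ->
  volume (A `|` B) = (volume A + volume B)%E.
Proof.
move=> mA mB AB; rewrite !volumeE.
apply: (@measureU _ _ _ (area (R := R) \x mu)%E) => //.
apply/seteqP; split => // p [Ap Bp].
by have : (A `&` B) (point p) by []; rewrite AB.
Qed.

Lemma volume_plane : volume [set v : 'rV[R]_3 | xc v = 0] = 0%E.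
Proof.
have := volume_box `[0, 0] `]-oo, +oo[ `]-oo, +oo[.
rewrite [X in (X * _ * _)%E]lebesgue_measure_itv /= ltxx !mul0e => <-.
congr volume; apply/seteqP; split => v /=; rewrite !in_itv /=.
  by move=> ->; rewrite lexx.
by move=> [/andP[h1 h2] _]; apply/eqP; rewrite eq_le h1 h2.
Qed.

Lemma volume_ge0 A : (0 <= volume A)%E.
Proof. by rewrite volumeE; exact: (measure_ge0 (area (R := R) \x mu)%E). Qed.

Lemma volume_eball_fin (r : R) : 0 < r -> (volume (eball 0 r) < +oo)%E.
Proof.
move=> r0; pose I := `[- r, r].
apply: (@le_lt_trans _ _ (volume [set v | xc v \in I /\ yc v \in I /\ zc v \in I])).
  apply: volume_le; [exact: measurable_eball|exact: measurable_box|].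
  move=> v; rewrite eballE //= subr0 /dot => vr.
  have h a b c : a * a + b * b + c * c < r ^+ 2 -> - r <= a <= r by nra.
  rewrite !in_itv /= !(h _ _ _ vr); split=> //.
  by rewrite (h (yc v) (xc v) (zc v)) ?(h (zc v) (xc v) (yc v)) //; lra.
rewrite volume_box /I !lebesgue_measure_itv /= lte_fin.
by case: ifP => _; rewrite ?mule0 // -!EFinB -!EFinM ltry.
Qed.

Lemma volume_eball_gt0 (r : R) : 0 < r -> (0 < volume (eball 0 r))%E.
Proof.
move=> r0; pose I := `[0, r / 2].
apply: (@lt_le_trans _ _ (volume [set v | xc v \in I /\ yc v \in I /\ zc v \in I])).
  rewrite volume_box /I !lebesgue_measure_itv /= lte_fin.
  by rewrite divr_gt0 // -!EFinB -!EFinM lte_fin subr0 !mulr_gt0 ?divr_gt0.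
apply: volume_le; [exact: measurable_box|exact: measurable_eball|].
move=> v /=; rewrite eballE //= subr0 /dot !in_itv /=.
by move=> [/andP[h1 h2] [/andP[h3 h4] /andP[h5 h6]]]; nra.
Qed.

Lemma disjoint A B : (forall v, A v -> B v -> False) -> A `&` B = set0.
Proof. by move=> AB; apply/seteqP; split => // v [Av Bv]; case: (AB v). Qed.

Section FixedBall.
Variables (r : R).
Hypothesis r0 : 0 < r.
Let ball := eball (0 : 'rV[R]_3) r.

Definition vol A := fine (volume A).

Lemma volume_fin A : measurable3 A -> A `<=` ball -> volume A \is a fin_num.
Proof.
move=> mA sA; rewrite ge0_fin_numE ?volume_ge0 //.
apply: le_lt_trans (volume_eball_fin r0).
by apply: volume_le => //; exact: measurable_eball.
Qed.

Lemma volU A B : measurable3 A -> measurable3 B -> A `<=` ball -> B `<=` ball ->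
  A `&` B = set0 -> vol (A `|` B) = vol A + vol B.
Proof. by move=> mA mB sA sB AB; rewrite /vol volumeU // fineD ?volume_fin. Qed.

Lemma vol_ge0 A : 0 <= vol A.
Proof. by rewrite fine_ge0 // volume_ge0. Qed.

Lemma vol_le A : measurable3 A -> A `<=` ball -> vol A <= vol ball.
Proof.
move=> mA sA; rewrite fine_le ?volume_fin //; first exact: measurable_eball.
by apply: volume_le => //; exact: measurable_eball.
Qed.

(** The part of the ball between half-planes orthogonal to p and to q; for
    q = cos b p + sin b p' it is a wedge of angle b around the axis orthogonal to
    p and p'. *)
Definition wedge p q := [set v | [/\ ball v, 0 < dot v p & dot v q <= 0]].

Lemma wedge_sub p q : wedge p q `<=` ball. Proof. by move=> v []. Qed.

Lemma measurable_dot p : measurable_coord (fun y => dot y p).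
Proof.
have := measurable_dot_sub 0 p; congr measurable_coord.
by apply/funext => y; rewrite subr0.
Qed.

Lemma measurable_wedge p q : measurable3 (wedge p q).
Proof.
rewrite (_ : wedge p q = (ball `&` [set v | 0 < dot v p]) `&` [set v | dot v q <= 0]).
  apply: measurable3I; last by apply: measurable3_le; exact: measurable_dot.
  apply: measurable3I; first exact: measurable_eball.
  by apply: measurable3_gt; exact: measurable_dot.
by apply/seteqP; split => v; [move=> [] | move=> [[]]].
Qed.

Lemma rotation_ball Q : rotation Q -> Q @^-1` ball = ball.
Proof.
move=> [dQ _]; rewrite /ball eballE //; apply/seteqP; split => v /=;
  by rewrite !subr0 dQ.
Qed.

Definition e1 : 'rV[R]_3 := vec3 1 0 0.
Definition e2 : 'rV[R]_3 := vec3 0 1 0.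

Definition wedge_vol b := vol (wedge e1 (cos b *: e1 + sin b *: e2)).

Lemma dot_comb v p q (a b : R) : dot v (a *: p + b *: q) = a * dot v p + b * dot v q.
Proof. vec_ring. Qed.

(** The volume of a wedge depends on its angle only, because a rotation brings it
    to the standard position. *)
Lemma vol_wedge p q b : dot p p = 1 -> dot q q = 1 -> dot p q = 0 ->
  vol (wedge p (cos b *: p + sin b *: q)) = wedge_vol b.
Proof.
move=> pp qq pq; have [Q [rQ Qp Qq]] := align pp qq pq.
have [dQ [_ vQ]] := rQ; rewrite /wedge_vol /vol.
rewrite -(vQ _ (measurable_wedge e1 (cos b *: e1 + sin b *: e2))).2.
have bQ v : ball (Q v) = ball v by rewrite -[in RHS](rotation_ball rQ).
congr (fine (volume _)); rewrite /wedge; apply/seteqP; split => v /=;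
  by rewrite bQ !dot_comb -(dQ v p) -(dQ v q) Qp Qq.
Qed.

Lemma e11 : dot e1 e1 = 1. Proof. by rewrite /dot !vec3E; ring. Qed.
Lemma e22 : dot e2 e2 = 1. Proof. by rewrite /dot !vec3E; ring. Qed.
Lemma e12 : dot e1 e2 = 0. Proof. by rewrite /dot !vec3E; ring. Qed.

(** A wedge of angle a + b is cut by a plane into wedges of angles a and b. *)
Lemma wedge_volD a b : 0 < a -> 0 < b -> a + b < pi ->
  wedge_vol (a + b) = wedge_vol a + wedge_vol b.
Proof.
move=> a0 b0 abpi.
pose p := cos a *: e1 + sin a *: e2; pose q := - sin a *: e1 + cos a *: e2.
have sc : cos a * cos a + sin a * sin a = 1 by rewrite -!expr2 cos2Dsin2.
have pp : dot p p = 1.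
  by rewrite /p /dot /e1 /e2 !(coordE, vec3E) -[RHS]sc; ring.
have qq : dot q q = 1.
  by rewrite /q /dot /e1 /e2 !(coordE, vec3E) -[RHS]sc; ring.
have pq : dot p q = 0 by rewrite /p /q /dot /e1 /e2 !(coordE, vec3E); ring.
rewrite -(vol_wedge b pp qq pq).
have disj : wedge e1 p `&` wedge p (cos b *: p + sin b *: q) = set0.
  by apply/seteqP; split => // v [[_ _ h] [_ h' _]]; move: h'; rewrite ltNge h.
rewrite /wedge_vol -/p.
rewrite -(volU (measurable_wedge _ _) (measurable_wedge _ _)
  (@wedge_sub _ _) (@wedge_sub _ _) disj).
have pE v : dot v p = cos a * dot v e1 + sin a * dot v e2 by exact: dot_comb.
have qE v : dot v (cos b *: p + sin b *: q) =
    cos (a + b) * dot v e1 + sin (a + b) * dot v e2.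
  by rewrite cosD sinD /p /q; vec_ring.
have sa : 0 < sin a by apply: sin_gt0_pi; lra.
have sb : 0 < sin b by apply: sin_gt0_pi; lra.
have sab : 0 < sin (a + b) by apply: sin_gt0_pi; lra.
(* The sine addition formula: the three functionals are linearly dependent. *)
have I v : sin a * dot v (cos b *: p + sin b *: q) = sin (a + b) * dot v p - sin b * dot v e1.
  rewrite qE pE cosD sinD.
  transitivity (sin a * (cos a * cos b - sin a * sin b) * dot v e1 + sin a * (sin a * cos b + cos a * sin b) * dot v e2); first by ring.
  transitivity ((sin a * cos b + cos a * sin b) * (cos a * dot v e1 + sin a * dot v e2) - sin b * dot v e1 * (cos a * cos a + sin a * sin a)); first by ring.
  by rewrite sc mulr1.
congr vol; apply/seteqP; split => v.
  move=> [bv x0]; rewrite dot_comb -qE => le0.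
  have [pv|pv] := leP (dot v p) 0; first by left.
  by right.
move=> [[bv x0 pv]|[bv pv le0]]; split=> //; rewrite ?dot_comb -?qE //.
  have := I v; move: (dot v _) => z zE; nra.
by have := I v; move: le0; move: (dot v (_ + _ *: q)) => z zE; nra.
Qed.

(** Up to the plane x = 0, of volume 0, the ball is the union of four wedges of
    angle pi / 2. *)
Lemma vol_ball_quarters : vol ball = 4 * wedge_vol (pi / 2).
Proof.
have W p q : dot p p = 1 -> dot q q = 1 -> dot p q = 0 ->
    vol (wedge p q) = wedge_vol (pi / 2).
  move=> pp qq pq; rewrite -(vol_wedge _ pp qq pq) cos_pihalf sin_pihalf.
  by rewrite scale0r scale1r add0r.
have W1 := W _ _ e11 e22 e12.
have W2 : vol (wedge (- e2) e1) = wedge_vol (pi / 2).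
  by apply: W; rewrite /dot !(coordE, vec3E); ring.
have W3 : vol (wedge (- e1) (- e2)) = wedge_vol (pi / 2).
  by apply: W; rewrite /dot !(coordE, vec3E); ring.
have W4 : vol (wedge e2 (- e1)) = wedge_vol (pi / 2).
  by apply: W; rewrite /dot !(coordE, vec3E); ring.
have xE v : dot v e1 = xc v by rewrite /dot !vec3E; ring.
have yE v : dot v e2 = yc v by rewrite /dot !vec3E; ring.
have xN v : dot v (- e1) = - xc v by rewrite -xE; vec_ring.
have yN v : dot v (- e2) = - yc v by rewrite -yE; vec_ring.
move: W1 W2 W3 W4 xE yE xN yN; move: e1 e2 (- e1) (- e2) => a b a' b'.
move=> W1 W2 W3 W4 xE yE xN yN.
pose Wa := wedge a b; pose Wb := wedge b' a.
pose Wc := wedge a' b'; pose Wd := wedge b a'.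
have [ma mb mc md] : [/\ measurable3 Wa, measurable3 Wb, measurable3 Wc & measurable3 Wd].
  by split; exact: measurable_wedge.
have [sa sb sc sd] : [/\ Wa `<=` ball, Wb `<=` ball, Wc `<=` ball & Wd `<=` ball].
  by split; exact: wedge_sub.
have mbl : measurable3 ball by exact: measurable_eball.
pose U := Wa `|` Wb `|` Wc `|` Wd.
have mU : measurable3 U by repeat apply: measurable3U.
have sU : U `<=` ball by move=> v [[[/sa|/sb]|/sc]|/sd].
have volUE : vol U = 4 * wedge_vol (pi / 2).
  have dab : Wa `&` Wb = set0.
    by apply: disjoint => v [_ + +] [_ + +]; rewrite xE yE yN;
      move: (xc v) (yc v) => x y; clear; lra.
  have dabc : (Wa `|` Wb) `&` Wc = set0.
    by apply: disjoint => v [] [_ + +] [_ + +]; rewrite ?xE ?yE ?yN ?xN;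
      move: (xc v) (yc v) => x y; clear; lra.
  have dabcd : (Wa `|` Wb `|` Wc) `&` Wd = set0.
    by apply: disjoint => v [[]|] [_ + +] [_ + +]; rewrite ?xE ?yE ?yN ?xN;
      move: (xc v) (yc v) => x y; clear; lra.
  have mab := measurable3U ma mb; have mabc := measurable3U mab mc.
  have sab : Wa `|` Wb `<=` ball by move=> v [/sa|/sb].
  have sabc : Wa `|` Wb `|` Wc `<=` ball by move=> v [[/sa|/sb]|/sc].
  rewrite /U (volU mabc md sabc sd dabcd) (volU mab mc sab sc dabc).
  by rewrite (volU ma mb sa sb dab) /Wa /Wb /Wc /Wd W1 W2 W3 W4; ring.
have vol0 : vol (ball `\` U) = 0.
  clear volUE W1 W2 W3 W4.
  suff : (volume (ball `\` U) <= 0)%E.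
    by move=> h; apply/eqP; rewrite eq_le vol_ge0 andbT /vol fine_le0.
  rewrite -volume_plane; apply: volume_le.
  - exact: measurable3I mbl (measurable3C mU).
  - have := measurable_box `[0, 0] `]-oo, +oo[ `]-oo, +oo[; congr measurable3.
    apply/seteqP; split => v /=; rewrite !in_itv /=.
      by move=> [/andP[h1 h2] _]; apply/eqP; rewrite eq_le h1 h2.
    by move=> ->; rewrite lexx.
  - move=> v [bv nU] /=; apply/eqP/contraT => x0; exfalso; apply: nU.
    rewrite /U /Wa /Wb /Wc /Wd /wedge /= !xE !yE !xN !yN.
    have [xp|xn] : (0 < xc v) \/ (xc v < 0).
      by move: x0; rewrite neq_lt => /orP[]; [right|left].
    + have [y0|y0] := leP (yc v) 0; first by left; left; left.
      by right; split; rewrite // oppr_le0 ltW.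
    + have [y0|y0] := leP 0 (yc v).
        by left; right; split; rewrite ?oppr_gt0 ?oppr_le0.
      by left; left; right; split; [exact: bv | rewrite oppr_gt0 | exact: ltW].
have mD : measurable3 (ball `\` U) := measurable3I mbl (measurable3C mU).
have sD : ball `\` U `<=` ball by move=> v [].
have dD : U `&` (ball `\` U) = set0 by apply: disjoint => v Uv [_ nUv]; exact: nUv Uv.
rewrite -volUE -[RHS]addr0 -vol0 -(volU mU mD sU sD dD).
congr vol; apply/seteqP; split => v; last by case=> [/sU|[]].
move=> bv; have [Uv|nUv] := pselect (U v); first by left; exact: Uv.
right; split; [exact: bv | exact: nUv].
Qed.

Lemma wedge_vol_linear b : 0 < b < pi -> wedge_vol b = b / (2 * pi) * vol ball.
Proof.
apply: (bounded_additive_linear (pi_gt0 R) wedge_volD) => [c c0|]; last exact: vol_ball_quarters.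
rewrite vol_ge0 /=; apply: vol_le; [exact: measurable_wedge | exact: wedge_sub].
Qed.
End FixedBall.

Lemma volume_wedge x r p q b : 0 < r -> dot p p = 1 -> dot q q = 1 ->
    dot p q = 0 -> 0 < b < pi ->
  fine (volume [set y | [/\ eball x r y, 0 < dot (y - x) p &
                          dot (y - x) (cos b *: p + sin b *: q) <= 0]]) =
  b / (2 * pi) * fine (volume (eball x r)).
Proof.
move=> r0 pp qq pq b0; set q' := _ + _.
have bE y : eball x r y = eball 0 r (y - x) by rewrite /eball /= subr0.
have -> : [set y | [/\ eball x r y, 0 < dot (y - x) p & dot (y - x) q' <= 0]] =
    (fun y => y - x) @^-1` wedge r p q'.
  by apply/seteqP; split => y; rewrite /= bE.
have -> : eball x r = (fun y => y - x) @^-1` eball 0 r by apply/funext.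
rewrite (volume_translation x (measurable_wedge r0 _ _)).2.
rewrite (volume_translation x (measurable_eball 0 r0)).2.
rewrite -[LHS]/(vol _) vol_wedge // wedge_vol_linear //.
Qed.

Lemma fine_volume_eball_gt0 (x : 'rV[R]_3) (r : R) : 0 < r -> 0 < fine (volume (eball x r)).
Proof.
move=> r0; have -> : eball x r = (fun y => y - x) @^-1` eball 0 r.
  by apply/funext => y; rewrite /eball /= subr0.
rewrite (volume_translation x (measurable_eball 0 r0)).2.
by rewrite fine_gt0 // volume_eball_gt0 // volume_eball_fin.
Qed.
End Wedge.

(** * Connected components and half-spaces *)

Section Topology.
Variable R : realType.
Implicit Types (u v w p q : 'rV[R]_3) (A B : set 'rV[R]_3).

Lemma continuous_dot_sub x p : continuous (fun y : 'rV[R]_3 => dot (y - x) p : R).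
Proof.
have -> : (fun y : 'rV[R]_3 => dot (y - x) p) =
    (fun y => xc p * xc y + yc p * yc y + zc p * zc y + (- dot x p)).
  by apply/funext => y; vec_ring.
have c k : continuous (fun y : 'rV[R]_3 => y 0 k : R) by exact: coord_continuous.
have ck a k : continuous (fun y : 'rV[R]_3 => a * y 0 k : R).
  by move=> y; exact: (cvgM (@cvg_cst _ a _ _ _) (c k y)).
have cD (f g : 'rV[R]_3 -> R) : continuous f -> continuous g ->
    continuous (fun y => f y + g y).
  by move=> cf cg y; exact: (cvgD (cf y) (cg y)).
apply: (cD _ (fun=> - dot x p)); last exact: cst_continuous.
exact: (cD _ _ (cD _ _ (ck _ _) (ck _ _)) (ck _ _)).
Qed.

Lemma open_halfspace x p : open [set y | 0 < dot (y - x) p].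
Proof.
rewrite (_ : [set _ | _] = (fun y => dot (y - x) p : R) @^-1` [set z | 0 < z]) //.
apply: open_comp; last exact: open_gt.
by move=> y _; exact: continuous_dot_sub.
Qed.

Lemma segment_component A p q : (forall s, 0 <= s <= 1 -> A (p + s *: (q - p))) ->
  connected_component A p q.
Proof.
move=> pA; pose f (s : R) := p + s *: (q - p).
have fc : continuous f.
  by move=> s; apply: cvgD; [exact: cvg_cst | apply: cvgZr_tmp].
have cI : connected (f @` `[0, 1]).
  apply: connected_continuous_connected; first exact: segment_connected.
  exact: continuous_subspaceT.
apply: (connected_component_max (B := f @` `[0, 1])) => //.
- by exists 0; rewrite ?/f /= ?in_itv /= ?lexx ?ler01 // scale0r addr0.
- by move=> _ [s /=] + <-; rewrite in_itv /=; exact: pA.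
- by exists 1; rewrite ?/f /= ?in_itv /= ?lexx ?ler01 // scale1r addrC subrK.
Qed.

(** A connected component cannot leave W for W', as W is open and closed in A. *)
Lemma component_in_open A (W W' : set 'rV[R]_3) p : open W -> open W' ->
  W `&` W' = set0 -> A `<=` W `|` W' -> W p ->
  connected_component A p `<=` W.
Proof.
move=> oW oW' WW' AW Wp y Cy.
have [Ap|nAp] := pselect (A p); last by rewrite connected_component_out in Cy.
set C := connected_component A p in Cy *.
have CE : C `&` W = C.
  apply: (component_connected (A := A) (x := p)).
  - by exists p; split => //; exact: connected_component_refl.
  - by exists W.
  - exists (~` W'); first exact: open_closedC.
    apply/seteqP; split => z [Cz h]; split => //.
      by move=> W'z; have : (W `&` W') z by []; rewrite WW'.
    by have [] := AW z (connected_component_sub Cz).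
by have [] : (C `&` W) y by rewrite CE.
Qed.

Lemma angle_exists (c s : R) : c ^+ 2 + s ^+ 2 = 1 ->
  exists a, [/\ 0 <= a < 2 * pi, cos a = c & sin a = s].
Proof.
move=> cs; have pi0 : 0 < pi :> R := pi_gt0 R.
have c1 : -1 <= c <= 1.
  have : c ^+ 2 <= 1 by rewrite -cs lerDl sqr_ge0.
  by clear; move=> c2; apply/andP; split; nra.
have ac := acosK c1; have a0 := acos_ge0 c1; have api := acos_lepi c1.
have sE : Num.sqrt (1 - c ^+ 2) = `|s| by rewrite -cs addrC addKr sqrtr_sqr.
have [s0|s0] := leP 0 s.
  exists (acos c); split => //; last by rewrite sin_acos // sE ger0_norm.
  by rewrite a0 /=; lra.
exists (2 * pi - acos c).
have cE : cos (2 * pi - acos c) = c.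
  by rewrite addrC -[2 * pi]/(2%:R * pi) mulr_natl cosD2pi cosN.
have s'E : sin (2 * pi - acos c) = s.
  by rewrite addrC mulr_natl sinD2pi sinN sin_acos // sE ltr0_norm // opprK.
have acn : acos c != 0.
  apply: contraTneq s0 => ac0.
  by rewrite -s'E ac0 subr0 mulr_natl sin2pi ltxx.
have ac0 : 0 < acos c by rewrite lt0r acn.
split => //; clear -ac0 api pi0.
by move: (acos c) ac0 api => x ac0 api; apply/andP; split; lra.
Qed.
End Topology.

(** * The body cut off by two half-planes *)

Section Hinge.
Variable R : realType.
Implicit Types (u v w p q y z : 'rV[R]_3) (A B : set 'rV[R]_3).

Lemma eball_segment (x p q : 'rV[R]_3) (r s : R) : 0 < r -> 0 <= s <= 1 ->
  eball x r p -> eball x r q -> eball x r (p + s *: (q - p)).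
Proof.
move=> r0 /andP[s0 s1]; rewrite eballE //= => pr qr.
have -> : dot (p + s *: (q - p) - x) (p + s *: (q - p) - x) =
   (1 - s) * dot (p - x) (p - x) + s * dot (q - x) (q - x)
   - s * (1 - s) * dot (q - p) (q - p) by vec_ring.
have h : 0 <= dot (q - p) (q - p) by rewrite /dot !addr_ge0 // -expr2 sqr_ge0.
have s1' : 0 <= 1 - s by rewrite subr_ge0.
have {}h := mulr_ge0 (mulr_ge0 s0 s1') h.
move: (dot (q - p) _) (dot (p - x) _) (dot (q - x) _) h pr qr => a b c h pr qr.
have [bc|/ltW bc] := leP b c.
  have k : 0 <= (1 - s) * (c - b) by rewrite mulr_ge0 ?subr_ge0.
  by apply: le_lt_trans qr; rewrite -subr_ge0; move: h k; clear; lra.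
have k : 0 <= s * (b - c) by rewrite mulr_ge0 ?subr_ge0.
by apply: le_lt_trans pr; rewrite -subr_ge0; move: h k; clear; lra.
Qed.

Lemma dot_segment x p q n (s : R) : 0 <= s <= 1 ->
  0 < dot (p - x) n -> 0 < dot (q - x) n -> 0 < dot (p + s *: (q - p) - x) n.
Proof.
move=> /andP[s0 s1] pn qn.
have -> : dot (p + s *: (q - p) - x) n =
  (1 - s) * dot (p - x) n + s * dot (q - x) n by vec_ring.
by move: (dot _ _) (dot _ _) pn qn => b c; nra.
Qed.

(** In the plane orthogonal to the edge, (f1, g1) are the coordinates of a point in
    the frame of the first face and (f2, g2) in that of the second one.  A point
    with f1 = 0 or f2 = 0 off the faces lies on the far half of a face plane,
    where the other function decides on which side of the wedge it is. *)
Lemma wedge_dichotomy (c s f1 f2 g1 g2 : R) :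
    c * c + s * s = 1 -> c < 1 ->
    f2 = s * g1 - c * f1 -> f1 = s * g2 - c * f2 -> g2 = s * f1 + c * g1 ->
    ~ (f1 = 0 /\ 0 <= g1) -> ~ (f2 = 0 /\ 0 <= g2) ->
  if 0 < s then (0 < f1 /\ 0 < f2) \/ (f1 < 0 \/ f2 < 0)
  else (0 < f1 \/ 0 < f2) \/ (f1 < 0 /\ f2 < 0).
Proof.
move=> cs c1 f2E f1E g2E nS1 nS2.
have g10 : f1 = 0 -> g1 < 0 by move=> h; rewrite ltNge; apply/negP => h'; apply: nS1.
have g20 : f2 = 0 -> g2 < 0 by move=> h; rewrite ltNge; apply/negP => h'; apply: nS2.
have [s0|s0] := ltP 0 s.
  have [h1|h1|h1] := ltgtP f1 0; first by right; left.
    have [h2|h2|h2] := ltgtP f2 0; [by right; right | by left; split |].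
    exfalso; move: h1; rewrite f1E h2 mulr0 subr0; apply/negP; rewrite -leNgt.
    by rewrite mulr_ge0_le0 ?ltW ?g20.
  right; right; rewrite f2E h1 mulr0 subr0.
  by rewrite pmulr_rlt0 ?g10.
have [h1|h1|h1] := ltgtP f1 0; last 1 first.
- have g1n := g10 h1; have sn : s < 0.
    rewrite lt_neqAle s0 andbT; apply/eqP => s00.
    have c1' : c = -1 by move: cs c1; rewrite s00; clear => h h'; nra.
    have f20 : f2 = 0 by rewrite f2E s00 h1; ring.
    have := g20 f20; rewrite g2E s00 c1' mul0r add0r mulN1r oppr_lt0 => h.
    by move: (lt_trans h g1n); rewrite ltxx.
  by left; right; rewrite f2E h1 mulr0 subr0 nmulr_rgt0.
- have [h2|h2|h2] := ltgtP f2 0; [by right; split | by left; right |].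
  exfalso; have := g20 h2; move: h1; rewrite f1E h2 mulr0 subr0 ltNge => /negP h h'; apply: h.
  by rewrite mulr_le0 // ltW.
- by left; left.
Qed.

Variables (x : 'rV[R]_3) (r : R) (e n1 n2 : 'rV[R]_3) (a : R).
Hypotheses (r0 : 0 < r) (ee : dot e e = 1) (nn1 : dot n1 n1 = 1)
  (nn2 : dot n2 n2 = 1) (en1 : dot e n1 = 0) (en2 : dot e n2 = 0).
Hypotheses (cosa : cos a = - dot n1 n2) (sina : sin a = - dot e (cross n1 n2)).

Let d1 := cross n1 e.

Let ball := eball x r.

Lemma frame_orthonormal : [/\ dot d1 d1 = 1, dot n1 d1 = 0 & dot d1 e = 0].
Proof.
split; [|rewrite /d1; vec_ring|rewrite /d1; vec_ring].
transitivity (dot n1 n1 * dot e e - dot e n1 ^+ 2); first by rewrite /d1; vec_ring.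
by rewrite nn1 ee en1 expr0n subr0 mulr1.
Qed.

(** In the orthonormal frame (n1, n1 x e) of the plane orthogonal to the edge, the
    second normal is determined by its angle with n1. *)
Lemma normal_in_frame : n2 = sin a *: d1 - cos a *: n1.
Proof.
have [dd nd de] := frame_orthonormal.
apply: (@basis_ext R n1 e); rewrite -/d1 ?dd ?oner_eq0 //.
- transitivity (sin a * dot n1 d1 - cos a * dot n1 n1); last by vec_ring.
  by rewrite nd nn1 cosa; vec_ring.
- transitivity (sin a * dot d1 e - cos a * dot e n1); last by vec_ring.
  rewrite de en1 !mulr0 subr0 -en2; vec_ring.
- transitivity (sin a * dot d1 d1 - cos a * dot n1 d1); last by vec_ring.
  by rewrite dd nd sina /d1; vec_ring.
Qed.

Let cs : cos a * cos a + sin a * sin a = 1.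
Proof. by rewrite -!expr2 cos2Dsin2. Qed.

Let d2E : cross e n2 = sin a *: n1 + cos a *: d1.
Proof.
rewrite normal_in_frame.
transitivity (sin a *: (dot e e *: n1 - dot e n1 *: e) + cos a *: d1).
  by rewrite /d1; vec_eq.
by rewrite ee en1 scale1r scale0r subr0.
Qed.

Let f1 y := dot (y - x) n1.
Let g1 y := dot (y - x) d1.
Let f2 y := dot (y - x) n2.
Let g2 y := dot (y - x) (cross e n2).

Let f2E y : f2 y = sin a * g1 y - cos a * f1 y.
Proof. rewrite /f2 /g1 /f1 normal_in_frame; vec_ring. Qed.

Let g2E y : g2 y = sin a * f1 y + cos a * g1 y.
Proof. rewrite /g2 /g1 /f1 d2E; vec_ring. Qed.

Let f1E y : f1 y = sin a * g2 y - cos a * f2 y.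
Proof.
rewrite g2E f2E.
transitivity ((cos a * cos a + sin a * sin a) * f1 y); last by ring.
by rewrite cs mul1r.
Qed.

(** The side of the two faces towards which both normals point: convex, an
    intersection of half-spaces, if the angle is less than pi; a union of
    half-spaces otherwise. *)
Definition open_wedge : set 'rV[R]_3 := [set y |
  if 0 < sin a then 0 < f1 y /\ 0 < f2 y else 0 < f1 y \/ 0 < f2 y].

Variables (S1 S2 : set 'rV[R]_3).
Hypothesis S1E : forall y, ball y -> (S1 y <-> f1 y = 0 /\ 0 <= g1 y).
Hypothesis S2E : forall y, ball y -> (S2 y <-> f2 y = 0 /\ 0 <= g2 y).
Hypothesis nu0 : n1 + n2 != 0.

Let one_plus : 0 < 1 + dot n1 n2.
Proof.
have : 0 < dot (n1 + n2) (n1 + n2).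
  rewrite lt0r; apply/andP; split; last by rewrite /dot !addr_ge0 // -expr2 sqr_ge0.
  apply: contra nu0 => /eqP h; apply/eqP; move: h; move: (n1 + n2) => u.
  rewrite /dot -!expr2 => h.
  have [hx hy hz] : [/\ xc u ^+ 2 = 0, yc u ^+ 2 = 0 & zc u ^+ 2 = 0].
    have := (sqr_ge0 (xc u), sqr_ge0 (yc u), sqr_ge0 (zc u)).
    by move: (_ ^+ 2) (_ ^+ 2) (_ ^+ 2) h => A B C h [[A0 B0] C0]; split; lra.
  by apply: row3P; rewrite !coordE; split; apply/eqP; rewrite -sqrf_eq0 ?hx ?hy ?hz.
have -> : dot (n1 + n2) (n1 + n2) = dot n1 n1 + dot n2 n2 + 2 * dot n1 n2 by vec_ring.
by rewrite nn1 nn2; move: (dot n1 n2) => t; lra.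
Qed.

Let base (ep : R) := x + (ep / 2) *: (n1 + n2).

Let base_f ep : 0 < ep -> 0 < f1 (base ep) /\ 0 < f2 (base ep).
Proof.
move=> ep0; have h := one_plus; rewrite /f1 /f2 /base; split.
  have -> : dot (x + (ep / 2) *: (n1 + n2) - x) n1 = ep / 2 * (dot n1 n1 + dot n1 n2).
    by vec_ring.
  by rewrite nn1 mulr_gt0 // divr_gt0.
have -> : dot (x + (ep / 2) *: (n1 + n2) - x) n2 = ep / 2 * (dot n2 n2 + dot n1 n2).
  by vec_ring.
by rewrite nn2 mulr_gt0 // divr_gt0.
Qed.

Let base_wedge ep : 0 < ep -> open_wedge (base ep).
Proof.
by move=> /base_f[h1 h2]; rewrite /open_wedge /=; case: ifP => _; [split | left].
Qed.

Let dot12 : dot n1 n2 <= 1.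
Proof. by rewrite -lerN2 -cosa cos_geN1. Qed.

Let base_ball ep : 0 < ep < r -> ball (base ep).
Proof.
move=> /andP[ep0 epr]; rewrite /ball eballE //= /base.
have -> : dot (x + (ep / 2) *: (n1 + n2) - x) (x + (ep / 2) *: (n1 + n2) - x) =
   (ep ^+ 2 / 4) * (dot n1 n1 + dot n2 n2 + 2 * dot n1 n2).
  have -> : ep ^+ 2 / 4 = (ep / 2) * (ep / 2) by field.
  by vec_ring.
rewrite nn1 nn2; have h := dot12; have h' := one_plus.
by move: (dot n1 n2) h h' => t; nra.
Qed.

Let not_faces y : ball y -> open_wedge y -> ~ (S1 `|` S2) y.
Proof.
move=> by_ Wy [/(S1E by_)[h1 h2]|/(S2E by_)[h1 h2]]; move: Wy; rewrite /open_wedge /=.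
  rewrite f2E h1 mulr0 subr0 ltxx; case: ifP => [_ []//|/negbT]; rewrite -leNgt => s0.
  by case=> // h; move: (mulr_le0_ge0 s0 h2); rewrite leNgt h.
rewrite f1E h1 mulr0 subr0 ltxx; case: ifP => [_ []//|/negbT]; rewrite -leNgt => s0.
by case=> // h; move: (mulr_le0_ge0 s0 h2); rewrite leNgt h.
Qed.

Let wedge_star ep y s : 0 < ep -> 0 <= s <= 1 -> open_wedge y ->
  open_wedge (base ep + s *: (y - base ep)).
Proof.
move=> ep0 s01; have [b1 b2] := base_f ep0; rewrite /open_wedge /= /f1 /f2.
case: ifP => _; first by move=> [h1 h2]; split; exact: dot_segment.
by move=> [h|h]; [left|right]; exact: dot_segment.
Qed.

Definition opposite_wedge : set 'rV[R]_3 := [set y |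
  if 0 < sin a then f1 y < 0 \/ f2 y < 0 else f1 y < 0 /\ f2 y < 0].

Let open_f1 : open [set y | 0 < f1 y]. Proof. exact: open_halfspace. Qed.
Let open_f2 : open [set y | 0 < f2 y]. Proof. exact: open_halfspace. Qed.
Let open_neg n : open [set y | dot (y - x) n < 0].
Proof.
have := @open_halfspace R x (- n); congr open; apply/seteqP; split => y /=;
  by rewrite (_ : dot (y - x) (- n) = - dot (y - x) n) ?oppr_gt0 //; vec_ring.
Qed.

Let open_nf1 : open [set y | f1 y < 0]. Proof. exact: open_neg. Qed.
Let open_nf2 : open [set y | f2 y < 0]. Proof. exact: open_neg. Qed.

Let component_wedge ep : 0 < ep ->
  connected_component (ball `\` (S1 `|` S2)) (base ep) `<=` open_wedge.
Proof.
move=> ep0; apply: (component_in_open (W' := opposite_wedge)).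
- rewrite /open_wedge; case: (0 < sin a); first exact: (openI open_f1 open_f2).
  exact: (openU open_f1 open_f2).
- rewrite /opposite_wedge; case: (0 < sin a).
    exact: (openU open_nf1 open_nf2).
  exact: (openI open_nf1 open_nf2).
- apply/seteqP; split => // y; rewrite /open_wedge /opposite_wedge /=.
  move: (f1 y) (f2 y) => A B; case: ifP => _ /=.
    by move=> [[h1 h2] [h|h]]; [move: (lt_trans h h1)|move: (lt_trans h h2)]; rewrite ltxx.
  by move=> [[h|h] [h1 h2]]; [move: (lt_trans h1 h)|move: (lt_trans h2 h)]; rewrite ltxx.
- move=> y [by_ /not_orP[nS1 nS2]].
  have {}nS1 : ~ (f1 y = 0 /\ 0 <= g1 y) by move/(S1E by_).
  have {}nS2 : ~ (f2 y = 0 /\ 0 <= g2 y) by move/(S2E by_).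
  have c1 : cos a < 1.
    by rewrite cosa -subr_gt0 opprK one_plus.
  have := wedge_dichotomy cs c1 (f2E y) (f1E y) (g2E y) nS1 nS2.
  by rewrite /open_wedge /opposite_wedge /setU /=; case: (0 < sin a).
- exact: base_wedge.
Qed.

(** The wedge is star-shaped about the base points, so every point of it is
    reached by a segment that avoids the faces.  Conversely, the ball without the
    faces is covered by the wedge and the disjoint open opposite wedge, so a
    component cannot pass from one to the other. *)
Lemma body_wedge : [set y | exists2 ep, 0 < ep < r &
    connected_component (ball `\` (S1 `|` S2)) (base ep) y] = ball `&` open_wedge.
Proof.
apply/seteqP; split => [y [ep /andP[ep0 epr] Cy]|y [by_ Wy]].
  split; last exact: component_wedge Cy.
  by have [] := connected_component_sub Cy.
have r2 : 0 < r / 2 < r.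
  by rewrite divr_gt0 //= ltr_pdivrMr // ltr_pMr // ltr1n.
have r20 : 0 < r / 2 by case/andP: r2.
(* Any base point in the ball will do. *)
exists (r / 2) => //; apply: segment_component => s s01.
have bs : ball (base (r / 2) + s *: (y - base (r / 2))).
  by apply: eball_segment => //; exact: base_ball.
by split => //; apply: not_faces => //; exact: wedge_star.
Qed.
End Hinge.

(** * The volume of the body *)

Section WedgeVolume.
Variable R : realType.
Let reflex (h a : R) : a < 2 * h -> h < a -> 0 < 2 * h - a < h.
Proof. by move=> h1 h2; apply/andP; split; lra. Qed.
Let halve (h : R) : 0 < h -> 0 < h / 2 < h.
Proof. by move=> h0; apply/andP; split; lra. Qed.
Implicit Types (p q y : 'rV[R]_3) (A B : set 'rV[R]_3).

Lemma eball_translation (x : 'rV[R]_3) (r : R) :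
  eball x r = (fun y => y - x) @^-1` eball 0 r.
Proof. by apply/funext => y; rewrite /eball /= subr0. Qed.

Lemma volume_ball_fin (x : 'rV[R]_3) (r : R) : 0 < r ->
  (volume (eball x r) < +oo)%E.
Proof.
move=> r0; rewrite eball_translation.
rewrite (volume_translation x (measurable_eball 0 r0)).2.
exact: volume_eball_fin.
Qed.

Lemma measurable_plane (x p : 'rV[R]_3) :
  measurable3 [set y | dot (y - x) p = 0].
Proof.
have -> : [set y | dot (y - x) p = 0] =
    [set y | dot (y - x) p <= 0] `&` [set y | dot (y - x) (- p) <= 0].
  have dN y : dot (y - x) (- p) = - dot (y - x) p by vec_ring.
  apply/seteqP; split => y /=; rewrite dN; first by move=> ->; rewrite oppr0 lexx.
  by move=> [h1 h2]; apply/eqP; rewrite eq_le h1 -oppr_le0 h2.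
by apply: measurable3I; apply: measurable3_le; exact: measurable_dot_sub.
Qed.

Lemma volume_hyperplane (x p q : 'rV[R]_3) : dot p p = 1 -> dot q q = 1 ->
  dot p q = 0 -> volume [set y | dot (y - x) p = 0] = 0%E.
Proof.
move=> pp qq pq; have [Q [rQ Qp Qq]] := align pp qq pq; have [dQ [_ vQ]] := rQ.
have mx : measurable3 [set v : 'rV[R]_3 | xc v = 0].
  have := measurable_plane 0 (vec3 1 0 0); congr measurable3.
  apply/funext => v /=; rewrite subr0; congr (_ = _).
  by rewrite /dot !vec3E; ring.
have [mQ vQ0] := vQ _ mx.
rewrite -(volume_plane R) -vQ0 -(volume_translation x mQ).2.
congr volume; apply/funext => y /=; congr (_ = _).
rewrite -dQ Qp /dot !vec3E; ring.
Qed.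

Lemma volume_mod_null A B (N : set 'rV[R]_3) :
  measurable3 A -> measurable3 B -> measurable3 N -> volume N = 0%E ->
  B `<=` A -> (forall y, A y -> ~ B y -> N y) -> volume A = volume B.
Proof.
move=> mA mB mN N0 BA ABN.
have mD : measurable3 (A `\` B) := measurable3I mA (measurable3C mB).
have D0 : volume (A `\` B) = 0%E.
  apply/eqP; rewrite eq_le volume_ge0 andbT -N0.
  by apply: volume_le => // y [Ay nBy]; exact: ABN.
have AE : A = B `|` (A `\` B).
  by apply/seteqP; split => [y Ay|y [/BA|[]]//]; have [By|nBy] := pselect (B y); [left|right].
rewrite {1}AE volumeU // ?D0 ?adde0 //.
by apply: disjoint => y By [_].
Qed.

Lemma fine_volumeU (x : 'rV[R]_3) (r : R) A B : 0 < r ->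
  measurable3 A -> measurable3 B -> A `|` B `<=` eball x r ->
  (forall y, A y -> B y -> False) ->
  fine (volume (A `|` B)) = fine (volume A) + fine (volume B).
Proof.
move=> r0 mA mB sub dis; rewrite volumeU //; last exact: disjoint.
have fin C : measurable3 C -> C `<=` eball x r -> volume C \is a fin_num.
  move=> mC sC; rewrite ge0_fin_numE ?volume_ge0 //.
  apply: le_lt_trans (volume_ball_fin x r0).
  by apply: volume_le => //; exact: measurable_eball.
by rewrite fineD //; apply: fin => // y h; apply: sub; [left|right].
Qed.

Variables (x : 'rV[R]_3) (r : R) (e n1 n2 : 'rV[R]_3) (a : R).
Hypotheses (r0 : 0 < r) (ee : dot e e = 1) (nn1 : dot n1 n1 = 1)
  (nn2 : dot n2 n2 = 1) (en1 : dot e n1 = 0) (en2 : dot e n2 = 0).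
Hypotheses (cosa : cos a = - dot n1 n2) (sina : sin a = - dot e (cross n1 n2)).
Hypothesis a_bounds : 0 < a < 2 * pi.

Let V := fine (volume (eball x r)).
Let d1 := cross n1 e.

Let mgt p : measurable3 [set y | 0 < dot (y - x) p].
Proof. by apply: measurable3_gt; exact: measurable_dot_sub. Qed.
Let mle p : measurable3 [set y | dot (y - x) p <= 0].
Proof. by apply: measurable3_le; exact: measurable_dot_sub. Qed.
Let mball : measurable3 (eball x r). Proof. exact: measurable_eball. Qed.

Let sector p q := [set y | [/\ eball x r y, 0 < dot (y - x) p & dot (y - x) q <= 0]].

Let msector p q : measurable3 (sector p q).
Proof.
have -> : sector p q = eball x r `&` [set y | 0 < dot (y - x) p] `&`
    [set y | dot (y - x) q <= 0].
  by apply/seteqP; split => y; [move=> []|move=> [[]]].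
exact: (measurable3I (measurable3I mball (mgt p)) (mle q)).
Qed.

Let n2E : n2 = sin a *: d1 - cos a *: n1.
Proof. exact: (normal_in_frame ee nn1 en1 en2 cosa sina). Qed.

Let frame : [/\ dot d1 d1 = 1, dot n1 d1 = 0 & dot d1 e = 0].
Proof. exact: (frame_orthonormal ee nn1 en1). Qed.

Let null p : dot p p = 1 -> dot e p = 0 -> volume [set y | dot (y - x) p = 0] = 0%E.
Proof.
move=> pp ep; apply: (@volume_hyperplane x p e) => //.
by rewrite -ep; vec_ring.
Qed.

Let dotN y p : dot y (- p) = - dot y p. Proof. vec_ring. Qed.
Let negd : dot (- d1) (- d1) = 1 /\ dot n1 (- d1) = 0 /\ dot (- n1) (- d1) = 0 /\ dot (- n1) (- n1) = 1.
Proof.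
have [dd nd de] := frame; split; first by rewrite -dd; vec_ring.
split; first by rewrite dotN nd oppr0.
by split; [rewrite -nd; vec_ring | rewrite -nn1; vec_ring].
Qed.

(** For a < pi, up to a plane the body is a wedge of angle a.  For a > pi it is the
    complement of a wedge of angle 2 pi - a, and for a = pi a half-ball, that is
    two wedges of angle pi / 2. *)
Lemma volume_open_wedge : fine (volume (eball x r `&` open_wedge x n1 n2 a)) =
  a / (2 * pi) * V.
Proof.
have [dd nd de] := frame; have [ddN [ndN [nNdN nnN]]] := negd.
have /andP[a0 a2] := a_bounds; have pi0 : 0 < pi :> R := pi_gt0 R.
rewrite /open_wedge.
have [api|api|api] := ltgtP a pi.
- have sa : 0 < sin a by apply: sin_gt0_pi; rewrite a0.
  rewrite sa.
  have n2N : cos a *: n1 + sin a *: - d1 = - n2 by rewrite n2E; vec_eq.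
  have := volume_wedge x r0 nn1 ddN ndN (b := a); rewrite a0 api n2N => <- //.
  congr (fine _); apply/esym.
  apply: (volume_mod_null (msector n1 (- n2)) _ (measurable_plane x n2)).
  + exact: (measurable3I mball (measurable3I (mgt n1) (mgt n2))).
  + exact: null.
  + by move=> y [by_ [h1 h2]]; split => //; rewrite dotN oppr_le0 ltW.
  + move=> y [by_ h1]; rewrite dotN oppr_le0 => h2 nW /=.
    apply/eqP; rewrite eq_le h2 andbT leNgt; apply/negP => h; apply: nW.
    by split.
- have sa : sin a < 0.
    have := sin_gt0_pi (x := a - pi); rewrite subr_gt0 api => h.
    rewrite -(subrK pi a) sinDpi oppr_lt0 h // ltrBlDr.
    by rewrite -mulr2n -mulr_natl.
  rewrite ltNge (ltW sa) /=.
  set W := _ `&` _; pose Z := [set y | [/\ eball x r y, dot (y - x) n1 <= 0 & dot (y - x) n2 <= 0]].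
  have b0 : 0 < 2 * pi - a < pi.
    exact: reflex.
  have cb : cos (2 * pi - a) = cos a by rewrite addrC mulr_natl cosD2pi cosN.
  have sb : sin (2 * pi - a) = - sin a by rewrite addrC mulr_natl sinD2pi sinN.
  have n2N : cos (2 * pi - a) *: - n1 + sin (2 * pi - a) *: - d1 = n2.
    by rewrite cb sb n2E; vec_eq.
  have := volume_wedge x r0 nnN ddN nNdN b0; rewrite n2N -/V => vZ.
  have mZ : measurable3 Z.
    have -> : Z = eball x r `&` ([set y | dot (y - x) n1 <= 0] `&` [set y | dot (y - x) n2 <= 0]).
      by apply/seteqP; split => y; [move=> []|move=> [? []]].
    exact: (measurable3I mball (measurable3I (mle n1) (mle n2))).
  have mW : measurable3 W := measurable3I mball (measurable3U (mgt n1) (mgt n2)).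
  have vZE : volume Z = volume (sector (- n1) n2).
    apply: (volume_mod_null mZ (msector _ _) (measurable_plane x n1)).
    + exact: null.
    + by move=> y [by_ h1 h2]; split => //; rewrite -oppr_ge0 -dotN ltW.
    + move=> y [by_ h1 h2] nS /=; apply/eqP; rewrite eq_le h1 leNgt.
      by apply/negP => h; apply: nS; split; rewrite // dotN oppr_gt0.
  have : V = fine (volume W) + fine (volume Z).
    rewrite -(@fine_volumeU x r W Z r0 mW mZ).
    + congr (fine (volume _)); apply/seteqP; split => y; last by move=> [[]|[]].
      move=> by_; have [h1|h1] := leP (dot (y - x) n1) 0; last by left; split => //; left.
      by have [h2|h2] := leP (dot (y - x) n2) 0; [right | left; split => //; right].
    + by move=> y [[]|[]].
    + by move=> y [_ [h|h]] [_ h1 h2]; [move: h1|move: h2]; rewrite leNgt h.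
  rewrite vZE vZ => VE.
  apply: (addIr ((2 * pi - a) / (2 * pi) * V)); rewrite -VE.
  have pn : (pi : R) != 0 by rewrite gt_eqF.
  by move: pn; move: (pi : R) V => h V' hn; field.
- have sa : sin a = 0 by rewrite api sinpi.
  have n21 : n2 = n1 by rewrite n2E sa api cospi; vec_eq.
  rewrite sa ltxx n21.
  have pi2 : 0 < (pi : R) / 2 < pi.
    exact: halve.
  have := volume_wedge x r0 nn1 dd nd pi2; have := volume_wedge x r0 nn1 ddN ndN pi2.
  rewrite cos_pihalf sin_pihalf !scale0r !scale1r !add0r => v1 v2.
  set W := _ `&` _; pose B := [set y | [/\ eball x r y, 0 < dot (y - x) n1 & 0 < dot (y - x) d1]].
  have mB : measurable3 B.
    have -> : B = eball x r `&` ([set y | 0 < dot (y - x) n1] `&` [set y | 0 < dot (y - x) d1]).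
      by apply/seteqP; split => y; [move=> []|move=> [? []]].
    exact: (measurable3I mball (measurable3I (mgt n1) (mgt d1))).
  have vB : volume (sector n1 (- d1)) = volume B.
    apply: (volume_mod_null (msector _ _) mB (measurable_plane x d1)).
    + by apply: null => //; rewrite -de; vec_ring.
    + by move=> y [by_ h1 h2]; split => //; rewrite dotN oppr_le0 ltW.
    + move=> y [by_ h1]; rewrite dotN oppr_le0 => h2 nB /=; apply/eqP.
      by rewrite eq_le h2 andbT leNgt; apply/negP => h; apply: nB; split.
  have -> : W = sector n1 d1 `|` B.
    apply/seteqP; split => y; last by move=> [[]|[]]; split => //; left.
    by move=> [by_ [h|h]]; (have [k|k] := leP (dot (y - x) d1) 0; [left|right]).
  rewrite (@fine_volumeU x r _ _ r0 (msector _ _) mB).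
  + have -> : fine (volume (sector n1 d1)) = pi / 2 / (2 * pi) * V by exact: v2.
    have -> : fine (volume B) = pi / 2 / (2 * pi) * V by rewrite -vB; exact: v1.
    rewrite api.
    have pn : (pi : R) != 0 by rewrite gt_eqF.
    by move: pn; move: (pi : R) V => h V' hn; field.
  + by move=> y [[]|[]].
  + by move=> y [_ _ h] [_ _ h']; move: h; rewrite leNgt h'.
Qed.
End WedgeVolume.

(** * Hulls and their images under a polyhedron *)

Section Hulls.
Variable R : realType.

Definition triangle k (U V W : 'rV[R]_k) : set 'rV[R]_k :=
  [set y | exists al be ga, [/\ 0 <= al, 0 <= be, 0 <= ga, al + be + ga = 1 &
     y = al *: U + be *: V + ga *: W]].

Definition segment k (U V : 'rV[R]_k) : set 'rV[R]_k :=
  [set y | exists2 s, 0 <= s <= 1 & y = U + s *: (V - U)].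

Lemma big_fset3 (T : choiceType) (Z : nmodType) (a b c : T) (F : T -> Z) :
  a != b -> b != c -> c != a ->
  \sum_(v <- [fset a; b; c]%fset) F v = F a + F b + F c.
Proof.
move=> ab bc ca; rewrite fsetUC big_fsetU1 /=; last first.
  by rewrite !inE negb_or ca eq_sym bc.
rewrite big_fsetU1 /=; last by rewrite !inE.
by rewrite big_seq_fset1 addrC.
Qed.

Lemma hull3 k (a b c : 'rV[R]_k) : a != b -> b != c -> c != a ->
  hull [fset a; b; c]%fset = triangle a b c.
Proof.
move=> ab bc ca; apply/seteqP; split => y.
  move=> [w [w0 w1 yE]]; exists (w a), (w b), (w c).
  move: w1 yE; rewrite !big_fset3 // => w1 ->.
  by split=> //; apply: w0; rewrite !inE eqxx ?orbT.
move=> [al [be [ga [h1 h2 h3 h4 ->]]]].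
exists (fun v => if v == a then al else if v == b then be else ga).
rewrite !big_fset3 // !eqxx [b == a]eq_sym (negPf ab) (negPf ca) [c == b]eq_sym (negPf bc).
by split=> // v _; case: ifP => // _; case: ifP.
Qed.

Lemma hull2 k (a b : 'rV[R]_k) : a != b -> hull [fset a; b]%fset = segment a b.
Proof.
move=> ab; have nb : a \notin [fset b]%fset by rewrite inE.
have E (Z : nmodType) (F : 'rV[R]_k -> Z) : \sum_(v <- [fset a; b]%fset) F v = F a + F b.
  by rewrite big_fsetU1 //= big_seq_fset1.
apply/seteqP; split => y.
  move=> [w [w0 + +]]; rewrite !E => w1 ->; exists (w b).
    by rewrite w0 ?inE ?eqxx ?orbT //= -w1 lerDr w0 // !inE eqxx.
  have -> : w a = 1 - w b by rewrite -w1 addrK.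
  by rewrite scalerBl scale1r scalerBr addrAC addrA.
move=> [s /andP[s0 s1] ->]; exists (fun v => if v == b then s else 1 - s).
rewrite !E eqxx (negPf ab); split.
- by move=> v _; case: ifP => // _; rewrite subr_ge0.
- by rewrite subrK.
- by rewrite scalerBl scale1r scalerBr addrAC addrA.
Qed.

Lemma hull_vertex k (s : {fset 'rV[R]_k}) v : v \in s -> hull s v.
Proof.
move=> vs; exists (fun x => (x == v)%:R); split.
- by move=> x _; rewrite ler0n.
- rewrite (bigD1_seq v) ?fset_uniq //= eqxx big1 ?addr0 // => x /negPf ->.
  by [].
- rewrite (bigD1_seq v) ?fset_uniq //= eqxx scale1r big1 ?addr0 // => x /negPf ->.
  by rewrite scale0r.
Qed.

Lemma hull_convex k (s : {fset 'rV[R]_k}) x y (l : R) : 0 <= l <= 1 ->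
  hull s x -> hull s y -> hull s (l *: x + (1 - l) *: y).
Proof.
move=> /andP[l0 l1] [w [w0 w1 ->]] [w' [w'0 w'1 ->]].
exists (fun v => l * w v + (1 - l) * w' v); split.
- by move=> v vs; rewrite addr_ge0 // mulr_ge0 ?w0 ?w'0 ?subr_ge0.
- by rewrite big_split /= -!mulr_sumr w1 w'1 !mulr1 addrC subrK.
- rewrite !scaler_sumr -big_split /=; apply: eq_bigr => v _.
  by rewrite [RHS]scalerDl !scalerA.
Qed.

Section Polyhedron.
Variables (n : nat) (K : {fset {fset 'rV[R]_n}}) (P : 'rV[R]_n -> 'rV[R]_3).
Hypothesis Pp : polyhedron K P.

Lemma polyhedron_segment u v : u != v -> [fset u; v]%fset \in K ->
  P @` hull [fset u; v]%fset = segment (P u) (P v).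
Proof.
move=> uv sK.
have Pe (s : R) : 0 <= s <= 1 -> P (u + s *: (v - u)) = P u + s *: (P v - P u).
  move=> s01; have -> : u + s *: (v - u) = s *: v + (1 - s) *: u.
    by rewrite scalerBl scale1r scalerBr addrCA addrA.
  rewrite (Pp sK) //; try by apply: hull_vertex; rewrite !inE eqxx ?orbT.
  by rewrite scalerBl scale1r scalerBr addrCA addrA.
rewrite hull2 //; apply/seteqP; split => y.
  by move=> [_ [s s01 ->] <-]; exists s => //; exact: Pe.
by move=> [s s01 ->]; exists (u + s *: (v - u)); [exists s | exact: Pe].
Qed.

(** Affinity on segments gives affinity on triangles, by grouping two of the three
    weights. *)
Lemma polyhedron_comb3 s a b c (al be ga : R) : s \in K ->
  a \in s -> b \in s -> c \in s ->
  0 <= al -> 0 <= be -> 0 <= ga -> al + be + ga = 1 ->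
  P (al *: a + be *: b + ga *: c) = al *: P a + be *: P b + ga *: P c.
Proof.
move=> sK /hull_vertex ha /hull_vertex hb /hull_vertex hc al0 be0 ga0 s1.
have [be1|be1] := eqVneq (al + be) 0.
  have [al00 be00] : al = 0 /\ be = 0 by split; lra.
  have ga1 : ga = 1 by lra.
  by rewrite al00 be00 ga1 !scale0r !scale1r !add0r.
set m := al + be in be1 *; have m0 : 0 < m by rewrite lt0r be1 addr_ge0.
have m1 : m <= 1 by rewrite -s1 lerDl.
have l01 : 0 <= al / m <= 1.
  by rewrite (divr_ge0 al0 (ltW m0)) /= ler_pdivrMr // mul1r lerDl.
have hy := hull_convex l01 ha hb.
have e1 : m * (al / m) = al by rewrite mulrC divfK.
have e2 : m * (1 - al / m) = be by rewrite mulrBr mulr1 e1 /m addrC addKr.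
have e3 : 1 - m = ga by rewrite -s1 addrC addKr.
have m01 : 0 <= m <= 1 by rewrite (ltW m0).
have := Pp sK hy hc m01; rewrite (Pp sK ha hb l01) e3 !scalerDr !scalerA e1 e2.
by [].
Qed.

Lemma polyhedron_triangle a b c : a != b -> b != c -> c != a ->
  [fset a; b; c]%fset \in K ->
  P @` hull [fset a; b; c]%fset = triangle (P a) (P b) (P c).
Proof.
move=> ab bc ca sK; rewrite hull3 //.
have Pe al be ga : 0 <= al -> 0 <= be -> 0 <= ga -> al + be + ga = 1 ->
    P (al *: a + be *: b + ga *: c) = al *: P a + be *: P b + ga *: P c.
  by move=> *; apply: (polyhedron_comb3 sK) => //; rewrite !inE eqxx ?orbT.
apply/seteqP; split => y.
  by move=> [_ [al [be [ga [h1 h2 h3 h4 ->]]]] <-]; rewrite Pe //; exists al, be, ga.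
move=> [al [be [ga [h1 h2 h3 h4 ->]]]]; exists (al *: a + be *: b + ga *: c).
  by exists al, be, ga.
exact: Pe.
Qed.
End Polyhedron.
End Hulls.

(** * The principal value of a dihedral angle *)

Section TriangleNearEdge.
Variable R : realType.

(** The segment from a point where both functions are positive to one where one of
    them is negative hits the boundary of the quadrant; A and B are the values at
    the end of the segment. *)
Lemma exit_point (A0 B0 A B : R) : 0 < A0 -> 0 < B0 -> A < 0 \/ B < 0 ->
  exists s, [/\ 0 <= s <= 1, 0 <= A0 + s * (A - A0), 0 <= B0 + s * (B - B0) &
    A0 + s * (A - A0) = 0 \/ B0 + s * (B - B0) = 0].
Proof.
move=> a0 b0.
have zero (c0 c : R) : 0 < c0 -> c < 0 -> let s := c0 / (c0 - c) in
    0 < s < 1 /\ c0 + s * (c - c0) = 0.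
  move=> c00 c1; have d : 0 < c0 - c by lra.
  have dn : c0 - c != 0 by rewrite gt_eqF.
  split; last by field.
  by rewrite divr_gt0 //= ltr_pdivrMr // mul1r; lra.
have zeroB : B < 0 -> (0 <= A \/ 0 <= A0 + B0 / (B0 - B) * (A - A0)) ->
    exists s, [/\ 0 <= s <= 1, 0 <= A0 + s * (A - A0), 0 <= B0 + s * (B - B0) &
      A0 + s * (A - A0) = 0 \/ B0 + s * (B - B0) = 0].
  move=> bn h; have [/andP[s0 s1] sz] := zero _ _ b0 bn.
  exists (B0 / (B0 - B)); move: (B0 / (B0 - B)) s0 s1 sz h => s s0 s1 sz h.
  split; [by rewrite !ltW | | by rewrite sz | by right].
  case: h => // A_ge; have : 0 <= (1 - s) * A0 + s * A.
    by rewrite addr_ge0 // mulr_ge0 // ?subr_ge0 ltW.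
  by congr (0 <= _); ring.
move=> h; have [A_ge|An] := leP 0 A.
  by case: h => [|bn]; [rewrite ltNge A_ge | apply: zeroB => //; left].
have [/andP[s0 s1] sz] := zero _ _ a0 An.
have [Bs|Bs] := leP 0 (B0 + A0 / (A0 - A) * (B - B0)).
  exists (A0 / (A0 - A)); split; [by rewrite !ltW | by rewrite sz | exact: Bs | by left].
set s := A0 / (A0 - A) in s0 s1 sz Bs.
have bn : B < 0.
  rewrite ltNge; apply/negP => bp; move: Bs; rewrite ltNge => /negP; apply.
  have : 0 <= (1 - s) * B0 + s * B.
    by rewrite addr_ge0 // mulr_ge0 // ?subr_ge0 ltW.
  by congr (0 <= _); ring.
apply: zeroB => //; right.
have [/andP[t0 t1] tz] := zero _ _ b0 bn.
set t := B0 / (B0 - B) in t0 t1 tz *.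
have ts : t <= s.
  rewrite leNgt; apply/negP => st; move: Bs; rewrite ltNge => /negP; apply.
  have : 0 <= (t - s) * (B0 - B) by rewrite mulr_ge0 // subr_ge0 ltW // (lt_trans bn).
  by move: tz; clear => tz; nra.
have : 0 <= (s - t) * (A0 - A) by rewrite mulr_ge0 // subr_ge0 // ltW // (lt_trans An).
by move: sz; clear => sz; nra.
Qed.

Implicit Types (U V W x y : 'rV[R]_3).

(** Around a point x inside the edge UV, in a ball that avoids the other two edges,
    the triangle is a half-disc: a point of the half-plane outside the triangle
    has a negative barycentric coordinate at U or V, and the segment from x to it
    would cross the edge VW or UW inside the ball. *)
Lemma triangle_near_edge U V W x (r : R) :
    let N := cross (V - U) (W - U) in
    0 < dot N N -> 0 < r -> (exists2 tau, 0 < tau < 1 & x = U + tau *: (V - U)) ->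
    (forall y, eball x r y -> segment U W y -> False) ->
    (forall y, eball x r y -> segment V W y -> False) ->
  forall y, eball x r y ->
    (triangle U V W y <-> dot (y - x) N = 0 /\ 0 <= dot (y - x) (cross N (V - U))).
Proof.
move=> N N0 r0 [tau /andP[tau0 tau1] xE] noUW noVW y yb.
have Nn : dot N N != 0 by rewrite gt_eqF.
pose E := V - U; pose D := W - U.
split.
  move=> [al [be [ga [al0 be0 ga0 s1 yE]]]].
  have zE : y - x = (be - tau) *: E + ga *: D.
    have alE : al = 1 - be - ga by rewrite -s1; ring.
    by rewrite yE xE alE /E /D; vec_eq.
  rewrite zE; split; first by rewrite /N -/E -/D; vec_ring.
  have -> : dot ((be - tau) *: E + ga *: D) (cross N E) = ga * dot N N.
    by rewrite /N -/E -/D; vec_ring.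
  by rewrite mulr_ge0 // ltW.
move=> [zN zd]; set z := y - x in zN zd.
(* The barycentric coordinates of y, by Cramer for the Gram matrix of E, D. *)
pose ga := (dot z D * dot E E - dot z E * dot E D) / dot N N.
pose b := (dot z E * dot D D - dot z D * dot E D) / dot N N.
have gaE : ga = dot z (cross N E) / dot N N.
  by congr (_ / _); rewrite /N -/E -/D; vec_ring.
have ga0 : 0 <= ga by rewrite gaE divr_ge0 // ltW.
have zE : z = b *: E + ga *: D.
  apply: (scalerI Nn).
  have -> : dot N N *: z = dot z N *: N
     + (dot z E * dot D D - dot z D * dot E D) *: E
     + (dot z D * dot E E - dot z E * dot E D) *: D.
    by rewrite /N -/E -/D; clear; vec_eq.
  rewrite zN scale0r add0r [in RHS]scalerDr !scalerA /b /ga.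
  by rewrite ![dot N N * _]mulrC !divfK.
pose be := tau + b; pose al := 1 - be - ga.
have yE : y = al *: U + be *: V + ga *: W.
  have -> : y = x + z by rewrite /z addrC subrK.
  by rewrite zE xE /al /be /E /D; vec_eq.
have s1 : al + be + ga = 1 by rewrite /al; ring.
have no_exit : al < 0 \/ be < 0 -> False.
  have tau1' : 0 < 1 - tau by rewrite subr_gt0.
  move=> /(exit_point tau1' tau0)[s [s01]].
  have /andP[s0 _] := s01; set A := 1 - tau + _; set B := tau + _ => A0 B0 AB.
  have sg0 : 0 <= s * ga by rewrite mulr_ge0.
  have sum1 : A + B + s * ga = 1 by rewrite /A /B /al; ring.
  have xb : eball x r x.
    by rewrite eballE //= subrr (_ : dot 0 0 = 0) ?exprn_gt0 //; vec_ring.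
  have ysb := eball_segment r0 s01 xb yb.
  have ysE : x + s *: (y - x) = A *: U + B *: V + (s * ga) *: W.
    by rewrite yE xE /A /B /al; vec_eq.
  rewrite ysE in ysb; case: AB => h.
    apply: (noVW _ ysb); exists (s * ga).
      by rewrite sg0 /= -sum1 h add0r lerDr.
    have -> : B = 1 - s * ga by rewrite -sum1 h add0r addrK.
    by rewrite h; vec_eq.
  apply: (noUW _ ysb); exists (s * ga).
    by rewrite sg0 /= -sum1 h addr0 lerDr.
  have -> : A = 1 - s * ga by rewrite -sum1 h addr0 addrK.
  by rewrite h; vec_eq.
exists al, be, ga; split => //; rewrite leNgt; apply/negP => h; apply: no_exit.
  by left.
by right.
Qed.
End TriangleNearEdge.

Section PrincipalValue.
Variables (R : realType) (n : nat) (K : {fset {fset 'rV[R]_n}}).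
Variable o : {fset 'rV[R]_n} -> 'rV[R]_n * 'rV[R]_n * 'rV[R]_n.
Hypotheses (Kc : strongly_connected_complex K) (Ko : orientation K o).
Variable P : 'rV[R]_n -> 'rV[R]_3.
Hypothesis Pp : polyhedron K P.

Definition face_normal t : 'rV[R]_3 :=
  let: (a, b, c) := o t in cross (P b - P a) (P c - P a).

Hypothesis Pn : forall t, t \in simplices K 2 -> 0 < dot (face_normal t) (face_normal t).

Definition unit_edge u v : 'rV[R]_3 :=
  (enorm (P v - P u))^-1 *: (P v - P u).

Lemma normal_face t : normal o P t =
  (Num.sqrt (dot (face_normal t) (face_normal t)))^-1 *: face_normal t.
Proof. by rewrite /normal /face_normal; case: (o t) => [[a b] c]; rewrite /enorm dotpE. Qed.

Lemma boundary_third t u v : t \in simplices K 2 -> (u, v) \in boundary o t ->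
  exists w, [/\ t = [fset u; v; w]%fset, u != v, v != w, w != u &
    face_normal t = cross (P v - P u) (P w - P u)].
Proof.
move=> tK; rewrite /boundary /face_normal; case: (faceP Ko tK) => a b c tE ab bc ca.
rewrite !inE => /or3P[] /eqP[-> ->].
- by exists c; rewrite tE.
- exists a; split => //; first by rewrite tE -fsetUA fsetUC.
  by vec_eq.
- exists b; split => //; first by rewrite tE fsetUC fsetUA.
  by vec_eq.
Qed.

Lemma unit_normalized (w : 'rV[R]_3) : 0 < dot w w ->
  dot ((Num.sqrt (dot w w))^-1 *: w) ((Num.sqrt (dot w w))^-1 *: w) = 1.
Proof.
move=> w0; have s0 : Num.sqrt (dot w w) != 0 by rewrite gt_eqF // sqrtr_gt0.
have -> : dot ((Num.sqrt (dot w w))^-1 *: w) ((Num.sqrt (dot w w))^-1 *: w) =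
  (Num.sqrt (dot w w))^-1 ^+ 2 * dot w w by vec_ring.
by rewrite -[X in _ * X](sqr_sqrtr (ltW w0)) -exprMn mulVf // expr1n.
Qed.

Lemma edge_positive t u v : t \in simplices K 2 -> (u, v) \in boundary o t ->
  0 < dot (P v - P u) (P v - P u).
Proof.
move=> tK uv; have [w [_ _ _ _ NE]] := boundary_third tK uv.
have := Pn tK; rewrite NE; set E := P v - P u; set D := P w - P u => N0.
rewrite lt0r; apply/andP; split; last by rewrite /dot !addr_ge0 // -expr2 sqr_ge0.
apply: contraTneq N0 => E0.
have -> : dot (cross E D) (cross E D) = dot E E * dot D D - dot E D ^+ 2 by vec_ring.
by rewrite E0 mul0r sub0r oppr_gt0 ltNge sqr_ge0.
Qed.

Lemma face_near_edge s t u v x r : t \in simplices K 2 -> (u, v) \in boundary o t ->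
    s = [fset u; v]%fset -> (P @` hull s) x ->
    (forall v', [fset v']%fset \in K -> x <> P v') -> 0 < r ->
    (forall e, e \in simplices K 1 -> e != s -> (e `<=` t)%fset ->
       eball x r `&` (P @` hull e) = set0) ->
  forall y, eball x r y -> ((P @` hull t) y <->
    dot (y - x) (normal o P t) = 0 /\
    0 <= dot (y - x) (cross (normal o P t) (unit_edge u v))).
Proof.
move=> tK uvt sE xs xv r0 avoid y yb.
have [w [tE uv vw wu NE]] := boundary_third tK uvt.
have /simplicesP[tK' _] := tK.
have edge a b : a != b -> (forall c, c \in [fset a; b]%fset -> c \in t) ->
    [fset a; b]%fset \in simplices K 1.
  move=> ab sub; apply/simplicesP; rewrite cardfs2 ab; split => //.
  apply: (scc_face Kc tK'); first exact/fsubsetP.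
  by apply/fset0Pn; exists a; rewrite !inE eqxx.
have tri : P @` hull t = triangle (P u) (P v) (P w).
  by rewrite tE; apply: (polyhedron_triangle Pp) => //; rewrite -tE.
have inK a b : a != b -> (forall c, c \in [fset a; b]%fset -> c \in t) ->
    [fset a; b]%fset \in K by move=> ab /(edge _ _ ab)/simplicesP[].
have sub1 : forall c, c \in [fset u; v]%fset -> c \in t.
  by move=> c; rewrite tE !inE => /orP[] ->; rewrite ?orbT.
have sub2 : forall c, c \in [fset u; w]%fset -> c \in t.
  by move=> c; rewrite tE !inE => /orP[] ->; rewrite ?orbT.
have sub3 : forall c, c \in [fset v; w]%fset -> c \in t.
  by move=> c; rewrite tE !inE => /orP[] ->; rewrite ?orbT.
have uw : u != w by rewrite eq_sym.
have vert a : a \in t -> [fset a]%fset \in K.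
  move=> at_; apply: (scc_face Kc tK'); first by rewrite fsub1set.
  by apply/fset0Pn; exists a; rewrite inE.
have [tau /andP[tau0 tau1] xE] : segment (P u) (P v) x.
  by rewrite -(polyhedron_segment Pp uv (inK _ _ uv sub1)) -sE.
have tau01 : exists2 tau, 0 < tau < 1 & x = P u + tau *: (P v - P u).
  exists tau => //; apply/andP; split.
    rewrite lt_neqAle tau0 andbT; apply/eqP => t0.
    apply: (xv u); first by apply: vert; apply: sub1; rewrite !inE eqxx.
    by rewrite xE -t0 scale0r addr0.
  rewrite lt_neqAle tau1 andbT; apply/eqP => t0.
  apply: (xv v); first by apply: vert; apply: sub1; rewrite !inE eqxx orbT.
  by rewrite xE t0 scale1r addrC subrK.
have noseg a b : a != b -> (forall c, c \in [fset a; b]%fset -> c \in t) ->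
    [fset a; b]%fset != s -> forall y, eball x r y -> segment (P a) (P b) y -> False.
  move=> ab sub ns z zb zs; have := avoid _ (edge _ _ ab sub) ns.
  have -> : ([fset a; b] `<=` t)%fset by exact/fsubsetP.
  rewrite (polyhedron_segment Pp ab (inK _ _ ab sub)) => /(_ isT) h.
  by have : (eball x r `&` segment (P a) (P b)) z by []; rewrite h.
have ns2 : [fset u; w]%fset != s.
  rewrite sE; apply/eqP => /fsetP/(_ v); rewrite !inE eqxx orbT eq_sym (negPf uv).
  by rewrite (negPf vw).
have ns3 : [fset v; w]%fset != s.
  rewrite sE; apply/eqP => /fsetP/(_ u); rewrite !inE eqxx (negPf uv).
  by rewrite (negPf uw).
have N0 := Pn tK; rewrite NE in N0.
rewrite tri (triangle_near_edge N0 r0 tau01 (noseg _ _ uw sub2 ns2) (noseg _ _ vw sub3 ns3) yb).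
rewrite normal_face NE /unit_edge /enorm dotpE.
set N := cross _ _ in N0 *; set E := P v - P u.
have E0 : 0 < dot E E by exact: edge_positive tK uvt.
have nN : 0 < (Num.sqrt (dot N N))^-1 by rewrite invr_gt0 sqrtr_gt0.
have nE : 0 < (Num.sqrt (dot E E))^-1 by rewrite invr_gt0 sqrtr_gt0.
move: (Num.sqrt (dot N N))^-1 (Num.sqrt (dot E E))^-1 nN nE => i k i0 k0.
have -> : dot (y - x) (i *: N) = i * dot (y - x) N by vec_ring.
have -> : dot (y - x) (cross (i *: N) (k *: E)) = i * k * dot (y - x) (cross N E).
  by vec_ring.
rewrite pmulr_rge0 ?mulr_gt0 //; split => -[h1 h2]; split => //.
  by rewrite h1 mulr0.
by move/eqP: h1; rewrite mulf_eq0 gt_eqF //= => /eqP.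
Qed.

(** Let a be the angle in [0, 2 pi) with the given cosine and sine.  The faces are
    half-discs near x, hence the body is a wedge of angle a and its share of the
    ball is a / (2 pi).  If n1 + n2 = 0 the convention phi = 0 agrees with the
    formulas. *)
Lemma principal_value_oriented s phi t1 t2 u v :
    t1 \in simplices K 2 -> t2 \in simplices K 2 -> s = [fset u; v]%fset ->
    (u, v) \in boundary o t1 -> (v, u) \in boundary o t2 ->
    let nu := normal o P t1 + normal o P t2 in
    (if nu == 0 then phi = 0 else
      exists x r, admissible_ball K P s t1 t2 x r /\
      phi = 2 * pi * (fine (volume (positive_body P t1 t2 nu x r))
                      / fine (volume (eball x r)))) ->
  cos phi = - dot (normal o P t1) (normal o P t2) /\
  sin phi = - dot (unit_edge u v) (cross (normal o P t1) (normal o P t2)).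
Proof.
move=> t1K t2K sE uv1 vu2 nu.
have nn1 : dot (normal o P t1) (normal o P t1) = 1.
  by rewrite normal_face unit_normalized //; exact: Pn.
have nn2 : dot (normal o P t2) (normal o P t2) = 1.
  by rewrite normal_face unit_normalized //; exact: Pn.
have ee : dot (unit_edge u v) (unit_edge u v) = 1.
  by rewrite /unit_edge /enorm dotpE unit_normalized //; exact: edge_positive t1K uv1.
have orth t a b : t \in simplices K 2 -> (a, b) \in boundary o t ->
    dot (P b - P a) (normal o P t) = 0.
  move=> tK abt; have [w [_ _ _ _ NE]] := boundary_third tK abt.
  by rewrite normal_face NE; vec_ring.
have en1 : dot (unit_edge u v) (normal o P t1) = 0.
  have -> : dot (unit_edge u v) (normal o P t1) =
    (enorm (P v - P u))^-1 * dot (P v - P u) (normal o P t1) by rewrite /unit_edge; vec_ring.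
  by rewrite orth // mulr0.
have en2 : dot (unit_edge u v) (normal o P t2) = 0.
  have -> : dot (unit_edge u v) (normal o P t2) =
    - (enorm (P v - P u))^-1 * dot (P u - P v) (normal o P t2) by rewrite /unit_edge; vec_ring.
  by rewrite orth // mulr0.
have [nu0 ->|nu0 [x [r [[xs xv r0 avoid] ->]]]] := eqVneq nu 0.
  have n2E : normal o P t2 = - normal o P t1.
    by apply/eqP; rewrite -addr_eq0 addrC; apply/eqP.
  rewrite cos0 sin0 n2E; split; last by vec_ring.
  by rewrite -nn1; vec_ring.
have xv' w : [fset w]%fset \in K -> x <> P w by exact: xv.
set e := unit_edge u v in ee en1 en2 *.
set n1 := normal o P t1 in nu nn1 en1 nu0 *; set n2 := normal o P t2 in nu nn2 en2 nu0 *.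
have cs : (- dot n1 n2) ^+ 2 + (- dot e (cross n1 n2)) ^+ 2 = 1.
  transitivity (dot n1 n1 * dot n2 n2 * dot e e
    + (1 - dot e e) * dot n1 n2 ^+ 2
    - dot n1 n1 * dot e n2 ^+ 2 - dot n2 n2 * dot e n1 ^+ 2
    + 2 * dot n1 n2 * dot e n1 * dot e n2); first by vec_ring.
  by rewrite nn1 nn2 ee en1 en2; ring.
have [a [a_b cosa sina]] := angle_exists cs.
have S1 y (yb : eball x r y) := face_near_edge t1K uv1 sE xs xv' r0
  (fun f fK fs ft => avoid f fK fs (introT orP (or_introl ft))) yb.
have sE' : s = [fset v; u]%fset by rewrite sE fsetUC.
have S2 y : eball x r y -> ((P @` hull t2) y <->
    dot (y - x) n2 = 0 /\ 0 <= dot (y - x) (cross e n2)).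
  move=> yb; have := face_near_edge t2K vu2 sE' xs xv' r0
    (fun f fK fs ft => avoid f fK fs (introT orP (or_intror ft))) yb.
  have -> // : cross (normal o P t2) (unit_edge v u) = cross e n2.
  rewrite /e /n2 /unit_edge.
  have -> : enorm (P u - P v) = enorm (P v - P u).
    by rewrite /enorm !dotpE; congr Num.sqrt; vec_ring.
  by vec_eq.
have a0 : 0 < a.
  have /andP[a0 _] := a_b; rewrite lt_neqAle a0 andbT; apply: contra nu0 => /eqP a00.
  have n12 : dot n1 n2 = -1 by move: cosa; rewrite -a00 cos0 => ->; rewrite opprK.
  have : dot nu nu = 0.
    transitivity (dot n1 n1 + dot n2 n2 + 2 * dot n1 n2); first by rewrite /nu; vec_ring.
    by rewrite nn1 nn2 n12; ring.
  rewrite /dot -!expr2 => /eqP; rewrite paddr_eq0 ?addr_ge0 ?sqr_ge0 //.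
  rewrite paddr_eq0 ?sqr_ge0 // !sqrf_eq0 => /andP[/andP[/eqP hx /eqP hy] /eqP hz].
  by apply/eqP; apply: row3P; rewrite hx hy hz xc0 yc0 zc0.
have body := body_wedge r0 ee nn1 nn2 en1 en2 cosa sina S1 S2 nu0.
have vol := volume_open_wedge x r0 ee nn1 nn2 en1 en2 cosa sina (introT andP (conj a0 (andP a_b).2)).
have -> : 2 * pi * (fine (volume (positive_body P t1 t2 nu x r)) /
    fine (volume (eball x r))) = a.
  have -> : positive_body P t1 t2 nu x r = eball x r `&` open_wedge x n1 n2 a.
    by rewrite -body.
  rewrite vol; have V0 := fine_volume_eball_gt0 x r0; have p0 := pi_gt0 R.
  move: (fine _) V0 p0; move: (pi : R) => h V V0 h0.
  by field; rewrite !gt_eqF.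
by rewrite cosa sina.
Qed.

(** The formulas do not change when the two faces are exchanged, since this also
    reverses the direction of the edge. *)
Lemma principal_value_angle s phi t1 t2 u v :
    t1 \in simplices K 2 -> t2 \in simplices K 2 -> s = [fset u; v]%fset -> u != v ->
    (u, v) \in boundary o t1 -> (v, u) \in boundary o t2 ->
    (forall t, t \in simplices K 2 -> (s `<=` t)%fset -> t = t1 \/ t = t2) ->
    is_principal_value K o P s phi ->
  cos phi = - dot (normal o P t1) (normal o P t2) /\
  sin phi = - dot (unit_edge u v) (cross (normal o P t1) (normal o P t2)).
Proof.
move=> t1K t2K sE uv uv1 vu2 only [t1' [t2' [t1'K t2'K tt]]].
have s1 : (s `<=` t1')%fset by rewrite -tt fsubsetIl.
have s2 : (s `<=` t2')%fset by rewrite -tt fsubsetIr.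
have neq : t1' != t2'.
  apply/eqP => e; move: tt; rewrite e fsetIid => t2s.
  have /simplicesP[_] := t2'K; rewrite t2s sE cardfs2; by case: (u != v).
have := only _ t1'K s1; have := only _ t2'K s2.
move=> [e2|e2] [e1|e1]; rewrite e1 e2 ?eqxx // in neq *; last first.
  exact: principal_value_oriented.
move=> h; have := principal_value_oriented t2K t1K _ vu2 uv1 h.
rewrite sE fsetUC => /(_ erefl)[-> ->]; split; first by vec_ring.
rewrite /unit_edge (_ : enorm (P u - P v) = enorm (P v - P u)); first by vec_ring.
by rewrite /enorm !dotpE; congr Num.sqrt; vec_ring.
Qed.
End PrincipalValue.

(** * Congruent triangles *)

Section Congruence.
Variable R : realType.
Implicit Types U V W x y z : 'rV[R]_3.

Lemma dot_ge0 x : 0 <= dot x x.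
Proof. by rewrite /dot !addr_ge0 // -expr2 sqr_ge0. Qed.

Lemma dot_eq0 x : (dot x x == 0) = (x == 0).
Proof.
apply/idP/eqP => [|->]; last by apply/eqP; vec_ring.
rewrite /dot -!expr2 paddr_eq0 ?addr_ge0 ?sqr_ge0 // paddr_eq0 ?sqr_ge0 //.
rewrite !sqrf_eq0 => /andP[/andP[/eqP hx /eqP hy] /eqP hz].
by apply: row3P; rewrite hx hy hz xc0 yc0 zc0.
Qed.

Lemma enormE x : enorm x = Num.sqrt (dot x x).
Proof. by rewrite /enorm dotpE. Qed.

Lemma enorm_sqr x : enorm x ^+ 2 = dot x x.
Proof. by rewrite enormE sqr_sqrtr ?dot_ge0. Qed.

Lemma triangle_rot U V W : triangle U V W = triangle V W U.
Proof.
apply/seteqP; split=> y [al [be [ga [al0 be0 ga0 s1 ->]]]].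
  by exists be, ga, al; split => //; [rewrite -s1; ring|vec_eq].
by exists ga, al, be; split => //; [rewrite -s1; ring|vec_eq].
Qed.

(** Being the midpoint of two distinct points of T is preserved by isometries, and the points
    of a nondegenerate triangle that are not midpoints are its vertices. *)
Definition midpoint (T : set 'rV[R]_3) y :=
  exists x z, [/\ T x, T z, x != z & y *+ 2 = x + z].

Lemma midpoint_segment U V y : segment U V y -> y != U -> y != V ->
  midpoint (segment U V) y.
Proof.
move=> [s /andP[s0 s1] yE] yU yV.
have s0' : 0 < s.
  by rewrite lt_neqAle s0 andbT; apply: contra yU => /eqP sE; rewrite yE -sE scale0r addr0.
have s1' : s < 1.
  rewrite lt_neqAle s1 andbT; apply: contra yV => /eqP sE.
  by rewrite yE sE scale1r addrC subrK.
have UV : U != V by apply: contra yU => /eqP UV; rewrite yE UV subrr scaler0 addr0.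
have [e [e0 es e1]] : exists e, [/\ 0 < e, e <= s & e <= 1 - s].
  exists (Num.min s (1 - s)); rewrite lt_min s0' subr_gt0 s1'.
  by rewrite !ge_min !lexx orbT.
(* Two points of the segment at the same distance on either side of y. *)
exists (U + (s - e) *: (V - U)), (U + (s + e) *: (V - U)); split.
- by exists (s - e) => //; apply/andP; split; lra.
- by exists (s + e) => //; apply/andP; split; lra.
- apply: contra UV => /eqP /addrI /eqP; rewrite -subr_eq0 -scalerBl scaler_eq0.
  by move=> /orP[/eqP h|]; [lra|rewrite subr_eq0 eq_sym].
- by rewrite yE mulr2n; vec_eq.
Qed.

Lemma sub_triangle U V W a b s : triangle U V W a -> triangle U V W b ->
  0 <= s <= 1 -> triangle U V W (a + s *: (b - a)).
Proof.
move=> [al [be [ga [al0 be0 ga0 s1 ->]]]] [al' [be' [ga' [al0' be0' ga0' s1' ->]]]].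
move=> /andP[s0 s1''].
exists ((1 - s) * al + s * al'), ((1 - s) * be + s * be'), ((1 - s) * ga + s * ga').
split; try by rewrite addr_ge0 // mulr_ge0 // subr_ge0.
  transitivity ((1 - s) * (al + be + ga) + s * (al' + be' + ga')); first by ring.
  by rewrite s1 s1'; ring.
by vec_eq.
Qed.

Lemma triangle_vertices U V W :
  [/\ triangle U V W U, triangle U V W V & triangle U V W W].
Proof.
split; [exists 1, 0, 0|exists 0, 1, 0|exists 0, 0, 1];
  by split; rewrite ?ler01 ?lexx //; [ring|vec_eq].
Qed.

Lemma midpoint_triangle U V W y : triangle U V W y ->
  y != U -> y != V -> y != W -> midpoint (triangle U V W) y.
Proof.
move=> yT yU yV yW; have [TU TV TW] := triangle_vertices U V W.
have sub a b : triangle U V W a -> triangle U V W b -> segment a b `<=` triangle U V W.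
  by move=> Ta Tb z [s s01 ->]; apply: sub_triangle.
have mid a b : triangle U V W a -> triangle U V W b -> segment a b y ->
    y != a -> y != b -> midpoint (triangle U V W) y.
  move=> Ta Tb yab ya yb; have [x [z [xs zs xz E]]] := midpoint_segment yab ya yb.
  by exists x, z; split => //; apply: (sub a b).
have [al [be [ga [al0 be0 ga0 s1 yE]]]] := yT.
have al1 : al < 1.
  rewrite ltNge; apply/negP => h; move/eqP: yU; apply.
  have -> : y = al *: U + be *: V + ga *: W by [].
  have b0 : be = 0 by lra.
  have g0 : ga = 0 by lra.
  have a1 : al = 1 by lra.
  by rewrite a1 b0 g0; vec_eq.
have d0 : 1 - al != 0 by rewrite subr_eq0 eq_sym lt_eqF.
pose s := ga / (1 - al); pose Q := V + s *: (W - V).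
have s01 : 0 <= s <= 1.
  rewrite /s divr_ge0 //= ?subr_ge0 ?(ltW al1) // ler_pdivrMr ?subr_gt0 //; lra.
have QT : triangle U V W Q by apply: sub_triangle.
have yQ : y = U + (1 - al) *: (Q - U).
  have gE : ga = (1 - al) * s by rewrite /s mulrC divfK.
  have bE : be = (1 - al) * (1 - s) by rewrite mulrBr mulr1 -gE -s1; ring.
  by rewrite yE bE gE /Q; vec_eq.
have [yQ'|yQ'] := eqVneq y Q.
  by apply: (mid V W) => //; rewrite yQ'; exists s.
apply: (mid U Q) => //; exists (1 - al) => //.
by rewrite subr_ge0 (ltW al1) /= lerBlDr lerDl.
Qed.

Lemma vertex_not_midpoint U V W :
  0 < dot (cross (V - U) (W - U)) (cross (V - U) (W - U)) ->
  ~ midpoint (triangle U V W) U.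
Proof.
set N := cross _ _ => N0 [x [z [[al [be [ga [al0 be0 ga0 s1 xE]]]]]]].
move=> [al' [be' [ga' [al0' be0' ga0' s1' zE]]]] xz UE.
have alE : al = 1 - be - ga by rewrite -s1; ring.
have alE' : al' = 1 - be' - ga' by rewrite -s1'; ring.
have E0 : (be + be') *: (V - U) + (ga + ga') *: (W - U) = 0.
  transitivity (x + z - U *+ 2); last by rewrite UE subrr.
  by rewrite xE zE alE alE' mulr2n; vec_eq.
have N0' : dot N N != 0 by rewrite gt_eqF.
have c0 (c : R) : c * dot N N = 0 -> c = 0.
  by move/eqP; rewrite mulf_eq0 (negPf N0') orbF => /eqP.
have b0 : be + be' = 0.
  apply: c0; transitivity (dot ((be + be') *: (V - U) + (ga + ga') *: (W - U))
    (cross (W - U) N)); first by rewrite /N; vec_ring.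
  by rewrite E0; vec_ring.
have g0 : ga + ga' = 0.
  apply: c0; transitivity (- dot ((be + be') *: (V - U) + (ga + ga') *: (W - U))
    (cross (V - U) N)); first by rewrite /N; vec_ring.
  by rewrite E0; vec_ring.
have [b b'] : be = 0 /\ be' = 0 by split; lra.
have [g g'] : ga = 0 /\ ga' = 0 by split; lra.
by move: xz; rewrite xE zE alE alE' b b' g g' eqxx.
Qed.

(** The midpoint x of a and b is the point with |x - a| = |x - b| = |a - b| / 2, by
    the parallelogram identity. *)
Lemma midpoint_isometry (f : 'rV[R]_3 -> 'rV[R]_3) (T : set 'rV[R]_3) x :
  (forall x y, enorm (f x - f y) = enorm (x - y)) ->
  midpoint (f @` T) (f x) -> midpoint T x.
Proof.
move=> iso [_ [_ [[a Ta <-] [b Tb <-] ab E]]].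
have dE p q : dot (f p - f q) (f p - f q) = dot (p - q) (p - q).
  by rewrite -!enorm_sqr iso.
exists a, b; split => //; first by apply: contra ab => /eqP ->.
apply/eqP; rewrite -subr_eq0 -dot_eq0; apply/eqP.
transitivity (2 * dot (x - a) (x - a) + 2 * dot (x - b) (x - b) - dot (a - b) (a - b)).
  by rewrite (mulr2n x); vec_ring.
rewrite -(dE x a) -(dE x b) -(dE a b); have -> : f x = (1/2) *: (f a + f b).
  by rewrite -E -(scaler_nat 2 (f x)) scalerA mul1r mulVf ?scale1r // pnatr_eq0.
by rewrite /dot !coordE; field.
Qed.

(** The triangle U'V'W' is not assumed nondegenerate, so only this direction is
    available: a point of it other than the three vertices is a midpoint, whereas
    f U is not. *)
Lemma vertex_image U V W U' V' W' (f : 'rV[R]_3 -> 'rV[R]_3) :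
  0 < dot (cross (V - U) (W - U)) (cross (V - U) (W - U)) ->
  (forall x y, enorm (f x - f y) = enorm (x - y)) ->
  f @` triangle U V W = triangle U' V' W' ->
  [\/ f U = U', f U = V' | f U = W'].
Proof.
move=> N0 iso fT.
have [?|?] := eqVneq (f U) U'; first exact: Or31.
have [?|?] := eqVneq (f U) V'; first exact: Or32.
have [?|?] := eqVneq (f U) W'; first exact: Or33.
have [TU _ _] := triangle_vertices U V W.
case: (@vertex_not_midpoint U V W) => //; apply: (midpoint_isometry iso).
by rewrite fT; apply: midpoint_triangle => //; rewrite -fT; exists U.
Qed.

Lemma congruent_side U V W U' V' W' :
  0 < dot (cross (V - U) (W - U)) (cross (V - U) (W - U)) ->
  congruent (triangle U V W) (triangle U' V' W') ->
  dot (U' - V') (U' - V') \in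
    [:: dot (U - V) (U - V); dot (V - W) (V - W); dot (W - U) (W - U)].
Proof.
move=> N0 [f iso fT].
have N1 : 0 < dot (cross (W - V) (U - V)) (cross (W - V) (U - V)).
  by have -> // : cross (W - V) (U - V) = cross (V - U) (W - U) by vec_eq.
have N2 : 0 < dot (cross (U - W) (V - W)) (cross (U - W) (V - W)).
  by have -> // : cross (U - W) (V - W) = cross (V - U) (W - U) by vec_eq.
have fU := vertex_image N0 iso fT.
have fV : [\/ f V = U', f V = V' | f V = W'].
  by apply: (vertex_image N1 iso); rewrite -triangle_rot.
have fW : [\/ f W = U', f W = V' | f W = W'].
  by apply: (vertex_image N2 iso); rewrite triangle_rot.
have neq x y : x != y -> f x <> f y.
  move=> /negP xy fxy; apply: xy; rewrite -subr_eq0 -dot_eq0 -enorm_sqr -iso fxy subrr.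
  by rewrite enorm_sqr; apply/eqP; vec_ring.
have UV : f U <> f V.
  by apply: neq; apply/eqP => e; move: N0; rewrite e -e; apply/negP; rewrite -leNgt e;
     rewrite (_ : dot _ _ = 0) //; vec_ring.
have VW : f V <> f W.
  by apply: neq; apply/eqP => e; move: N0; apply/negP; rewrite -leNgt e;
     rewrite (_ : dot _ _ = 0) //; vec_ring.
have WU : f W <> f U.
  by apply: neq; apply/eqP => e; move: N0; apply/negP; rewrite -leNgt e;
     rewrite (_ : dot _ _ = 0) //; vec_ring.
have dE p q : dot (p - q) (p - q) = dot (f p - f q) (f p - f q).
  by rewrite -!enorm_sqr iso.
have sym p q : dot (p - q) (p - q) = dot (q - p) (q - p) by vec_ring.
rewrite (dE U V) (dE V W) (dE W U) !inE.
case: fU fV fW => eU [] eV [] eW; rewrite ?eU ?eV ?eW in UV VW WU *;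
  by [case: UV|case: VW|case: WU|rewrite eqxx ?orbT|rewrite sym eqxx ?orbT].
Qed.

Lemma avoid_finite (xs : seq R) (a b : R) : a < b ->
  exists2 v, a < v < b & v \notin xs.
Proof.
elim: xs a b => [|x xs IH] a b ab; first by exists ((a + b) / 2) => //; apply/andP; split; lra.
have [v /andP[av vb] vx] := IH a b ab.
have [vE|vn] := eqVneq v x; last first.
  by exists v; rewrite ?av ?vb // inE negb_or vn.
have [v' /andP[av' v'b] vx'] := IH a v av.
exists v'; first by rewrite av' (lt_trans v'b).
by rewrite inE negb_or vx' -vE lt_eqF.
Qed.

(** The intermediate value theorem. *)
Lemma finite_valued_constant (g : R -> R) (xs : seq R) (t : R) :
  {within `[0, 1], continuous g} -> (forall s, 0 <= s <= 1 -> g s \in xs) ->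
  0 <= t <= 1 -> g t = g 0.
Proof.
move=> gc gx /andP[t0 t1]; apply: contrapT => /eqP neq.
have gc' : {within `[0, t], continuous g}.
  apply: continuous_subspaceW gc => s /=; rewrite !in_itv /= => /andP[-> st].
  exact: le_trans t1.
have lt : Num.min (g 0) (g t) < Num.max (g 0) (g t).
  have [h|h|h] := ltgtP (g 0) (g t); [by []|by []|].
  by rewrite h eqxx in neq.
have [v /andP[v0 v1] vx] := avoid_finite xs lt.
have [|c] := IVT t0 gc' (v := v); first by rewrite (ltW v0) (ltW v1).
rewrite in_itv /= => /andP[c0 ct] gv; move/negP: vx; apply; rewrite -gv; apply: gx.
by rewrite c0 (le_trans ct).
Qed.
End Congruence.

(** * Rigidity of the faces during a flex *)

Section FlexMetric.
Variables (R : realType) (n : nat) (K : {fset {fset 'rV[R]_n}}).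
Variable o : {fset 'rV[R]_n} -> 'rV[R]_n * 'rV[R]_n * 'rV[R]_n.
Hypothesis Ko : orientation K o.
Variables (P : 'rV[R]_n -> 'rV[R]_3) (Pt : R -> 'rV[R]_n -> 'rV[R]_3).

(** If the normal vanishes, the edge vectors p and q satisfy
    (q.q) p - (p.q) q = q x (p x q) = 0, an affine dependency between the vertices
    with weight q.q at P b. *)
Lemma nondegenerate_normal t : nondegenerate_faces K P -> t \in simplices K 2 ->
  0 < dot (face_normal o P t) (face_normal o P t).
Proof.
move=> Pnd tK; have [card indep] := Pnd _ tK.
move: card indep; rewrite /face_normal; case: (faceP Ko tK) => a b c tE ab bc ca.
set N := cross _ _.
have im : [fset P v | v in t]%fset = [fset P a; P b; P c]%fset.
  apply/fsetP => x; apply/imfsetP/idP => /=.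
    move=> [v]; rewrite tE !inE => /orP[/orP[]|] /eqP -> ->; rewrite eqxx ?orbT //.
  by rewrite !inE => /orP[/orP[]|] /eqP ->; [exists a|exists b|exists c];
    rewrite ?tE ?inE ?eqxx ?orbT.
rewrite im => card indep.
have neq (T : choiceType) (x y z : T) : #|` [fset x; y; z]%fset| = 3%N -> [/\ x != y, y != z & z != x].
  move=> xyz; split; apply: (contra_eq_neq _ xyz) => ->.
  - by rewrite fsetUid cardfs2; case: (y == z).
  - by rewrite -fsetUA fsetUid cardfs2; case: (x == z).
  - by rewrite fsetUC fsetUA fsetUid cardfs2; case: (x == y).
have [Pab Pbc Pca] := neq _ _ _ _ card.
rewrite lt0r dot_ge0 andbT dot_eq0; apply/eqP => N0.
pose p := P b - P a; pose q := P c - P a.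
(* The weights of the affine dependency q x (p x q) = 0. *)
pose w x := if x == P b then dot q q else if x == P c then - dot p q else dot p q - dot q q.
have wa : w (P a) = dot p q - dot q q by rewrite /w (negPf Pab) eq_sym (negPf Pca).
have wb : w (P b) = dot q q by rewrite /w eqxx.
have wc : w (P c) = - dot p q by rewrite /w eq_sym (negPf Pbc) eqxx.
have s0 : \sum_(v <- [fset P a; P b; P c]%fset) w v = 0.
  by rewrite big_fset3 // wa wb wc; ring.
have v0 : \sum_(v <- [fset P a; P b; P c]%fset) w v *: v = 0.
  rewrite big_fset3 // wa wb wc.
  transitivity (cross q N); first by rewrite /N -/p -/q /p /q; vec_eq.
  by rewrite N0; vec_eq.
have := indep w s0 v0 (P b); rewrite !inE eqxx orbT wb => /(_ isT) /eqP.
by rewrite dot_eq0 subr_eq0 (negPf Pca).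
Qed.

Hypothesis Pnd : nondegenerate_faces K P.
Hypothesis Pf : flex K P Pt.

Lemma vertex_support t v : t \in simplices K 2 -> v \in t -> support_of K v.
Proof. by move=> /simplicesP[tK _] vt; exists t => //; apply: hull_vertex. Qed.

Lemma continuous_distance x y : support_of K x -> support_of K y ->
  {within `[0, 1], continuous (fun s => dot (Pt s x - Pt s y) (Pt s x - Pt s y))}.
Proof.
move=> /(flex_continuous Pf) cx /(flex_continuous Pf) cy.
have coord z i : {within `[0, 1], continuous (Pt^~ z)} ->
    {within `[0, 1], continuous (fun s => Pt s z 0 i)}.
  move=> zc s; have c := @coord_continuous R 1 3 0 i (Pt s z).
  exact: (cvg_comp _ _ (zc s) c).
have cM (f g : R -> R) : {within `[0, 1], continuous f} ->
    {within `[0, 1], continuous g} -> {within `[0, 1], continuous (fun s => f s * g s)}.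
  by move=> fc gc s; apply: cvgM; [exact: fc|exact: gc].
have cD (f g : R -> R) : {within `[0, 1], continuous f} ->
    {within `[0, 1], continuous g} -> {within `[0, 1], continuous (fun s => f s + g s)}.
  by move=> fc gc s; apply: cvgD; [exact: fc|exact: gc].
have cB i : {within `[0, 1], continuous (fun s => Pt s x 0 i - Pt s y 0 i)}.
  by move=> s; apply: cvgB; [exact: (coord x i cx)|exact: (coord y i cy)].
have -> : (fun s => dot (Pt s x - Pt s y) (Pt s x - Pt s y)) = (fun s =>
   (Pt s x 0 (inord 0) - Pt s y 0 (inord 0)) * (Pt s x 0 (inord 0) - Pt s y 0 (inord 0)) +
   (Pt s x 0 (inord 1) - Pt s y 0 (inord 1)) * (Pt s x 0 (inord 1) - Pt s y 0 (inord 1)) +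
   (Pt s x 0 (inord 2) - Pt s y 0 (inord 2)) * (Pt s x 0 (inord 2) - Pt s y 0 (inord 2))).
  by apply/funext => s; rewrite /dot /xc /yc /zc !mxE.
exact: (cD _ _ (cD _ _ (cM _ _ (cB _) (cB _)) (cM _ _ (cB _) (cB _))) (cM _ _ (cB _) (cB _))).
Qed.

(** At any time the squared length of the side is one of the three squared lengths
    of the initial triangle, so by continuity it is constant. *)
Lemma flex_side t a b c s : t \in simplices K 2 -> t = [fset a; b; c]%fset ->
  a != b -> b != c -> c != a ->
  0 < dot (cross (P b - P a) (P c - P a)) (cross (P b - P a) (P c - P a)) ->
  0 <= s <= 1 ->
  dot (Pt s a - Pt s b) (Pt s a - Pt s b) = dot (P a - P b) (P a - P b).
Proof.
move=> tK tE ab bc ca N0 s01.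
have /simplicesP[tK' _] := tK.
have sup v : v \in t -> support_of K v by exact: vertex_support tK.
have ta : a \in t by rewrite tE !inE eqxx.
have tb : b \in t by rewrite tE !inE eqxx orbT.
have tc : c \in t by rewrite tE !inE eqxx orbT.
have st v : v \in t -> Pt 0 v = P v by move=> /sup; exact: flex_start.
rewrite -(st a) // -(st b) //.
have im r : 0 <= r <= 1 -> Pt r @` hull t = triangle (Pt r a) (Pt r b) (Pt r c).
  by move=> r01; rewrite tE; apply: (polyhedron_triangle (flex_polyhedron Pf r01)) => //;
     rewrite -tE.
pose xs := [:: dot (P a - P b) (P a - P b); dot (P b - P c) (P b - P c);
  dot (P c - P a) (P c - P a)].
pose g r := dot (Pt r a - Pt r b) (Pt r a - Pt r b).
apply: (@finite_valued_constant R g xs) => //.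
  exact: continuous_distance (sup _ ta) (sup _ tb).
move=> r /andP[]; rewrite le_eqVlt => /orP[/eqP <- _|r0 r1].
  by rewrite /g !st // /xs !inE eqxx.
have := flex_congruent Pf tK (introT andP (conj r0 r1)).
rewrite (im 0) ?lexx ?ler01 // (im r) ?(ltW r0) // !st //.
exact: congruent_side.
Qed.

Lemma flex_distance t a b s : t \in simplices K 2 -> a \in t -> b \in t ->
  0 <= s <= 1 ->
  dot (Pt s a - Pt s b) (Pt s a - Pt s b) = dot (P a - P b) (P a - P b).
Proof.
move=> tK at_ bt s01; move: at_ bt; have := nondegenerate_normal Pnd tK.
rewrite /face_normal; case: (faceP Ko tK) => A B C tE AB BC CA N0.
have tE1 : t = [fset B; C; A]%fset by rewrite tE -fsetUA fsetUC.
have tE2 : t = [fset C; A; B]%fset by rewrite tE fsetUC fsetUA.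
have N1 : 0 < dot (cross (P C - P B) (P A - P B)) (cross (P C - P B) (P A - P B)).
  by have -> // : cross (P C - P B) (P A - P B) = cross (P B - P A) (P C - P A) by vec_eq.
have N2 : 0 < dot (cross (P A - P C) (P B - P C)) (cross (P A - P C) (P B - P C)).
  by have -> // : cross (P A - P C) (P B - P C) = cross (P B - P A) (P C - P A) by vec_eq.
have h1 := flex_side tK tE AB BC CA N0 s01.
have h2 := flex_side tK tE1 BC CA AB N1 s01.
have h3 := flex_side tK tE2 CA AB BC N2 s01.
have sym (p q : 'rV[R]_3) : dot (p - q) (p - q) = dot (q - p) (q - p) by vec_ring.
have zero (p q : 'rV[R]_3) : dot (p - p) (p - p) = dot (q - q) (q - q) by vec_ring.
rewrite tE !inE => /orP[/orP[]|] /eqP -> /orP[/orP[]|] /eqP ->;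
  by [exact: h1|exact: h2|exact: h3|exact: zero|rewrite sym h1 sym|
      rewrite sym h2 sym|rewrite sym h3 sym].
Qed.

(** By polarization. *)
Lemma flex_inner t a b c s : t \in simplices K 2 ->
  a \in t -> b \in t -> c \in t -> 0 <= s <= 1 ->
  dot (Pt s b - Pt s a) (Pt s c - Pt s a) = dot (P b - P a) (P c - P a).
Proof.
move=> tK ta tb tc s01.
have pol (x y z : 'rV[R]_3) : dot (y - x) (z - x) =
    (dot (y - x) (y - x) + dot (z - x) (z - x) - dot (y - z) (y - z)) / 2.
  by rewrite /dot !coordE; field.
by rewrite pol !(flex_distance tK) // -pol.
Qed.
End FlexMetric.

(** * The Schlaefli relation *)

Section Schlafli.
Variables (R : realType) (n : nat) (K : {fset {fset 'rV[R]_n}}).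
Local Notation V := 'rV[R]_n.
Variable o : {fset V} -> V * V * V.
Hypotheses (Kc : strongly_connected_complex K) (Ko : orientation K o).
Variables (L : fieldType) (D : L -> L).
Hypotheses (derD : derivation D) (two_neq0 : 2%:R != 0 :> L).
Variable X : V -> 'rV[L]_3.

Definition generic_normal t : 'rV[L]_3 :=
  let: (a, b, c) := o t in cross (X b - X a) (X c - X a).

Variables (len nrm : {fset V} -> L) (i : L).
Hypotheses (ii : i * i = -1) (Di : D i = 0).
Hypothesis DX : forall t a b c, t \in simplices K 2 -> a \in t -> b \in t -> c \in t ->
  D (dot (X b - X a) (X c - X a)) = 0.
Hypothesis normal_neq0 : forall t, t \in simplices K 2 ->
  dot (generic_normal t) (generic_normal t) != 0.
Hypothesis Dnrm : forall t, t \in simplices K 2 -> D (nrm t) = 0.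
Hypothesis Dlen : forall s, s \in simplices K 1 -> D (len s) = 0.
Hypothesis lenE : forall u v, [fset u; v]%fset \in simplices K 1 -> u != v ->
  dot (X v - X u) (X v - X u) = len [fset u; v]%fset ^+ 2.
Hypothesis len_neq0 : forall s, s \in simplices K 1 -> len s != 0.

Definition generic_unit u v : 'rV[L]_3 := (len [fset u; v]%fset)^-1 *: (X v - X u).

(** The number exp(i phi) of the dihedral angle phi at the edge from u to v, where
    t1 induces the direction (u, v). *)
Definition rotor t1 t2 u v : L :=
  let n1 := (nrm t1)^-1 *: generic_normal t1 in
  let n2 := (nrm t2)^-1 *: generic_normal t2 in
  - dot n1 n2 - i * dot (generic_unit u v) (cross n1 n2).

Lemma derivationV x : D x = 0 -> D x^-1 = 0.
Proof.
move=> Dx; have [->|x0] := eqVneq x 0; first by rewrite invr0 derivation0.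
have := derivationM derD x x^-1; rewrite divff // derivation1 // Dx mul0r add0r.
by move/esym/eqP; rewrite mulf_eq0 (negPf x0) => /eqP.
Qed.

Lemma face_velocity t : t \in simplices K 2 -> exists w : 'rV[L]_3,
  forall a b, a \in t -> b \in t -> map_mx D (X b - X a) = cross w (X b - X a).
Proof.
move=> tK; have := normal_neq0 tK; have dx := DX tK; rewrite /generic_normal.
move: dx; case: (faceP Ko tK) => A B E tE _ _ _ dx N0.
have tA : A \in t by rewrite tE !inE eqxx.
have tB : B \in t by rewrite tE !inE eqxx orbT.
have tC : E \in t by rewrite tE !inE eqxx orbT.
have [w [wB wC]] := rigid_velocity derD two_neq0 (dx A B B tA tB tB) (dx A B E tA tB tC)
  (dx A E E tA tC tC) N0.
exists w.
have from_A a : a \in t -> map_mx D (X a - X A) = cross w (X a - X A).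
  rewrite tE !inE => /orP[/orP[]|] /eqP -> //.
  by rewrite derivation_sub // !subrr; vec_eq.
move=> a b ta tb; have -> : X b - X a = (X b - X A) - (X a - X A).
  by rewrite opprB addrA subrK.
by rewrite derivation_sub // !from_A //; vec_eq.
Qed.

(** rho s is the rate of change of the dihedral angle at s, up to sign, and equals
    (w1 - w2).e for the angular velocities of the adjacent faces.  Multiplied by
    the length of s it becomes w1.(X v - X u) + w2.(X u - X v), so that the sum
    over all edges can be rearranged as a sum over faces t of w_t dotted with the
    sum of the boundary vectors of t, which is 0. *)
Lemma schlafli_formula : exists rho : {fset V} -> L,
  (forall s t1 t2 u v, s \in simplices K 1 ->
    t1 \in simplices K 2 -> t2 \in simplices K 2 -> t1 != t2 ->
    s = [fset u; v]%fset -> u != v ->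
    (u, v) \in boundary o t1 -> (v, u) \in boundary o t2 ->
    (forall t, t \in simplices K 2 -> (s `<=` t)%fset -> t = t1 \/ t = t2) ->
    D (rotor t1 t2 u v) = - i * rho s * rotor t1 t2 u v) /\
  \sum_(s <- simplices K 1) len s * rho s = 0.
Proof.
have [w wP] : exists w : {fset V} -> 'rV[L]_3, forall t, t \in simplices K 2 ->
    forall a b, a \in t -> b \in t -> map_mx D (X b - X a) = cross (w t) (X b - X a).
  have h t : exists w : 'rV[L]_3, t \in simplices K 2 ->
      forall a b, a \in t -> b \in t -> map_mx D (X b - X a) = cross w (X b - X a).
    have [tK|tK] := boolP (t \in simplices K 2); last by exists 0.
    by have [w wP] := face_velocity tK; exists w.
  by exists (fun t => projT1 (cid (h t))) => t; exact: (projT2 (cid (h t))).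
pose G t (e : V * V) := dot (w t) (X e.2 - X e.1).
pose turn s := \sum_(t <- simplices K 2)
   \sum_(e <- boundary o t | [fset e.1; e.2]%fset == s) G t e.
exists (fun s => (len s)^-1 * turn s); split; last first.
  rewrite big_seq (eq_bigr turn); last by move=> s sK; rewrite mulrA divff ?mul1r ?len_neq0.
  rewrite -big_seq /turn (sum_edges_faces Kc Ko) big_seq big1 // => t tK.
  rewrite /boundary; case: (o t) => [[a b] c].
  by rewrite !big_cons big_nil /G /=; vec_ring.
move=> s t1 t2 u v sK t1K t2K t12 sE uv uv1 vu2 only.
have turnE : turn s = dot (w t1 - w t2) (X v - X u).
  by rewrite /turn (sum_around_edge Ko G t1K t2K t12 sE uv uv1 vu2 only) /G /=; vec_ring.
have st (t : {fset V}) e : t \in simplices K 2 -> e \in boundary o t ->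
    e.1 \in t /\ e.2 \in t.
  by move=> tK /(boundary_sub Ko tK)/fsubsetP sub; split; apply: sub; rewrite !inE eqxx ?orbT.
have [/= u1 v1] := st _ _ t1K uv1; have [/= v2 u2] := st _ _ t2K vu2.
set e := generic_unit u v.
have De t : t \in simplices K 2 -> u \in t -> v \in t -> map_mx D e = cross (w t) e.
  move=> tK ut vt; rewrite /e /generic_unit derivation_scale // derivationV ?scale0r ?add0r.
    by rewrite (wP _ tK _ _ ut vt); vec_eq.
  by apply: Dlen; rewrite -sE.
have l0 : len s != 0 by exact: len_neq0.
have ee : dot e e = 1.
  rewrite /e /generic_unit -sE.
  transitivity ((len s)^-1 ^+ 2 * dot (X v - X u) (X v - X u)); first by vec_ring.
  by rewrite lenE -?sE // exprVn mulVf // expf_neq0.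
have orth a b t : t \in simplices K 2 -> (a, b) \in boundary o t ->
    dot (X b - X a) (generic_normal t) = 0.
  move=> tK; rewrite /boundary /generic_normal; case: (o t) => [[x y] z].
  by rewrite !inE => /or3P[] /eqP[-> ->]; vec_ring.
have Dn t : t \in simplices K 2 -> map_mx D ((nrm t)^-1 *: generic_normal t) =
    cross (w t) ((nrm t)^-1 *: generic_normal t).
  move=> tK; rewrite /generic_normal; have wt := wP _ tK.
  move: wt; case: (faceP Ko tK) => a b c tE _ _ _ wt.
  apply: normal_velocity => //; first by rewrite derivationV // Dnrm.
    by apply: wt; rewrite tE !inE eqxx ?orbT.
  by apply: wt; rewrite tE !inE eqxx ?orbT.
rewrite /rotor -/e.
rewrite (hinge_derivation derD ii Di ee _ (De _ t1K u1 v1) (De _ t2K u2 v2) (Dn _ t1K) (Dn _ t2K)).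
  congr (_ * _ * _); rewrite turnE /e /generic_unit -sE; vec_ring.
rewrite /e /generic_unit.
transitivity ((len [fset u; v]%fset)^-1 * (nrm t1)^-1 * dot (X v - X u) (generic_normal t1)).
  by vec_ring.
by rewrite orth // mulr0.
Qed.
End Schlafli.

(** * Integral relations between residues *)

Section ResidueRelation.
Variables (C L : fieldType) (c : {rmorphism C -> L}) (D : L -> L) (M : L -> Prop) (z : L).
Hypothesis res : dlog_residue c D M z.
Variables (I : eqType) (r : seq I).

Let derD : derivation D := res_deriv res.

Lemma dlog_exprz x (a : int) : x != 0 -> dlog D (x ^ a) = dlog D x *~ a.
Proof.
move=> x0.
have pos k : dlog D (x ^+ k) = dlog D x *+ k.
  elim: k => [|k IH]; first by rewrite expr0 mulr0n /dlog derivation1 // mul0r.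
  by rewrite exprS dlogM ?expf_neq0 // IH mulrS.
case: a => k; first by rewrite -exprnP pos pmulrn.
by rewrite NegzE -exprnN dlogV ?expf_neq0 // pos mulrNz pmulrn.
Qed.

Lemma dlog_prod_exprz (u : I -> L) (a : I -> int) : (forall s, s \in r -> u s != 0) ->
  dlog D (\prod_(s <- r) u s ^ a s) = \sum_(s <- r) dlog D (u s) *~ a s.
Proof.
elim: r => [|s q IH] u0; first by rewrite !big_nil /dlog derivation1 // mul0r.
have q0 x : x \in q -> u x != 0 by move=> xq; apply: u0; rewrite inE xq orbT.
have s0 : u s != 0 by apply: u0; rewrite inE eqxx.
rewrite !big_cons dlogM ?expfz_neq0 //; first by rewrite dlog_exprz // IH.
rewrite big_seq; apply: (big_ind (fun x => x != 0)); first exact: oner_neq0.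
  exact: mulf_neq0.
by move=> x xq; rewrite expfz_neq0 // q0.
Qed.

Lemma residue_sum (b : I -> C) (y : I -> L) (n : I -> int) :
  (forall s, s \in r -> M (y s - z *~ n s)) ->
  M (\sum_(s <- r) c (b s) * y s - c (\sum_(s <- r) b s * (n s)%:~R) * z).
Proof.
move=> My.
have -> : \sum_(s <- r) c (b s) * y s - c (\sum_(s <- r) b s * (n s)%:~R) * z =
    \sum_(s <- r) c (b s) * (y s - z *~ n s).
  rewrite rmorph_sum mulr_suml -sumrB; apply: eq_bigr => s _.
  by rewrite mulrBr rmorphM rmorph_int -mulrA; congr (_ - _ * _); rewrite mulrC mulrzr.
rewrite big_seq; apply: (big_ind M); first exact: res0 res.
  exact: resD res.
by move=> s /My; exact: resZ res _ _.
Qed.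

(** The integers n s are the residues of the D (u s) / u s.  The linear relation
    between the rho s is one between these logarithmic derivatives, so it passes
    to residues; and so does the multiplicative relation that expresses an element
    with residue d by the u s. *)
Lemma residue_relation (iota : C) (u rho : I -> L) (ell : I -> C) :
    (forall s, s \in r -> u s != 0) ->
    (forall s, s \in r -> D (u s) = - c iota * rho s * u s) ->
    \sum_(s <- r) c (ell s) * rho s = 0 ->
  exists n : I -> int, \sum_(s <- r) ell s * (n s)%:~R = 0 /\
    forall (a : I -> int) (d : nat), \sum_(s <- r) a s * n s = 0 ->
      dlog D (\prod_(s <- r) u s ^ a s) = z *+ d -> d%:R = 0 :> C.
Proof.
move=> u0 Du ell0.
have [n nP] : exists n : I -> int, forall s, s \in r -> M (dlog D (u s) - z *~ n s).
  have h s : exists k : int, s \in r -> M (dlog D (u s) - z *~ k).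
    have [sr|_] := boolP (s \in r); last by exists 0.
    by have [k kP] := res_dlog res (u0 s sr); exists k.
  by exists (fun s => projT1 (cid (h s))) => s; exact: (projT2 (cid (h s))).
exists n; split.
  have := residue_sum ell nP; rewrite (_ : \sum_(s <- r) c (ell s) * _ = 0); last first.
    transitivity (- c iota * \sum_(s <- r) c (ell s) * rho s); last first.
      by rewrite ell0 mulr0.
    rewrite mulr_sumr big_seq [RHS]big_seq; apply: eq_bigr => s sr.
    by rewrite /dlog Du // mulfK ?u0 //; ring.
  rewrite sub0r -mulNr -rmorphN => /(res_polar res) /eqP.
  by rewrite oppr_eq0 => /eqP.
move=> a d an0 Wd.
have := residue_sum (fun s => (a s)%:~R) nP.
rewrite (_ : \sum_(s <- r) c _ * _ = z *+ d); last first.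
  rewrite -Wd dlog_prod_exprz //; apply: eq_bigr => s _.
  by rewrite rmorph_int mulrC mulrzr.
rewrite (_ : \sum_(s <- r) _ = 0); last first.
  under eq_bigr do rewrite -intrM.
  by rewrite -(rmorph_sum (intmul 1)) /= an0.
rewrite rmorph0 mul0r subr0 (_ : z *+ d = c d%:R * z); last by rewrite rmorph_nat mulr_natl.
exact: res_polar res _.
Qed.
End ResidueRelation.

(** * Sequences represented in an algebraic extension *)

Section Representation.
Variables (R C L F : fieldType) (inc : {rmorphism R -> C}).
Variables (cls : {rmorphism (nat -> C) -> F}) (j : {rmorphism L -> F}).
Variable c : {rmorphism C -> L}.
Hypothesis jc : forall a, j (c a) = cls (fun=> a).

(** An element of L that corresponds to a sequence of real numbers in the
    ultrapower.  An identity between real sequences holds in L because j is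
    injective. *)
Definition represents (y : L) (f : nat -> R) := j y = cls (fun k => inc (f k)).

Definition represents_vector (Y : 'rV[L]_3) (f : nat -> 'rV[R]_3) :=
  [/\ represents (xc Y) (fun k => xc (f k)), represents (yc Y) (fun k => yc (f k))
    & represents (zc Y) (fun k => zc (f k))].

Lemma representsD y z f g : represents y f -> represents z g ->
  represents (y + z) (fun k => f k + g k).
Proof.
move=> yf zg; rewrite /represents rmorphD yf zg -rmorphD; congr (cls _).
by apply/funext => k; rewrite rmorphD.
Qed.

Lemma representsM y z f g : represents y f -> represents z g ->
  represents (y * z) (fun k => f k * g k).
Proof.
move=> yf zg; rewrite /represents rmorphM yf zg -rmorphM; congr (cls _).
by apply/funext => k; rewrite rmorphM.
Qed.

Lemma representsN y f : represents y f -> represents (- y) (fun k => - f k).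
Proof.
move=> yf; rewrite /represents rmorphN yf -rmorphN; congr (cls _).
by apply/funext => k; rewrite rmorphN.
Qed.

Lemma representsC a : represents (c (inc a)) (fun=> a).
Proof. exact: jc. Qed.

Lemma represents_const y f a : represents y f -> (forall k, f k = a) -> y = c (inc a).
Proof.
move=> yf fa; apply: (fmorph_inj j); rewrite yf jc; congr (cls _).
by apply/funext => k; rewrite fa.
Qed.

Lemma represents_ext y f g : represents y f -> f =1 g -> represents y g.
Proof. by move=> yf /funext <-. Qed.

Lemma represents_vectorB Y Z f g : represents_vector Y f -> represents_vector Z g ->
  represents_vector (Y - Z) (fun k => f k - g k).
Proof.
move=> [x1 y1 z1] [x2 y2 z2]; split; rewrite ?coordE.
- by apply: (represents_ext (representsD x1 (representsN x2))) => k; rewrite !coordE.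
- by apply: (represents_ext (representsD y1 (representsN y2))) => k; rewrite !coordE.
- by apply: (represents_ext (representsD z1 (representsN z2))) => k; rewrite !coordE.
Qed.

Lemma represents_vectorZ y f Z g : represents y f -> represents_vector Z g ->
  represents_vector (y *: Z) (fun k => f k *: g k).
Proof.
move=> yf [x2 y2 z2]; split; rewrite ?coordE.
- by apply: (represents_ext (representsM yf x2)) => k; rewrite !coordE.
- by apply: (represents_ext (representsM yf y2)) => k; rewrite !coordE.
- by apply: (represents_ext (representsM yf z2)) => k; rewrite !coordE.
Qed.

Lemma represents_cross Y Z f g : represents_vector Y f -> represents_vector Z g ->
  represents_vector (cross Y Z) (fun k => cross (f k) (g k)).
Proof.
have minor a b d e fa fb fd fe : represents a fa -> represents b fb ->
    represents d fd -> represents e fe ->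
    represents (a * b - d * e) (fun k => fa k * fb k - fd k * fe k).
  by move=> ? ? ? ?; apply: representsD; [|apply: representsN]; exact: representsM.
move=> [x1 y1 z1] [x2 y2 z2]; split; rewrite ?coordE.
- by apply: (represents_ext (minor _ _ _ _ _ _ _ _ y1 z2 z1 y2)) => k; rewrite !coordE.
- by apply: (represents_ext (minor _ _ _ _ _ _ _ _ z1 x2 x1 z2)) => k; rewrite !coordE.
- by apply: (represents_ext (minor _ _ _ _ _ _ _ _ x1 y2 y1 x2)) => k; rewrite !coordE.
Qed.

Lemma represents_dot Y Z f g : represents_vector Y f -> represents_vector Z g ->
  represents (dot Y Z) (fun k => dot (f k) (g k)).
Proof.
move=> [x1 y1 z1] [x2 y2 z2].
exact: representsD (representsD (representsM x1 x2) (representsM y1 y2)) (representsM z1 z2).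
Qed.

(** Negative powers are not ring operations on sequences; they are compatible with
    classes because e has no zero term. *)
Lemma cls_exprz (e : nat -> C) (a : int) : (forall k, e k != 0) ->
  cls (fun k => e k ^ a) = cls e ^ a.
Proof.
move=> e0.
have pos (f : nat -> C) p : cls (fun k => f k ^+ p) = cls f ^+ p.
  elim: p => [|p IH]; first by rewrite expr0 -[RHS](rmorph1 cls); congr (cls _).
  rewrite exprS -IH -rmorphM; congr (cls _); apply/funext => k; exact: exprS.
case: a => p; first exact: pos.
rewrite NegzE -[RHS]exprnN -[RHS]exprVn.
under eq_fun do rewrite -exprnN -exprVn.
rewrite (pos (fun k => (e k)^-1)); congr (_ ^+ _).
have h : cls (fun k => (e k)^-1) * cls e = 1.
  rewrite -rmorphM -[RHS](rmorph1 cls); congr (cls _); apply/funext => k.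
  exact: mulVf (e0 k).
have c0 : cls e != 0 by apply: contra_eq_neq h => ->; rewrite mulr0 eq_sym oner_neq0.
by apply: (mulIf c0); rewrite h mulVf.
Qed.

Lemma cls_prod_exprz (I : Type) (r : seq I) (e : I -> nat -> C) (a : I -> int) :
  (forall s k, e s k != 0) ->
  cls (fun k => \prod_(s <- r) e s k ^ a s) = \prod_(s <- r) cls (e s) ^ a s.
Proof.
move=> e0; elim: r => [|s r IH].
  rewrite big_nil -[RHS](rmorph1 cls); congr (cls _); apply/funext => k.
  by rewrite big_nil.
rewrite big_cons -IH -cls_exprz // -rmorphM; congr (cls _); apply/funext => k.
by rewrite big_cons.
Qed.
End Representation.

(** * A flex sampled at infinitely many times *)

Lemma periodic_int (U W : zmodType) (f : U -> W) (T : U) (m : int) (a : U) :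
  periodic f T -> f (a + T *~ m) = f a.
Proof.
move=> fT; case: m => p; first exact: periodicn.
by rewrite NegzE mulrNz -[in RHS](subrK (T *~ p.+1) a) -pmulrn periodicn.
Qed.

Section SampledFlex.
Variables (R : realType) (n : nat) (K : {fset {fset 'rV[R]_n}}).
Local Notation V := 'rV[R]_n.
Variable o : {fset V} -> V * V * V.
Hypotheses (Kc : strongly_connected_complex K) (Ko : orientation K o).
Variables (P : V -> 'rV[R]_3) (Pt : R -> V -> 'rV[R]_3).
Hypotheses (Pnd : nondegenerate_faces K P) (Pf : flex K P Pt).

Lemma edge_length_pair u v : u != v ->
  edge_length P [fset u; v]%fset ^+ 2 = dot (P v - P u) (P v - P u).
Proof.
move=> uv; rewrite /edge_length enorm_sqr.
have := fset_uniq [fset u; v]%fset; have : size (enum_fset [fset u; v]%fset) = 2%N.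
  by rewrite cardfs2 uv.
have : u \in enum_fset [fset u; v]%fset by rewrite !inE eqxx.
have : v \in enum_fset [fset u; v]%fset by rewrite !inE eqxx orbT.
case: (enum_fset _) => [|x [|y [|//]]] //= + + _ _; rewrite !inE.
move=> /orP[] /eqP vE /orP[] /eqP uE; move: uv; rewrite vE uE ?eqxx //= => _; vec_ring.
Qed.

(** The squared norm of a cross product is the Gram determinant of the factors. *)
Lemma face_normal_gram t s : t \in simplices K 2 -> 0 <= s <= 1 ->
  dot (face_normal o (Pt s) t) (face_normal o (Pt s) t) =
  dot (face_normal o P t) (face_normal o P t).
Proof.
move=> tK s01; have inner := flex_inner Ko Pnd Pf tK.
move: inner; rewrite /face_normal; case: (faceP Ko tK) => a b c tE _ _ _ inner.
have ta : a \in t by rewrite tE !inE eqxx.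
have tb : b \in t by rewrite tE !inE eqxx orbT.
have tc : c \in t by rewrite tE !inE eqxx orbT.
have gram (p q : 'rV[R]_3) : dot (cross p q) (cross p q) =
  dot p p * dot q q - dot p q ^+ 2 by vec_ring.
by rewrite !gram !inner.
Qed.

Variables (C : fieldType) (inc : {rmorphism R -> C}) (iota : C).
Hypothesis ii : iota * iota = -1.
Variable tk : nat -> R.
Hypothesis tk01 : forall k, 0 <= tk k <= 1.
Variable phi : {fset V} -> R -> R.
Hypothesis phiP : forall s, s \in simplices K 1 ->
  forall k, oriented_dihedral_angle K o (Pt (tk k)) s (phi s (tk k)).

(** The exponential exp(i x), with iota for i. *)
Definition phase (x : R) : C := inc (cos x) + iota * inc (sin x).

Lemma phase_conj x : phase x * (inc (cos x) - iota * inc (sin x)) = 1.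
Proof.
rewrite -(rmorph1 inc) -(cos2Dsin2 x) rmorphD !rmorphXn /phase.
transitivity (inc (cos x) ^+ 2 - (iota * iota) * inc (sin x) ^+ 2); first by ring.
by rewrite ii; ring.
Qed.

Lemma phase_neq0 x : phase x != 0.
Proof.
apply/eqP => p0; have := phase_conj x; rewrite p0 mul0r => /esym /eqP.
by rewrite oner_eq0.
Qed.

Lemma dihedral_cos_sin s t1 t2 u v k : s \in simplices K 1 ->
    t1 \in simplices K 2 -> t2 \in simplices K 2 -> s = [fset u; v]%fset -> u != v ->
    (u, v) \in boundary o t1 -> (v, u) \in boundary o t2 ->
    (forall t, t \in simplices K 2 -> (s `<=` t)%fset -> t = t1 \/ t = t2) ->
  let Q := Pt (tk k) in
  cos (phi s (tk k)) = - dot (normal o Q t1) (normal o Q t2) /\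
  sin (phi s (tk k)) = - dot (unit_edge Q u v) (cross (normal o Q t1) (normal o Q t2)).
Proof.
move=> sK t1K t2K sE uv uv1 vu2 only Q.
have [psi [m [psiP ->]]] := phiP sK k.
have Qn t : t \in simplices K 2 -> 0 < dot (face_normal o Q t) (face_normal o Q t).
  by move=> tK; rewrite /Q (face_normal_gram tK (tk01 k)); exact: (nondegenerate_normal Ko Pnd).
have := principal_value_angle Kc Ko (flex_polyhedron Pf (tk01 k)) Qn t1K t2K sE uv uv1 vu2
  only psiP.
have -> : 2 * pi * m%:~R = (pi *+ 2) *~ m :> R by rewrite mulrzr mulr_natl.
by move=> h; rewrite (periodic_int _ _ (@cosD2pi R)) (periodic_int _ _ (@sinD2pi R)); exact: h.
Qed.

Definition vertices : seq V := flatten [seq enum_fset t | t <- enum_fset (simplices K 2)].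

Lemma mem_vertices t v : t \in simplices K 2 -> v \in t -> v \in vertices.
Proof.
by move=> tK vt; apply/flattenP; exists (enum_fset t); [exact: map_f|].
Qed.

(** The integers n s are the residues of the exp(i phi_s).  The vertex coordinates
    at the times tk define positions X over the field L, with the edge lengths of P
    as constants, so the Schlaefli formula and the integrality of
    residues apply. *)
Lemma sampled_relation (w : nat -> C) (a : {fset V} -> int) : injective w ->
    (forall k, w k = \prod_(s <- simplices K 1) phase (phi s (tk k)) ^ a s) ->
  exists n : {fset V} -> int,
    \sum_(s <- simplices K 1) edge_length P s * (n s)%:~R = 0 /\
    \sum_(s <- simplices K 1) a s * n s != 0.
Proof.
move=> w_inj wE.
have charC : [pchar C] =i pred0 by move=> p; rewrite (fmorph_pchar inc) pchar_num.
(* The vertex positions at the sampled times, as sequences of scalars. *)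
pose coord v (i : 'I_3) : nat -> C := fun k => inc (Pt (tk k) v 0 i).
pose xs := [seq coord v i | v <- vertices, i <- enum 'I_3].
have [L [F [cls [j [c [D [M [z [res jc lift [W [d [jW Wd d0]]]]]]]]]]]] :=
  generic_point xs charC w_inj.
have derD := res_deriv res.
have charL : [pchar L] =i pred0 by move=> p; rewrite (fmorph_pchar c) charC.
have two_neq0 : 2%:R != 0 :> L.
  by rewrite -(rmorph_nat c) fmorph_eq0 -(rmorph_nat inc) fmorph_eq0 pnatr_eq0.
have lift' v i : exists y, v \in vertices -> j y = cls (coord v i).
  have [vV|_] := boolP (v \in vertices); last by exists 0.
  have [|y yP] := lift (coord v i); last by exists y.
  by apply: allpairs_f => //; rewrite mem_enum.
(* The generic position of the vertex v: its image under j is the class of the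
   sequence of its positions. *)
pose X v : 'rV[L]_3 := \row_i projT1 (cid (lift' v i)).
have repX v : v \in vertices -> represents_vector inc cls j (X v) (fun k => Pt (tk k) v).
  by move=> vV; split; rewrite /represents /xc /yc /zc mxE;
     exact: (projT2 (cid (lift' v _)) vV).
have repXB t u v : t \in simplices K 2 -> u \in t -> v \in t ->
    represents_vector inc cls j (X v - X u) (fun k => Pt (tk k) v - Pt (tk k) u).
  move=> tK ut vt; apply: represents_vectorB; apply: repX.
    exact: (mem_vertices tK vt).
  exact: (mem_vertices tK ut).
(* The Gram matrices of the faces are constants, as they are so at each time. *)
have dotX t u v x : t \in simplices K 2 -> u \in t -> v \in t -> x \in t ->
    dot (X v - X u) (X x - X u) = c (inc (dot (P v - P u) (P x - P u))).
  move=> tK ut vt xt.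
  apply: (represents_const jc (represents_dot (repXB _ _ _ tK ut vt) (repXB _ _ _ tK ut xt))).
  by move=> k; apply: (flex_inner Ko Pnd Pf tK).
have Dc x : D (c x) = 0 by exact: (res_const res).
pose N t := dot (face_normal o P t) (face_normal o P t).
have N0 t : t \in simplices K 2 -> 0 < N t by exact: (nondegenerate_normal Ko Pnd).
have repN t : t \in simplices K 2 ->
    represents_vector inc cls j (generic_normal o X t) (fun k => face_normal o (Pt (tk k)) t).
  move=> tK; have := repXB t; rewrite /generic_normal /face_normal.
  case: (faceP Ko tK) => A B E tE _ _ _ rep.
  by apply: represents_cross; apply: rep => //; rewrite tE !inE eqxx ?orbT.
have NN t : t \in simplices K 2 ->
    dot (generic_normal o X t) (generic_normal o X t) = c (inc (N t)).
  move=> tK; apply: (represents_const jc (represents_dot (repN _ tK) (repN _ tK))).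
  by move=> k; apply: face_normal_gram.
pose nrm t := c (inc (Num.sqrt (N t))).
pose len s := c (inc (edge_length P s)).
have sub_face s : s \in simplices K 1 -> exists2 t, t \in simplices K 2 & (s `<=` t)%fset.
  by move=> /simplicesP[sK _]; exact: (scc_pure Kc sK).
have lenE u v : [fset u; v]%fset \in simplices K 1 -> u != v ->
    dot (X v - X u) (X v - X u) = len [fset u; v]%fset ^+ 2.
  move=> sK uv; have [t tK /fsubsetP st] := sub_face _ sK.
  have ut : u \in t by apply: st; rewrite !inE eqxx.
  have vt : v \in t by apply: st; rewrite !inE eqxx orbT.
  by rewrite (dotX t) // -edge_length_pair // !rmorphXn.
have len_neq0 s : s \in simplices K 1 -> len s != 0.
  move=> sK; have [t1 t2 u v t1K _ _ sE uv uv1 _ _] := edgeP Kc Ko sK.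
  have := edge_positive Ko (fun t => @nondegenerate_normal _ _ _ _ Ko _ t Pnd) t1K uv1.
  rewrite -edge_length_pair // -sE /len fmorph_eq0 fmorph_eq0.
  by apply: contraTneq => ->; rewrite expr0n ltxx.
have normal_neq0 t : t \in simplices K 2 ->
    dot (generic_normal o X t) (generic_normal o X t) != 0.
  by move=> tK; rewrite NN // !fmorph_eq0 gt_eqF // N0.
have cii : c iota * c iota = -1 by rewrite -rmorphM ii rmorphN1.
have [rho [rhoP rho0]] := @schlafli_formula R n K o Kc Ko L D derD two_neq0 X len nrm (c iota)
  cii (Dc _) (fun t u v x tK ut vt xt => etrans (congr1 D (dotX t u v x tK ut vt xt)) (Dc _))
  normal_neq0 (fun _ _ => Dc _) (fun _ _ => Dc _) lenE len_neq0.
(* U s is the class of the sequence exp(i phi_s(tk)). *)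
have rotors s : exists U, s \in simplices K 1 ->
    j U = cls (fun k => phase (phi s (tk k))) /\ D U = - c iota * rho s * U.
  have [sK|_] := boolP (s \in simplices K 1); last by exists 0.
  have [t1 t2 u v t1K t2K t12 sE uv uv1 vu2 only] := edgeP Kc Ko sK.
  exists (rotor o X len nrm (c iota) t1 t2 u v) => _; split; last exact: rhoP.
  have repn t : t \in simplices K 2 -> represents_vector inc cls j
      ((nrm t)^-1 *: generic_normal o X t) (fun k => normal o (Pt (tk k)) t).
    move=> tK; have h := represents_vectorZ (representsC inc jc (Num.sqrt (N t))^-1) (repN _ tK).
    rewrite /nrm -!fmorphV; move: h.
    congr (represents_vector _ _ _ _ _); apply/funext => k.
    by rewrite normal_face (face_normal_gram tK (tk01 k)).
  have ut : u \in t1.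
    by have /fsubsetP := boundary_sub Ko t1K uv1; apply; rewrite !inE eqxx.
  have vt : v \in t1.
    by have /fsubsetP := boundary_sub Ko t1K uv1; apply; rewrite !inE eqxx orbT.
  have repe : represents_vector inc cls j (generic_unit X len u v)
      (fun k => unit_edge (Pt (tk k)) u v).
    have := represents_vectorZ (representsC inc jc (edge_length P s)^-1) (repXB _ _ _ t1K ut vt).
    rewrite /generic_unit -sE /len -!fmorphV.
    congr (represents_vector _ _ _ _ _); apply/funext => k.
    rewrite /unit_edge enormE (flex_distance Ko Pnd Pf t1K vt ut (tk01 k)).
    by rewrite -edge_length_pair // -sE sqrtr_sqr ger0_norm // sqrtr_ge0.
  have repc := representsN (represents_dot (repn _ t1K) (repn _ t2K)).
  have reps := representsN (represents_dot repe (represents_cross (repn _ t1K) (repn _ t2K))).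
  have angle k := dihedral_cos_sin k sK t1K t2K sE uv uv1 vu2 only.
  have {}repc := represents_ext repc (fun k => esym (angle k).1).
  have {}reps := represents_ext reps (fun k => esym (angle k).2).
  (* The cosine and the sine of the angle are the two parts of the rotor. *)
  rewrite /rotor -mulrN rmorphD rmorphM /= jc repc reps -rmorphM -rmorphD.
  by congr (cls _).
pose U s := projT1 (cid (rotors s)).
have UP s (sK : s \in simplices K 1) := projT2 (cid (rotors s)) sK.
have U0 s : s \in simplices K 1 -> U s != 0.
  move=> sK; have [jU _] := UP s sK; apply/eqP => Us0.
  have : cls (fun k => phase (phi s (tk k))) *
      cls (fun k => inc (cos (phi s (tk k))) - iota * inc (sin (phi s (tk k)))) = 1.
    rewrite -rmorphM -[RHS](rmorph1 cls); congr (cls _); apply/funext => k.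
    exact: phase_conj.
  by rewrite -jU -/(U s) Us0 rmorph0 mul0r => /esym /eqP; rewrite oner_eq0.
have [N' [ell0 aN]] := residue_relation res U0 (fun s sK => (UP s sK).2) rho0.
exists N'; split.
  apply: (fmorph_inj inc); rewrite rmorph0 -ell0 rmorph_sum; apply: eq_bigr => s _.
  by rewrite rmorphM rmorph_int.
(* The given expression of w as a product holds in L as well. *)
apply/eqP => an0; have WE : W = \prod_(s <- simplices K 1) U s ^ a s.
  apply: (fmorph_inj j); rewrite jW rmorph_prod.
  transitivity (\prod_(s <- simplices K 1) cls (fun k => phase (phi s (tk k))) ^ a s).
    rewrite -cls_prod_exprz; last by move=> s k; exact: phase_neq0.
    by congr (cls _); apply/funext.
  by rewrite big_seq [RHS]big_seq; apply: eq_bigr => s sK; rewrite fmorphXz (UP s sK).1.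
have := aN a d an0; rewrite -WE => /(_ Wd) /eqP.
by rewrite ((pcharf0P C).1 charC) (gtn_eqF d0).
Qed.
End SampledFlex.

(** * Constancy of the Dehn invariants *)

Lemma common_denominator (I : eqType) (r : seq I) (q : I -> rat) :
  exists2 N : nat, (0 < N)%N &
  exists a : I -> int, forall s, s \in r -> q s * N%:R = (a s)%:~R.
Proof.
suff [N N0 NP] : exists2 N : nat, (0 < N)%N &
    forall s, s \in r -> exists k : int, q s * N%:R = k%:~R.
  exists N => //.
  have h s : exists k : int, s \in r -> q s * N%:R = k%:~R.
    have [/NP[k kP]|_] := boolP (s \in r); last by exists 0.
    by exists k.
  by exists (fun s => projT1 (cid (h s))) => s; exact: (projT2 (cid (h s))).
elim: r => [|x r [N N0 NP]]; first by exists 1%N.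
have d0 := denq_gt0 (q x); exists (N * `|denq (q x)|)%N.
  by rewrite muln_gt0 N0 absz_gt0 gt_eqF.
have dE : (`|denq (q x)|%N)%:R = (denq (q x))%:~R :> rat.
  by rewrite -[in RHS](gtz0_abs d0) -pmulrn.
move=> s; rewrite natrM dE inE => /orP[/eqP ->|/NP[k kP]].
  exists (numq (q x) * N%:Z); rewrite mulrCA rmorphM /= -pmulrn mulrC; congr (_ * _).
  by rewrite -[X in X * _]divq_num_den divfK // intr_eq0 gt_eqF.
by exists (k * denq (q x)); rewrite rmorphM /= -kP mulrA.
Qed.

Section Phase.
Variables (R : realType) (C : fieldType) (inc : {rmorphism R -> C}) (iota : C).
Hypothesis ii : iota * iota = -1.
Local Notation phase := (phase inc iota).

Lemma phase0 : phase 0 = 1.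
Proof. by rewrite /phase cos0 sin0 rmorph0 rmorph1 mulr0 addr0. Qed.

Lemma phaseD x y : phase (x + y) = phase x * phase y.
Proof.
rewrite /phase cosD sinD rmorphB rmorphD !rmorphM.
transitivity (inc (cos x) * inc (cos y) + (iota * iota) * (inc (sin x) * inc (sin y)) +
  iota * (inc (sin x) * inc (cos y) + inc (cos x) * inc (sin y))); first by rewrite ii; ring.
by ring.
Qed.

Lemma phaseMz x (a : int) : phase (x * a%:~R) = phase x ^ a.
Proof.
have pos k : phase (x * k%:R) = phase x ^+ k.
  elim: k => [|k IH]; first by rewrite mulr0 phase0.
  by rewrite -natr1 mulrDr mulr1 phaseD IH exprSr.
case: a => k; first exact: pos.
rewrite NegzE -exprnN -pos.
have p0 : phase (x * k.+1%:R) != 0 by exact: phase_neq0.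
apply: (mulIf p0); rewrite mulVf // -phaseD rmorphN /= -pmulrn mulrN addNr.
exact: phase0.
Qed.

Lemma phase_sum (I : Type) (r : seq I) (x : I -> R) (a : I -> int) :
  phase (\sum_(s <- r) x s * (a s)%:~R) = \prod_(s <- r) phase (x s) ^ a s.
Proof.
by elim: r => [|s r IH]; rewrite ?big_nil ?phase0 // !big_cons phaseD phaseMz IH.
Qed.

Hypothesis independent : forall a b, inc a + iota * inc b = 0 -> a = 0 /\ b = 0.

Lemma phase_inj x y : `|x - y| <= 1 -> phase x = phase y -> x = y.
Proof.
move=> xy1 /eqP; rewrite -subr_eq0 => /eqP E.
have [/eqP] : cos x - cos y = 0 /\ sin x - sin y = 0.
  apply: independent; rewrite -{}E /phase !rmorphB; ring.
rewrite subr_eq0 => /eqP cE /eqP; rewrite subr_eq0 => /eqP sE.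
(* Equal exponentials differ by the angle x - y of cosine 1. *)
have c1 : cos `|x - y| = 1.
  have -> : cos `|x - y| = cos (x - y).
    by have [_|_] := ger0P (x - y); rewrite ?cosN.
  by rewrite cosB cE sE -!expr2 cos2Dsin2.
have pi1 : 1 <= pi :> R by apply: le_trans (pi_ge2 R); lra.
have : `|x - y| = 0.
  apply: cos_inj; last by rewrite c1 cos0.
    by rewrite in_itv /= normr_ge0 (le_trans xy1).
  by rewrite in_itv /= lexx pi_ge0.
by move/normr0_eq0/eqP; rewrite subr_eq0 => /eqP.
Qed.
End Phase.

(** The distance at most 1, less than a half-turn, ensures that the exponentials of
    the values are distinct as well. *)
Lemma distinct_values (R : realType) (lo hi : R) : lo < hi ->
  exists y : nat -> R, [/\ injective y, forall k, lo <= y k <= hi &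
    forall k l, `|y k - y l| <= 1].
Proof.
move=> lt; pose h := Num.min 1 (hi - lo).
have h0 : 0 < h by rewrite lt_min ltr01 subr_gt0.
have h1 : h <= 1 by rewrite ge_min lexx.
have hh : h <= hi - lo by rewrite ge_min lexx orbT.
clearbody h; have y01 k : 0 <= h / k.+1%:R <= h.
  apply/andP; split; first exact: divr_ge0 (ltW h0) (ler0n _ _).
  by rewrite ler_pdivrMr ?ltr0n // ler_peMr ?(ltW h0) // ler1n.
exists (fun k => lo + h / k.+1%:R); split.
- move=> k l /addrI /(mulfI (lt0r_neq0 h0)) /invr_inj /eqP.
  by rewrite eqr_nat eqSS => /eqP.
- by move=> k /=; have /andP[a b] := y01 k; rewrite lerDl a -lerBrDl (le_trans b).
move=> k l /=; have := y01 l; have := y01 k.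
move: (h / k.+1%:R) (h / l.+1%:R) => x y /andP[x0 xh] /andP[y0 yh].
by rewrite ler_norml; apply/andP; split; lra.
Qed.

Section Dehn.
Variables (R : realType) (m : nat) (lam : 'I_m -> R) (I : eqType) (r : seq I).

Lemma continuous_weighted_sum (c : I -> R) (phi : I -> R -> R) :
  (forall s, s \in r -> {within `[0, 1], continuous (phi s)}) ->
  {within `[0, 1], continuous (fun t => \sum_(s <- r) c s * phi s t)}.
Proof.
elim: r => [|s q IH] phic.
  have -> : (fun t => \sum_(s <- [::]) c s * phi s t) = (fun=> 0).
    by apply/funext => t; rewrite big_nil.
  by move=> x; exact: cvg_cst.
have -> : (fun t => \sum_(x <- s :: q) c x * phi x t) =
    (fun t => c s * phi s t + \sum_(x <- q) c x * phi x t).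
  by apply/funext => t; rewrite big_cons.
have h : {within `[0, 1], continuous (fun t => \sum_(s <- q) c s * phi s t)}.
  by apply: IH => x xq; apply: phic; rewrite inE xq orbT.
have hs : {within `[0, 1], continuous (phi s)} by apply: phic; rewrite inE eqxx.
have hc : {within `[0, 1], continuous (fun t => c s * phi s t)}.
  by move=> x; apply: cvgM; [exact: cvg_cst|exact: hs].
by move=> x; apply: cvgD; [exact: hc|exact: h].
Qed.

(** The coefficient of lam j in the relation, which is rational, must vanish. *)
Lemma rational_relation (ell : I -> R) (alpha : I -> 'I_m -> rat) (k : I -> int) j :
  Q_independent lam ->
  (forall s, s \in r -> ell s = \sum_(j < m) ratr (alpha s j) * lam j) ->
  \sum_(s <- r) ell s * (k s)%:~R = 0 ->
  \sum_(s <- r) alpha s j * (k s)%:~R = 0.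
Proof.
move=> indep ellE rel; apply: (indep (fun j => \sum_(s <- r) alpha s j * (k s)%:~R)).
rewrite -[RHS]rel; under eq_bigr do rewrite rmorph_sum mulr_suml.
rewrite exchange_big /= big_seq [RHS]big_seq; apply: eq_bigr => s sr.
rewrite ellE // mulr_suml; apply: eq_bigr => i _.
by rewrite rmorphM /= ratr_int mulrAC.
Qed.
End Dehn.

Theorem theorem3 (R : realType) (n : nat) (K : {fset {fset 'rV[R]_n}})
  (o : {fset 'rV[R]_n} -> 'rV[R]_n * 'rV[R]_n * 'rV[R]_n)
  (P : 'rV[R]_n -> 'rV[R]_3)
  (m : nat) (lam : 'I_m -> R) (alpha : {fset 'rV[R]_n} -> 'I_m -> rat)
  (Kcomplex : strongly_connected_complex K)
  (Koriented : orientation K o)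
  (Ppoly : polyhedron K P)
  (Pnondeg : nondegenerate_faces K P)
  (lam_basis : Q_basis_of_span lam (edge_lengths K P))
  (alphaE : forall s, s \in simplices K 1 ->
     edge_length P s = \sum_(j < m) ratr (alpha s j) * lam j)
  (Pt : R -> 'rV[R]_n -> 'rV[R]_3)
  (Pflex : flex K P Pt)
  (phi : {fset 'rV[R]_n} -> R -> R)
  (phiP : forall s, s \in simplices K 1 ->
     dihedral_angle_during K o P Pt s (phi s))
  (j : 'I_m) (t t' : R) (ht : 0 <= t <= 1) (ht' : 0 <= t' <= 1) :
  \sum_(s <- simplices K 1) ratr (alpha s j) * phi s t =
  \sum_(s <- simplices K 1) ratr (alpha s j) * phi s t'.
Proof.
wlog tt' : t t' ht ht' / t <= t'.
  move=> wlg; have [/wlg|/ltW/wlg h] := leP t t'; first exact.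
  by apply/esym/h.
have [N N0 [a aE]] := common_denominator (simplices K 1) (alpha ^~ j).
pose S x := \sum_(s <- simplices K 1) ratr (alpha s j) * phi s x.
apply: contrapT => /eqP; rewrite -/(S t) -/(S t') => neq.
pose g x := N%:R * S x.
have Nn : N%:R != 0 :> R by rewrite pnatr_eq0 -lt0n.
have gE x : g x = \sum_(s <- simplices K 1) phi s x * (a s)%:~R.
  rewrite /g /S mulr_sumr big_seq [RHS]big_seq; apply: eq_bigr => s sK.
  rewrite mulrA [RHS]mulrC; congr (_ * _).
  by rewrite -(ratr_int R) -(aE _ sK) rmorphM /= ratr_nat mulrC.
have gc : {within `[t, t'], continuous g}.
  have Sc : {within `[0, 1], continuous S}.
    by apply: continuous_weighted_sum => s /phiP[].
  have Sc' : {within `[t, t'], continuous S}.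
    apply: continuous_subspaceW Sc => x /=; rewrite !in_itv /= => /andP[tx xt].
    by rewrite (le_trans (andP ht).1 tx) (le_trans xt (andP ht').2).
  by move=> x; apply: cvgM; [exact: cvg_cst|exact: Sc'].
have lt : Num.min (g t) (g t') < Num.max (g t) (g t').
  have gn : g t != g t' by apply: contra neq => /eqP /(mulfI Nn) /eqP.
  have [h|h|h] := ltgtP (g t) (g t'); [by []|by []|].
  by rewrite h eqxx in gn.
have [y [y_inj ymem ydist]] := distinct_values lt.
(* The intermediate value theorem yields the times at which g = N S takes the
   values y k. *)
have tkP k : exists x, 0 <= x <= 1 /\ g x = y k.
  have [x] := IVT tt' gc (ymem k); rewrite in_itv /= => /andP[tx xt] gx; exists x; split=> //.
  by rewrite (le_trans (andP ht).1 tx) (le_trans xt (andP ht').2).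
pose tk k := projT1 (cid (tkP k)).
have tk01 k : 0 <= tk k <= 1 by exact: (projT2 (cid (tkP k))).1.
have gtk k : g (tk k) = y k by exact: (projT2 (cid (tkP k))).2.
pose inc : {rmorphism R -> R[i]} := real_complex R.
pose iota : R[i] := Complex 0 1.
have ii : iota * iota = -1 by rewrite -expr2 sqr_i.
have independent (b c : R) : inc b + iota * inc c = 0 -> b = 0 /\ c = 0.
  move=> /eqP; rewrite eq_complex /= => /andP[/eqP + /eqP].
  by rewrite !(mul0r, mul1r, mulr0, add0r, addr0, subr0, subrr) => -> ->.
have w_inj : injective (fun k => phase inc iota (y k)).
  by move=> k l /(phase_inj independent (ydist k l)) /y_inj.
have wE k : phase inc iota (y k) =
    \prod_(s <- simplices K 1) phase inc iota (phi s (tk k)) ^ a s.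
  by rewrite -gtk gE phase_sum.
have [nu [ell0 /eqP]] := sampled_relation Kcomplex Koriented Pnondeg Pflex ii tk01
  (fun s sK k => dihedral_mem (phiP s sK) (tk01 k)) w_inj wE.
apply; apply: (@intr_inj rat); rewrite rmorph_sum /=.
have rel := rational_relation j lam_basis.1 alphaE ell0.
transitivity (N%:R * \sum_(s <- simplices K 1) alpha s j * (nu s)%:~R); last first.
  by rewrite rel mulr0.
rewrite mulr_sumr big_seq [RHS]big_seq; apply: eq_bigr => s sK.
by rewrite rmorphM /= -(aE _ sK) mulrA [N%:R * _]mulrC.
Qed.
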